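(* Let $S\subset\mathbb{C}^n$ be a pseudoconvex smooth real hypersurface through $0$, and let $O,V\subset\mathbb{C}^n$ be respectively a real and a complex formal submanifold with $O\subset V$. Assume: (1) $O$ is generic in $V$ in the sense that $T_0O+JT_0O=T_0V$; (2) $O$ is contained in $S$ in the formal sense, i.e. $O\subset j_0^\infty S$; (3) $O$ is complex-tangential to $j_0^\infty S$ in the sense that $D_O\subset j_0^\infty HS \mod I(O)$; (4) $O$ is of finite commutator type, i.e. $\mathsf{Lie}(D^{10}_O\oplus\overline{D^{10}_O})(0)=\mathbb{C}T_0O$. Then $V$ is tangent to $S$ of infinite order or, equivalently, formally contained in $S$, i.e. $V\subset j_0^\infty S$. In particular, if $\dim_{\mathbb{C}}V\ge1$, then $S$ is of infinite regular type at $0$.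
   Context: $S$ is pseudoconvex if for every $p\in S$ there is a purely imaginary contact form $\theta$ near $p$ in $S$ (a nonzero $1$-form on $S$ vanishing on $\mathbb{C}HS=H^{10}S\oplus\overline{H^{10}S}$) with $\theta([L,\overline{L}])\ge0$ for all local sections $L$ of $H^{10}S$. Here $HS$ is the complex tangent bundle and $H^{10}S$ the bundle of $(1,0)$ tangent vectors. $J$ is the standard complex structure of $\mathbb{C}^n\cong\mathbb{R}^{2n}$. Formal submanifolds. For $\mathbb{K}=\mathbb{R}$ or $\mathbb{C}$, a manifold ideal $I\subset\mathbb{K}[[x_1,\ldots,x_m]]$ is an ideal generated by $k$ elements $F_1,\ldots,F_k$ with $F_j(0)=0$ and linearly independent differentials $dF_1(0),\ldots,dF_k(0)$; it defines (is identified with) a formal submanifold $O$ of $\mathbb{K}^m$ of codimension $k$, dimension $m-k$, with $I(O)=I$. Inclusion $X\subset Y$ means $I(Y)\subset I(X)$. The tangent space is $T_0O=\{\xi: df_0(\xi)=0\ \forall f\in I(O)\}$. A real formal submanifold $O\subset\mathbb{C}^n$ is one of $\mathbb{R}^{2n}$, with complexified ideal $\mathbb{C}I(O)=I(O)+iI(O)\subset\mathbb{C}[[z,\bar z]]$. A complex formal submanifold $V\subset\mathbb{C}^n$ is given by a manifold ideal $I(V)\subset\mathbb{C}[[z]]$ and is also regarded as the real formal submanifold whose complexified ideal in $\mathbb{C}[[z,\bar z]]$ is generated by $I(V)$ and the conjugates of its elements; inclusion $O\subset V$ and $T_0V$ are understood in this real sense. $j_0^\infty S$ is the real formal submanifold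 whose ideal consists of the Taylor series at $0$ of smooth real functions near $0$ vanishing on $S$. Vector fields. $D_O$ is the space of real formal vector fields $L$ (formal power series coefficients) in $\mathbb{R}^{2n}$ with $L(I(O))\subset I(O)$. $D^{10}_O$ is the space of formal vector fields $L=\sum_ja_j(z,\bar z)\partial_{z_j}$, $a_j\in\mathbb{C}[[z,\bar z]]$, with $L(\mathbb{C}I(O))\subset\mathbb{C}I(O)$, and $\overline{D^{10}_O}$ its conjugate. $j_0^\infty HS$ is the set of Taylor series at $0$ of smooth real vector fields $L$ near $0$ in $\mathbb{C}^n$ with $L|_S$ a section of $HS$. For a set $A$ of formal vector fields, $D_O\subset A\mod I(O)$ means every element of $D_O$ differs from an element of $A$ by a formal vector field with coefficients in $I(O)$. $\mathsf{Lie}(\cdot)$ is the generated Lie algebra (under Lie bracket), and $(0)$ denotes the set of values at $0$. $\mathbb{C}T_0O$ is the complexification of $T_0O$. Regular type. The regular type of $S$ at $0$ is the supremum over germs of holomorphic immersions $\gamma\colon(\mathbb{C},0)\to(\mathbb{C}^n,0)$ of the vanishing order at $0$ of $r\circ\gamma$, where $r$ is a local defining function of $S$. *)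

(* Defs.v *)
From HB Require Import structures.
From mathcomp Require Import all_boot all_order all_algebra.
From mathcomp Require Import all_classical all_reals all_analysis.
From mathcomp Require Import complex.

Set Implicit Arguments.
Unset Strict Implicit.
Unset Printing Implicit Defensive.

Import Order.TTheory GRing.Theory Num.Theory.
Import numFieldNormedType.Exports.

Local Open Scope classical_set_scope.
Local Open Scope ring_scope.
Local Open Scope complex_scope.

Notation multi_index m := {ffun 'I_m -> nat}.

Section MultiIndex.
Context {m : nat}.
Implicit Types a b : multi_index m.

Definition mi0 : multi_index m := [ffun=> 0%N].
Definition mi1 (i : 'I_m) : multi_index m := [ffun j => (j == i) : nat].
Definition mi_add a b : multi_index m := [ffun i => (a i + b i)%N].
Definition mi_deg a : nat := (\sum_i a i)%N.

Definition mi_val d (b : {ffun 'I_m -> 'I_d}) : multi_index m :=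
  [ffun i => nat_of_ord (b i)].

Definition mi_below a : seq (multi_index m) :=
  [seq b : multi_index m <- map (@mi_val (mi_deg a).+1) (enum {ffun 'I_m -> 'I_(mi_deg a).+1})
  | [forall i, b i <= a i]%N].

Definition mi_splits a : seq (multi_index m * multi_index m) :=
  [seq (b, [ffun i => (a i - b i)%N]) | b <- mi_below a].

Lemma mem_mi_below a b : (b \in mi_below a) = [forall i, b i <= a i]%N.
Proof.
rewrite mem_filter; case: forallP => //= ba.
have bd i : (b i < (mi_deg a).+1)%N.
  by rewrite ltnS (leq_trans (ba i)) // /mi_deg (bigD1 i) //= leq_addr.
apply/mapP; exists [ffun i => Ordinal (bd i)]; first by rewrite mem_enum.
by apply/ffunP => i; rewrite !ffunE.
Qed.

Lemma mem_mi_splits a p : (p \in mi_splits a) = (mi_add p.1 p.2 == a).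
Proof.
apply/mapP/eqP => [[b + ->]|<-] /=.
  rewrite mem_mi_below => /forallP ba.
  by apply/ffunP => i; rewrite !ffunE subnKC.
exists p.1; first by rewrite mem_mi_below; apply/forallP => i; rewrite ffunE leq_addr.
by case: p => b c /=; congr pair; apply/ffunP => i; rewrite !ffunE addKn.
Qed.

Lemma mi_splits_uniq a : uniq (mi_splits a).
Proof.
rewrite map_inj_uniq => [|b c [] //].
rewrite filter_uniq // map_inj_uniq ?enum_uniq // => b c /ffunP bc.
by apply/ffunP => i; apply/val_inj; have := bc i; rewrite !ffunE.
Qed.

Lemma mi_addA : associative mi_add.
Proof. by move=> a b c; apply/ffunP => i; rewrite !ffunE addnA. Qed.

Lemma mi_addC : commutative mi_add.
Proof. by move=> a b; apply/ffunP => i; rewrite !ffunE addnC. Qed.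

Lemma mi_add0 : left_id mi0 mi_add.
Proof. by move=> a; apply/ffunP => i; rewrite !ffunE. Qed.

End MultiIndex.

Record fps (m : nat) (K : Type) := Fps { fps_coef : multi_index m -> K }.

HB.instance Definition _ m (K : Type) := gen_eqMixin (fps m K).
HB.instance Definition _ m (K : Type) := gen_choiceMixin (fps m K).

Lemma fps_ext m (K : Type) (f g : fps m K) : fps_coef f =1 fps_coef g -> f = g.
Proof. by case: f g => [f] [g] /= /funext ->. Qed.

Section FpsRing.
Context {m : nat} {K : comNzRingType}.
Implicit Types f g h : fps m K.

Definition fps_zero : fps m K := Fps (fun=> 0).
Definition fps_one : fps m K := Fps (fun a => (a == mi0)%:R).
Definition fps_opp f : fps m K := Fps (fun a => - fps_coef f a).
Definition fps_add f g : fps m K := Fps (fun a => fps_coef f a + fps_coef g a).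
Definition fps_scale (c : K) f : fps m K := Fps (fun a => c * fps_coef f a).
Definition fps_mul f g : fps m K :=
  Fps (fun a => \sum_(p <- mi_splits a) fps_coef f p.1 * fps_coef g p.2).

Fact fps_addA : associative fps_add.
Proof. by move=> f g h; apply: fps_ext => a /=; rewrite addrA. Qed.
Fact fps_addC : commutative fps_add.
Proof. by move=> f g; apply: fps_ext => a /=; rewrite addrC. Qed.
Fact fps_add0 : left_id fps_zero fps_add.
Proof. by move=> f; apply: fps_ext => a /=; rewrite add0r. Qed.
Fact fps_addN : left_inverse fps_zero fps_opp fps_add.
Proof. by move=> f; apply: fps_ext => a /=; rewrite addNr. Qed.

HB.instance Definition _ :=
  GRing.isZmodule.Build (fps m K) fps_addA fps_addC fps_add0 fps_addN.

Fact fps_mulA : associative fps_mul.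
Proof.
move=> f g h; apply: fps_ext => a /=.
under eq_bigr do rewrite big_distrr /=.
under [RHS]eq_bigr do rewrite big_distrl /=.
pose F (t : multi_index m * multi_index m * multi_index m) :=
  fps_coef f t.1.1 * fps_coef g t.1.2 * fps_coef h t.2.
pose s1 := [seq (p.1, q.1, q.2) | p <- mi_splits a, q <- mi_splits p.2].
pose s2 := [seq (q.1, q.2, p.2) | p <- mi_splits a, q <- mi_splits p.1].
transitivity (\sum_(t <- s1) F t).
  rewrite big_allpairs_dep; apply: eq_bigr => p _; apply: eq_bigr => q _.
  by rewrite /F mulrA.
transitivity (\sum_(t <- s2) F t); last first.
  by rewrite big_allpairs_dep; apply: eq_bigr => p _; apply: eq_bigr => q _.
apply: perm_big; apply: uniq_perm.
- apply: allpairs_uniq_dep => [|p _|]; rewrite ?mi_splits_uniq //.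
  move=> [[p1 p2] [q1 q2]] [[p1' p2'] [q1' q2']] /=.
  move=> /allpairsPdep[p [q [_ + [e1 e2]]]] /allpairsPdep[p' [q' [_ + [e1' e2']]]].
  subst p q p' q'; rewrite !mem_mi_splits /= => /eqP <- /eqP <-.
  by case=> -> -> ->.
- apply: allpairs_uniq_dep => [|p _|]; rewrite ?mi_splits_uniq //.
  move=> [[p1 p2] [q1 q2]] [[p1' p2'] [q1' q2']] /=.
  move=> /allpairsPdep[p [q [_ + [e1 e2]]]] /allpairsPdep[p' [q' [_ + [e1' e2']]]].
  subst p q p' q'; rewrite !mem_mi_splits /= => /eqP <- /eqP <-.
  by case=> -> -> ->.
move=> [[x y] z]; apply/allpairsPdep/allpairsPdep => -[p [q []]].
  rewrite !mem_mi_splits => /eqP pa /eqP qp [-> -> ->].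
  exists (mi_add p.1 q.1, q.2), (p.1, q.1); rewrite !mem_mi_splits /=.
  by rewrite eqxx -mi_addA qp pa.
rewrite !mem_mi_splits => /eqP pa /eqP qp [-> -> ->].
exists (q.1, mi_add q.2 p.2), (q.2, p.2); rewrite !mem_mi_splits /=.
by rewrite eqxx mi_addA qp pa.
Qed.

Fact fps_mulC : commutative fps_mul.
Proof.
move=> f g; apply: fps_ext => a /=.
rewrite (perm_big [seq (p.2, p.1) | p <- mi_splits a]) /=.
  by rewrite big_map; apply: eq_bigr => p _; rewrite mulrC.
apply: uniq_perm; first exact: mi_splits_uniq.
  rewrite (map_inj_uniq (f := fun p => (p.2, p.1))) ?mi_splits_uniq //.
  by move=> [? ?] [? ?] [-> ->].
move=> [x y]; apply/idP/mapP => [xy|[[u v] + [-> ->]]].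
  by exists (y, x) => //; move: xy; rewrite !mem_mi_splits /= mi_addC.
by rewrite !mem_mi_splits /= mi_addC.
Qed.

Fact fps_mul1 : left_id fps_one fps_mul.
Proof.
move=> f; apply: fps_ext => a /=.
rewrite (bigD1_seq (mi0, a)) ?mi_splits_uniq ?mem_mi_splits /= ?mi_add0 //.
rewrite eqxx mul1r big_seq_cond big1 ?addr0 // => -[x y] /=.
rewrite mem_mi_splits /= => /andP[/eqP xya].
case: (eqVneq x mi0) => [x0|_ _]; last by rewrite mul0r.
by rewrite -xya x0 mi_add0 eqxx.
Qed.

Fact fps_mulDl : left_distributive fps_mul fps_add.
Proof.
move=> f g h; apply: fps_ext => a /=.
by rewrite -big_split; apply: eq_bigr => p _; rewrite mulrDl.
Qed.

Fact fps_one_neq0 : fps_one != 0.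
Proof.
apply/eqP => /(congr1 (fun f => fps_coef f mi0)) /=.
by rewrite eqxx => /eqP; rewrite oner_eq0.
Qed.

HB.instance Definition _ := GRing.Zmodule_isComNzRing.Build (fps m K)
  fps_mulA fps_mulC fps_mul1 fps_mulDl fps_one_neq0.

Fact fps_scaleA c d f : fps_scale c (fps_scale d f) = fps_scale (c * d) f.
Proof. by apply: fps_ext => a /=; rewrite mulrA. Qed.
Fact fps_scale1 : left_id 1 fps_scale.
Proof. by move=> f; apply: fps_ext => a /=; rewrite mul1r. Qed.
Fact fps_scaleDr : right_distributive fps_scale +%R.
Proof. by move=> c f g; apply: fps_ext => a /=; rewrite mulrDr. Qed.
Fact fps_scaleDl f : {morph fps_scale^~ f : c d / c + d}.
Proof. by move=> c d; apply: fps_ext => a /=; rewrite mulrDl. Qed.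

HB.instance Definition _ := GRing.Zmodule_isLmodule.Build K (fps m K)
  fps_scaleA fps_scale1 fps_scaleDr fps_scaleDl.

Fact fps_scaleAl (c : K) f g : c *: (f * g) = c *: f * g.
Proof.
apply: fps_ext => a /=; rewrite big_distrr /=.
by apply: eq_bigr => p _; rewrite mulrA.
Qed.

HB.instance Definition _ :=
  GRing.Lmodule_isLalgebra.Build K (fps m K) fps_scaleAl.

Definition fps_deriv (i : 'I_m) f : fps m K :=
  Fps (fun a => fps_coef f (mi_add a (mi1 i)) *+ (a i).+1).

End FpsRing.

Definition fps_map m (K K' : Type) (s : K -> K') (f : fps m K) : fps m K' :=
  Fps (s \o fps_coef f).

Definition is_ideal (A : comNzRingType) (I : set A) : Prop :=
  [/\ I 0, forall f g, I f -> I g -> I (f + g) & forall f g, I g -> I (f * g)].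

Definition fps_diff0 m (K : fieldType) (f : fps m K) : 'rV[K]_m :=
  \row_i fps_coef f (mi1 i).

Definition manifold_ideal m (K : fieldType) (k : nat) (I : set (fps m K)) : Prop :=
  exists F : 'I_k -> fps m K,
    [/\ forall j, fps_coef (F j) mi0 = 0,
        row_free (\matrix_(j < k) fps_diff0 (F j)) &
        I = smallest (@is_ideal _) (range F)].

Record formal_submfd (m : nat) (K : fieldType) := FormalSubmfd {
  fcodim : nat;
  fideal : set (fps m K);
  fidealP : manifold_ideal fcodim fideal }.

Definition fdim m K (X : formal_submfd m K) : nat := (m - fcodim X)%N.

(* Formal subsets are handled through their ideals, which reverses inclusion. *)
Definition formally_contained m K (IX IY : set (fps m K)) : Prop := IY `<=` IX.

Definition tangent0 m (K : fieldType) (I : set (fps m K)) : set 'rV[K]_m :=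
  [set xi | forall f, I f -> \sum_i fps_diff0 f 0 i * xi 0 i = 0].

(* A formal vector field [\sum_i L_i d/dx_i] is the row of its coefficients. *)
Notation formal_vf m K := 'rV[fps m K]_m.

Section FormalVectorFields.
Context {m : nat} {K : fieldType}.
Implicit Types L M : formal_vf m K.

Definition fvf_app L (f : fps m K) : fps m K := \sum_i L 0 i * fps_deriv i f.

Definition fvf_bracket L M : formal_vf m K :=
  \row_k (fvf_app L (M 0 k) - fvf_app M (L 0 k)).

Definition fvf_value0 L : 'rV[K]_m := map_mx (fun f => fps_coef f mi0) L.

Definition is_lie_algebra (A : set (formal_vf m K)) : Prop :=
  [/\ A 0, forall L M, A L -> A M -> A (L + M),
      forall (c : K) L, A L -> A (c%:A *: L) &
      forall L M, A L -> A M -> A (fvf_bracket L M)].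

Definition Lie (A : set (formal_vf m K)) : set (formal_vf m K) :=
  smallest is_lie_algebra A.

Definition preserves (L : formal_vf m K) (I : set (fps m K)) : Prop :=
  forall f, I f -> I (fvf_app L f).

Definition sub_mod (A B : set (formal_vf m K)) (I : set (fps m K)) : Prop :=
  forall L, A L -> exists2 M, B M & forall k, I ((L - M) 0 k).

End FormalVectorFields.

(* A point [z = x + i y] of C^n is the row [(x, y)], and C[[z, zbar]] is
   identified with C[[x, y]] by [z_j = x_j + i y_j], [zbar_j = x_j - i y_j];
   conjugation of series is thus conjugation of the coefficients in [x, y]. *)

Definition Jmap n (A : zmodType) (v : 'rV[A]_(n + n)) : 'rV[A]_(n + n) :=
  row_mx (- rsubmx v) (lsubmx v).

Section ComplexStructure.
Context {R : realType} {n : nat}.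
Local Notation C := R[i].

Definition real_point (w : 'rV[C]_n) : 'rV[R]_(n + n) :=
  row_mx (map_mx (@complex.Re R) w) (map_mx (@complex.Im R) w).

(* The series [f (x + i y)]: the coefficient of [x^a y^b] in [(x + i y)^c] is
   [\prod_j 'C(a_j + b_j, b_j) * 'i ^+ b_j] if [c = a + b], and 0 otherwise. *)
Definition fps_holo (f : fps n C) : fps (n + n) C :=
  Fps (fun ab : multi_index (n + n) =>
    let a j := ab (lshift n j) in
    let b j := ab (rshift n j) in
    fps_coef f [ffun j => (a j + b j)%N] *
      \prod_j ('i ^+ b j * 'C(a j + b j, b j)%:R)).

Definition complexify (I : set (fps (n + n) R)) : set (fps (n + n) C) :=
  [set fps_map (real_complex R) f + 'i *: fps_map (real_complex R) g
  | f in I & g in I].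

Definition complexified_ideal (V : formal_submfd n C) : set (fps (n + n) C) :=
  smallest (@is_ideal _)
    ((@fps_holo @` fideal V) `|`
     ((fun f => fps_map conjc (fps_holo f)) @` fideal V)).

(* The ideal of [V] regarded as a real formal submanifold. *)
Definition underlying_real_ideal (V : formal_submfd n C) : set (fps (n + n) R) :=
  [set f | complexified_ideal V (fps_map (real_complex R) f)].

Definition complexify_space m (T : set 'rV[R]_m) : set 'rV[C]_m :=
  [set v | T (map_mx (@complex.Re R) v) /\ T (map_mx (@complex.Im R) v)].

(* [\sum_j a_j d/dz_j] with [d/dz_j = (d/dx_j - i d/dy_j) / 2] *)
Definition dz_field (a : 'rV[fps (n + n) C]_n) : formal_vf (n + n) C :=
  row_mx ((2^-1 : C)%:A *: a) ((- 'i / 2 : C)%:A *: a).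

Definition DO (O : formal_submfd (n + n) R) : set (formal_vf (n + n) R) :=
  [set L | preserves L (fideal O)].

Definition D10 (O : formal_submfd (n + n) R) : set (formal_vf (n + n) C) :=
  [set L | (exists a, L = dz_field a) /\ preserves L (complexify (fideal O))].

Definition D01 (O : formal_submfd (n + n) R) : set (formal_vf (n + n) C) :=
  map_mx (fps_map conjc) @` D10 O.

Definition finite_commutator_type (O : formal_submfd (n + n) R) : Prop :=
  fvf_value0 @` Lie [set L + M | L in D10 O & M in D01 O] =
  complexify_space (tangent0 (fideal O)).

End ComplexStructure.

Section Smooth.
Context {R : realType} {m : nat}.
Implicit Types (f : 'rV[R]_m -> R) (p : 'rV[R]_m).

Definition partial (i : 'I_m) f : 'rV[R]_m -> R :=
  fun x => 'D_(delta_mx 0 i) f x.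

Definition partials (s : seq 'I_m) f : 'rV[R]_m -> R := foldr partial f s.

Definition smooth_near p f : Prop :=
  \forall x \near p, forall s : seq 'I_m,
    {for x, continuous (partials s f)} /\
    forall i, derivable (partials s f) x (delta_mx 0 i).

Definition taylor0 f : fps m R :=
  Fps (fun a => foldr (fun i g => iter (a i) (partial i) g) f (enum 'I_m) 0
                / (\prod_i (a i)`!)%:R).

Definition vanishing_order f : \bar R :=
  ereal_inf [set (mi_deg a)%:R%:E | a in [set a | fps_coef (taylor0 f) a != 0]].

Definition defining_function (S : set 'rV[R]_m) p f : Prop :=
  [/\ smooth_near p f, \forall x \near p, S x <-> f x = 0 &
      exists i, partial i f p != 0].

Definition smooth_hypersurface (S : set 'rV[R]_m) : Prop :=
  forall p, S p -> exists r, defining_function S p r.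

Definition vanishes_on (S : set 'rV[R]_m) p f : Prop :=
  \forall x \near p, S x -> f x = 0.

Definition tangent (S : set 'rV[R]_m) p : set 'rV[R]_m :=
  [set v | forall f, smooth_near p f -> vanishes_on S p f -> 'D_v f p = 0].

Definition smooth_map_near k p (F : 'rV[R]_m -> 'rV[R]_k) : Prop :=
  forall j, smooth_near p (fun x => F x 0 j).

Definition jet_ideal (S : set 'rV[R]_m) : set (fps m R) :=
  [set taylor0 f | f in [set f | smooth_near 0 f /\ vanishes_on S 0 f]].

End Smooth.

Section ComplexSmooth.
Context {R : realType} {m : nat}.
Local Notation C := R[i].
Implicit Types (p : 'rV[R]_m) (L M : 'rV[R]_m -> 'rV[C]_m).

Definition csmooth_map_near p L : Prop :=
  smooth_map_near p (map_mx (@complex.Re R) \o L) /\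
  smooth_map_near p (map_mx (@complex.Im R) \o L).

Definition cpartial (i : 'I_m) (f : 'rV[R]_m -> C) : 'rV[R]_m -> C :=
  fun x => partial i (@complex.Re R \o f) x +i* partial i (@complex.Im R \o f) x.

Definition vf_bracket L M : 'rV[R]_m -> 'rV[C]_m :=
  fun x => \row_k \sum_j (L x 0 j * cpartial j (fun y => M y 0 k) x
                        - M x 0 j * cpartial j (fun y => L y 0 k) x).

Definition vf_conj L : 'rV[R]_m -> 'rV[C]_m := map_mx conjc \o L.

(* The [C]-linear extension of the covector with coefficients [t]. *)
Definition form_app (t v : 'rV[C]_m) : C := \sum_k t 0 k * v 0 k.

End ComplexSmooth.

Section Hypersurface.
Context {R : realType} {n : nat}.
Local Notation C := R[i].
Context (S : set 'rV[R]_(n + n)).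

Definition HS (q : 'rV[R]_(n + n)) : set 'rV[R]_(n + n) :=
  [set v | tangent S q v /\ tangent S q (Jmap v)].

Definition H10 (q : 'rV[R]_(n + n)) : set 'rV[C]_(n + n) :=
  [set v | complexify_space (tangent S q) v /\ Jmap v = 'i *: v].

Definition section_H10_near (q : 'rV[R]_(n + n))
    (L : 'rV[R]_(n + n) -> 'rV[C]_(n + n)) : Prop :=
  csmooth_map_near q L /\ \forall x \near q, S x -> H10 x (L x).

(* Forms and vector fields on [S] are represented by smooth extensions to the
   ambient space; only their values at points of [S] are constrained, and
   [theta ([L, Lbar])] does not depend on the extensions there. *)
Definition contact_form_near (p : 'rV[R]_(n + n))
    (theta : 'rV[R]_(n + n) -> 'rV[C]_(n + n)) : Prop :=
  csmooth_map_near p theta /\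
  \forall q \near p, S q ->
    (exists2 v, tangent S q v &
       form_app (theta q) (map_mx (real_complex R) v) != 0) /\
    (forall v w, H10 q v -> H10 q w ->
       form_app (theta q) (v + map_mx conjc w) = 0).

Definition imaginary_near (p : 'rV[R]_(n + n))
    (theta : 'rV[R]_(n + n) -> 'rV[C]_(n + n)) : Prop :=
  \forall q \near p, S q -> forall v, tangent S q v ->
    complex.Re (form_app (theta q) (map_mx (real_complex R) v)) = 0.

Definition pseudoconvex : Prop :=
  forall p, S p -> exists theta,
    [/\ contact_form_near p theta, imaginary_near p theta &
        \forall q \near p, S q -> forall L, section_H10_near q L ->
          0 <= form_app (theta q) (vf_bracket L (vf_conj L) q)].

Definition jet_HS : set (formal_vf (n + n) R) :=
  [set (\row_k taylor0 (fun x => L x 0 k)) |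
     L in [set L : 'rV[R]_(n + n) -> 'rV[R]_(n + n) |
       smooth_map_near 0 L /\ \forall x \near (0 : 'rV[R]_(n + n)), S x -> HS x (L x)]].

End Hypersurface.

(* [R[i]] with the topology of a normed field, which is only attached to
   elements of [numFieldType]. *)
Definition complex_field (R : realType) : numFieldType := R[i].

Section RegularType.
Context {R : realType} {n : nat}.
Local Notation C := (complex_field R).

Definition holomorphic_immersion_germ (gamma : C -> 'rV[C]_n) : Prop :=
  [/\ \forall z \near (0 : C), derivable gamma z 1,
      gamma 0 = 0 & 'D_1 gamma 0 != 0].

Definition pullback (r : 'rV[R]_(n + n) -> R) (gamma : C -> 'rV[C]_n) :
    'rV[R]_(1 + 1) -> R :=
  fun u => r (real_point (gamma (u 0 (lshift 1 0) +i* u 0 (rshift 1 0)))).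

Definition regular_type (r : 'rV[R]_(n + n) -> R) : \bar R :=
  ereal_sup [set vanishing_order (pullback r gamma) |
             gamma in holomorphic_immersion_germ].

(* Two defining functions differ by a nonvanishing smooth factor, hence have the
   same regular type. *)
Definition infinite_regular_type (S : set 'rV[R]_(n + n)) : Prop :=
  forall r, defining_function S 0 r -> regular_type r = +oo%E.

End RegularType.

(* Main.v *)
Require Import Defs.
From HB Require Import structures.
From mathcomp Require Import all_boot all_order all_algebra.
From mathcomp Require Import all_classical all_reals all_analysis.
From mathcomp Require Import complex.
From mathcomp Require Import ring lra zify.

Set Implicit Arguments.
Unset Strict Implicit.
Unset Printing Implicit Defensive.

Import Order.TTheory GRing.Theory Num.Theory.
Import numFieldNormedType.Exports.

Local Open Scope classical_set_scope.
Local Open Scope ring_scope.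
Local Open Scope complex_scope.

(** Let [r] be a defining function of [S] at the origin and [rho] its Taylor
    series. In formal holomorphic coordinates [w] in which [V] is given by
    [w_1 = ... = w_k = 0] ([manifold_ideal_chart]), the inclusion of [V] in the
    jet of [S] says that all derivatives of [rho] along [V] vanish at the origin
    ([contact_vanish]). A stronger claim can be proved by induction: for every
    [m], all derivatives of [rho] of order less than [m] in the directions of [V]
    belong to the ideal of [O] ([ord_all]). A series with this property is said
    here to have order [m]; orders add up under multiplication ([Iord_mul]).

    Order 2. As [O] lies in [S], [rho] is in the ideal of [O]. As [O] is complex
    tangential, [L] and [J L] annihilate [rho] modulo this ideal for every field
    [L] tangent to [O]; hence so do the (1, 0) parts of complex fields tangent to
    [O]. By genericity and finite commutator type, the (1, 0) parts of the fields
    in the Lie algebra generated by the Cauchy-Riemann fields of [O] span the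
    (1, 0) directions of [V] at the origin ([span_vectors]), so by Cramer's rule
    the derivatives [d rho / d w_al] are in the ideal ([contact_order2]).

    From even order [m + 1] to [m + 2] ([step_even]). Consider the fields tangent
    to [O] whose (1, 0) and (0, 1) parts along [V] both map [rho] to a series of
    order [m + 1]. The Cauchy-Riemann fields of [O] and their conjugates are of
    this kind ([D10_tame]). The class is stable under brackets ([tame_lie]): up to
    terms of order [m + 1], the bracket only produces values of the Levi form of
    [rho] on such fields ([ord_T10_bracket]). A priori these have the odd order
    [m], but pseudoconvexity makes them nonnegative and a nonnegative series
    cannot have odd order, so they have order [m + 1] ([lev_even]). Hence the
    class contains the whole Lie algebra, whose (1, 0) parts span.

    From odd order [m + 2] to [m + 3] ([step_odd]). Now the Levi form has odd
    order [m] on all directions of [V], hence order [m + 1], which settles the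
    mixed second derivatives. Applying the fields of the Lie algebra to the first
    derivatives [d rho / d wbar_be] and subtracting the mixed derivatives gives
    the second derivatives of type (0, 2).

    Pseudoconvexity is a statement about points of [S] only. Along a formal curve
    on which [rho] vanishes to higher order than the Levi form, there are points
    of [S] so close to the curve that the leading coefficient of the Levi form is
    still nonnegative ([nearest_point], [formal_levi]). Curves of this sort are
    obtained by displacing a formal curve of [O] by [+ b s ^ M] and [- b s ^ M] in
    the directions of [V]; if the Levi form had odd order, its leading coefficients
    along these two curves would have opposite signs ([odd_order]).

    Finally a smooth function vanishing on [S] is bounded by a multiple of [|r|].
    So every formal curve in [V], being of infinite contact with [S], annihilates
    its Taylor series ([jets_vanishing]), and formal curves detect the ideal of [V]
    ([line_detects], [jet_inclusion]). When [V] has positive dimension, the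
    polynomial truncations of a formal holomorphic curve in [V] are immersed and
    have arbitrarily high contact with [S] ([high_contact]), so that the regular
    type is infinite. *)

(** * Formal power series: order, monomials, density *)

Section MultiIndexTheory.
Context {m : nat}.
Implicit Types a b : multi_index m.

Lemma mi_deg_add a b : mi_deg (mi_add a b) = (mi_deg a + mi_deg b)%N.
Proof. by rewrite /mi_deg -big_split; apply: eq_bigr => i _; rewrite ffunE. Qed.

Lemma mi_deg1 (i : 'I_m) : mi_deg (mi1 i) = 1%N.
Proof.
rewrite /mi_deg (bigD1 i) //= ffunE eqxx big1 ?addn0 // => j ji.
by rewrite ffunE (negbTE ji).
Qed.

Lemma mi_deg0 : mi_deg (@mi0 m) = 0%N.
Proof. by rewrite /mi_deg big1 // => i _; rewrite ffunE. Qed.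

Lemma mi_deg_eq0 a : mi_deg a = 0%N -> a = mi0.
Proof.
move=> /eqP; rewrite sum_nat_eq0 => /fintype.forallP a0.
by apply/ffunP => i; rewrite ffunE; apply/eqP/(implyP (a0 i)).
Qed.

Lemma mi_le_deg a (i : 'I_m) : (a i <= mi_deg a)%N.
Proof. by rewrite /mi_deg (bigD1 i) //= leq_addr. Qed.

Lemma mi_addI a : injective (mi_add a).
Proof.
move=> b c /ffunP e; apply/ffunP => i; have := e i; rewrite !ffunE.
exact: addnI.
Qed.

Lemma mi_pred a (i : 'I_m) : (0 < a i)%N ->
  exists b, a = mi_add b (mi1 i).
Proof.
move=> ai; exists [ffun j => (a j - (j == i))%N].
apply/ffunP => j; rewrite !ffunE subnK //.
by case: eqP => // ->.
Qed.

Lemma mi_ind (P : multi_index m -> Prop) :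
  P mi0 -> (forall a i, P a -> P (mi_add a (mi1 i))) -> forall a, P a.
Proof.
move=> P0 PS a; move: {2}(mi_deg a) (erefl (mi_deg a)) => n.
elim: n a => [a /mi_deg_eq0 -> //|n IH a aE].
have : [exists i, 0 < a i]%N.
  apply: contraPT aE; rewrite negb_exists => /fintype.forallP a0.
  rewrite /mi_deg big1 // => i _; apply/eqP.
  by have := a0 i; rewrite -leqNgt leqn0.
move=> /fintype.existsP[i /mi_pred[b ab]]; rewrite ab; apply: PS; apply: IH.
by move: aE; rewrite ab mi_deg_add mi_deg1 addn1 => -[].
Qed.

End MultiIndexTheory.

Section FpsTheory.
Context {m : nat} {K : comNzRingType}.
Implicit Types (f g h : fps m K) (a b c : multi_index m).

Lemma fps_coef_sum (I : Type) (s : seq I) (P : pred I) (F : I -> fps m K) a :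
  fps_coef (\sum_(i <- s | P i) F i) a = \sum_(i <- s | P i) fps_coef (F i) a.
Proof. by elim/big_rec2: _ => // i y1 y2 _ <-. Qed.

Lemma fps_coefD f g a : fps_coef (f + g) a = fps_coef f a + fps_coef g a.
Proof. by []. Qed.

Lemma fps_coefZ (c : K) f a : fps_coef (c *: f) a = c * fps_coef f a.
Proof. by []. Qed.

Lemma fps_coef_deriv i f a :
  fps_coef (fps_deriv i f) a = fps_coef f (mi_add a (mi1 i)) *+ (a i).+1.
Proof. by []. Qed.

Definition fpsX (i : 'I_m) : fps m K := Fps (fun a => (a == mi1 i)%:R).
Definition fps_mono b : fps m K := Fps (fun a => (a == b)%:R).

Lemma fps_mono0 : fps_mono mi0 = 1. Proof. by []. Qed.
Lemma fps_mono1 i : fps_mono (mi1 i) = fpsX i. Proof. by []. Qed.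

Lemma fps_coef_monoM b f a :
  fps_coef (fps_mono b * f) (mi_add b a) = fps_coef f a.
Proof.
rewrite /= (bigD1_seq (b, a)) ?mi_splits_uniq ?mem_mi_splits //=.
rewrite eqxx mul1r big_seq_cond big1 ?addr0 // => -[x y] /=.
rewrite mem_mi_splits /= => /andP[/eqP xya].
case: (eqVneq x b) => [xb|_ _]; last by rewrite mul0r.
by move: xya; rewrite xb => /mi_addI ->; rewrite eqxx.
Qed.

Lemma fps_coef_monoM0 b f a : (forall c, a <> mi_add b c) ->
  fps_coef (fps_mono b * f) a = 0.
Proof.
move=> ab; rewrite /= big_seq big1 // => -[x y] /=.
rewrite mem_mi_splits /= => /eqP xya.
by case: (eqVneq x b) => [xb|_]; [case: (ab y); rewrite -xb|rewrite mul0r].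
Qed.

Lemma fps_monoD a b : fps_mono (mi_add a b) = fps_mono a * fps_mono b.
Proof.
apply: fps_ext => c.
have [[d ->]|cN] := pselect (exists d, c = mi_add a d).
  by rewrite fps_coef_monoM /= (inj_eq (@mi_addI _ a)).
rewrite fps_coef_monoM0; last by move=> d cd; apply: cN; exists d.
by rewrite /=; case: eqVneq => // cab; case: cN; exists b.
Qed.

(** Membership in the [n]-th power of the maximal ideal, read off the
    coefficients; all continuity arguments for power series refer to this
    filtration. *)
Definition ord_ge (n : nat) f : Prop :=
  forall a, (mi_deg a < n)%N -> fps_coef f a = 0.

Lemma ord_ge0 f : ord_ge 0 f. Proof. by []. Qed.

Lemma ord_geW n n' f : (n' <= n)%N -> ord_ge n f -> ord_ge n' f.
Proof. by move=> nn fn a an; apply: fn; apply: leq_trans nn. Qed.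

Lemma ord_ge_zero n : ord_ge n 0. Proof. by []. Qed.

Lemma ord_geD n f g : ord_ge n f -> ord_ge n g -> ord_ge n (f + g).
Proof. by move=> fn gn a an /=; rewrite fn // gn // addr0. Qed.

Lemma ord_geN n f : ord_ge n f -> ord_ge n (- f).
Proof. by move=> fn a an /=; rewrite fn // oppr0. Qed.

Lemma ord_geB n f g : ord_ge n f -> ord_ge n g -> ord_ge n (f - g).
Proof. by move=> fn gn; apply: ord_geD => //; apply: ord_geN. Qed.

Lemma ord_geZ n (c : K) f : ord_ge n f -> ord_ge n (c *: f).
Proof. by move=> fn a an /=; rewrite fn // mulr0. Qed.

Lemma ord_ge_sum n (I : Type) (s : seq I) (P : pred I) (F : I -> fps m K) :
  (forall i, P i -> ord_ge n (F i)) -> ord_ge n (\sum_(i <- s | P i) F i).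
Proof. by move=> Fn a an; rewrite fps_coef_sum big1 // => i Pi; apply: Fn. Qed.

Lemma ord_geM n n' f g : ord_ge n f -> ord_ge n' g -> ord_ge (n + n') (f * g).
Proof.
move=> fn gn a an /=; rewrite big_seq big1 // => -[x y] /=.
rewrite mem_mi_splits /= => /eqP xya.
have [xn|nx] := ltnP (mi_deg x) n; first by rewrite fn // mul0r.
rewrite gn ?mulr0 // -(ltn_add2l n) (leq_ltn_trans _ an) //.
by rewrite -xya mi_deg_add leq_add2r.
Qed.

Lemma ord_geMl n f g : ord_ge n g -> ord_ge n (f * g).
Proof. by move=> gn; apply: (@ord_geM 0 n). Qed.

Lemma ord_geMr n f g : ord_ge n f -> ord_ge n (f * g).
Proof. by rewrite mulrC; apply: ord_geMl. Qed.

Lemma ord_ge_mono a : ord_ge (mi_deg a) (fps_mono a).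
Proof. by move=> b /=; case: eqVneq => // ->; rewrite ltnn. Qed.

Lemma ord_ge_eq0 f : (forall n, ord_ge n f) -> f = 0.
Proof. by move=> fn; apply: fps_ext => a; apply: (fn (mi_deg a).+1). Qed.

Lemma ord_ge1 f : ord_ge 1 f <-> fps_coef f mi0 = 0.
Proof.
split=> [->//|f0 a]; first by rewrite mi_deg0.
by rewrite ltnS leqn0 => /eqP/mi_deg_eq0 ->.
Qed.

Lemma fps_coef0M f g : fps_coef (f * g) mi0 = fps_coef f mi0 * fps_coef g mi0.
Proof.
rewrite /= (bigD1_seq (mi0, mi0)) ?mi_splits_uniq ?mem_mi_splits //= ?mi_add0 //.
rewrite big_seq_cond big1 ?addr0 // => -[x y] /=.
rewrite mem_mi_splits /= => /andP[/eqP xy0].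
have /eqP : mi_deg (mi_add x y) = 0%N by rewrite xy0 mi_deg0.
by rewrite mi_deg_add addn_eq0 => /andP[/eqP/mi_deg_eq0 -> /eqP/mi_deg_eq0 ->]; rewrite eqxx.
Qed.

(** The exponents are bounded one by one, rather than through the degree, so
    that the sum ranges over a finite function type; the remainder has order
    [n] either way. *)
Definition fps_trunc n f : fps m K :=
  \sum_(b : {ffun 'I_m -> 'I_n}) fps_coef f (mi_val b) *: fps_mono (mi_val b).

Lemma mi_val_inj n : injective (@mi_val m n).
Proof.
move=> b c /ffunP bc; apply/ffunP => i; apply/val_inj.
by have := bc i; rewrite !ffunE.
Qed.

Lemma mi_val_onto n a : (forall i, a i < n)%N ->
  exists b : {ffun 'I_m -> 'I_n}, mi_val b = a.
Proof.
move=> an; exists [ffun i => Ordinal (an i)].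
by apply/ffunP => i; rewrite !ffunE.
Qed.

Lemma fps_coef_trunc n f a : (forall i, a i < n)%N ->
  fps_coef (fps_trunc n f) a = fps_coef f a.
Proof.
move=> /mi_val_onto[b <-]; rewrite fps_coef_sum (bigD1 b) //= eqxx mulr1.
rewrite big1 ?addr0 // => c cb.
by rewrite (inj_eq (@mi_val_inj n)) eq_sym (negbTE cb) mulr0.
Qed.

Lemma ord_ge_trunc n f : ord_ge n (f - fps_trunc n f).
Proof.
move=> a an /=; rewrite fps_coef_trunc ?subrr // => i.
exact: leq_ltn_trans (mi_le_deg a i) an.
Qed.

End FpsTheory.

Arguments fpsX {m K}.
Arguments fps_mono {m K}.

(** An additive map that is continuous for the order filtration is determined by
    its values on scaled monomials; [l] is the loss of order it may incur. *)
Lemma fps_dense m p (K K' : comNzRingType) (E : fps m K -> fps p K') (l : nat) :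
    (forall f g, E (f - g) = E f - E g) ->
    (forall c a, E (c *: fps_mono a) = 0) ->
    (forall n f, ord_ge (n + l) f -> ord_ge n (E f)) ->
  forall f, E f = 0.
Proof.
move=> EB Em El f; apply: ord_ge_eq0 => n.
have E0 : E 0 = 0 by rewrite -(subrr 0) EB subrr.
have EN g : E (- g) = - E g by rewrite -sub0r EB E0 sub0r.
have ED g h : E (g + h) = E g + E h by rewrite -{1}(opprK h) EB EN opprK.
have -> : E f = E (f - fps_trunc (n + l) f).
  rewrite EB; suff -> : E (fps_trunc (n + l) f) = 0 by rewrite subr0.
  by rewrite /fps_trunc (big_morph E ED E0) big1.
by apply: El; apply: ord_ge_trunc.
Qed.

(** ** Differentiation *)
Section FpsDeriv.
Context {m : nat} {K : comNzRingType}.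
Implicit Types (f g h : fps m K) (a b c : multi_index m) (i j : 'I_m).

Lemma fps_derivB i f g : fps_deriv i (f - g) = fps_deriv i f - fps_deriv i g.
Proof. by apply: fps_ext => a /=; rewrite mulrnBl. Qed.

HB.instance Definition _ i :=
  GRing.isZmodMorphism.Build (fps m K) (fps m K) (fps_deriv i) (fps_derivB i).

Lemma fps_derivZ i (c : K) f : fps_deriv i (c *: f) = c *: fps_deriv i f.
Proof. by apply: fps_ext => a /=; rewrite mulrnAr. Qed.

HB.instance Definition _ i :=
  GRing.isScalable.Build K (fps m K) (fps m K) *:%R (fps_deriv i) (fps_derivZ i).

Lemma ord_ge_deriv n i f : ord_ge n.+1 f -> ord_ge n (fps_deriv i f).
Proof.
move=> fn a an /=; rewrite fn ?mul0rn //.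
by rewrite mi_deg_add mi_deg1 addn1.
Qed.

Lemma fps_derivC i j f : fps_deriv i (fps_deriv j f) = fps_deriv j (fps_deriv i f).
Proof.
have [->//|ij] := eqVneq i j.
apply: fps_ext => a /=; rewrite !ffunE !(eq_sym i) eq_sym (negbTE ij) !addn0.
rewrite -!mulrnA mulnC; congr (fps_coef f _ *+ _).
by rewrite -!mi_addA (mi_addC (mi1 i)).
Qed.

Lemma fps_derivX i j : fps_deriv i (fpsX j) = (i == j)%:R :> fps m K.
Proof.
apply: fps_ext => a /=; have [<-|ij] := eqVneq i j.
  rewrite -{2}(mi_add0 (mi1 i)) ![mi_add _ (mi1 i)]mi_addC (inj_eq (@mi_addI _ _)) /=.
  by case: eqVneq => [->|_]; rewrite ?ffunE ?mul0rn.
case: eqVneq => [/ffunP/(_ i)|_]; last by rewrite mul0rn.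
by rewrite !ffunE eqxx (negbTE ij) addn1.
Qed.

Lemma fps_deriv1 i : fps_deriv i (1 : fps m K) = 0.
Proof.
apply: fps_ext => a /=; case: eqVneq => [/ffunP/(_ i)|_]; last by rewrite mul0rn.
by rewrite !ffunE eqxx addn1.
Qed.

Lemma fps_derivXM i j f :
  fps_deriv i (fpsX j * f) = (i == j)%:R * f + fpsX j * fps_deriv i f.
Proof.
rewrite -!fps_mono1; apply: fps_ext => a; rewrite fps_coef_deriv fps_coefD.
have [[b ->]|aN] := pselect (exists b, a = mi_add (mi1 j) b).
  rewrite fps_coef_monoM -mi_addA fps_coef_monoM fps_coef_deriv.
  have [ij|ij] := eqVneq i j; last by rewrite mul0r add0r !ffunE (negbTE ij).
  by subst j; rewrite mul1r !ffunE eqxx add1n mulrS (mi_addC b).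
rewrite [X in _ = _ + X]fps_coef_monoM0 ?addr0; last first.
  by move=> c ac; apply: aN; exists c.
have aj : a j = 0%N.
  apply/eqP; rewrite -leqn0 leqNgt; apply/negP => /mi_pred[b ab].
  by apply: aN; exists b; rewrite mi_addC.
have [ij|ij] := eqVneq i j.
  by subst j; rewrite mi_addC fps_coef_monoM aj mul1r.
rewrite mul0r fps_coef_monoM0 ?mul0rn // => c.
by move=> /ffunP/(_ j); rewrite !ffunE aj eqxx eq_sym (negbTE ij).
Qed.

Lemma fps_derivM i f g :
  fps_deriv i (f * g) = fps_deriv i f * g + f * fps_deriv i g.
Proof.
apply/eqP; rewrite -subr_eq0; apply/eqP.
pose E f := fps_deriv i (f * g) - (fps_deriv i f * g + f * fps_deriv i g).
rewrite -/(E f); apply: (@fps_dense _ _ _ _ E 1) => [u v|c a|n u nu].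
- by rewrite /E mulrBl !raddfB /= mulrBl mulrBl; ring.
- rewrite /E -scalerAl !linearZ /= -!scalerAl -scalerDr -scalerBr.
  rewrite [X in _ *: X](_ : _ = 0) ?scaler0 //.
  elim/(@mi_ind m): a => [|a j IH].
    by rewrite fps_mono0 !mul1r fps_deriv1 mul0r add0r subrr.
  rewrite mi_addC fps_monoD fps_mono1 -mulrA !fps_derivXM.
  move/eqP: IH; rewrite subr_eq0 => /eqP ->; ring.
- rewrite /E; rewrite addn1 in nu; apply: ord_geB.
    by apply: ord_ge_deriv; apply: ord_geMr.
  by apply: ord_geD; apply: ord_geMr; [apply: ord_ge_deriv|apply: ord_geW nu].
Qed.

End FpsDeriv.

(** * Substitution *)
Lemma fps_scaleAr m (K : comNzRingType) (c : K) (f g : fps m K) :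
  c *: (f * g) = f * (c *: g).
Proof. by rewrite mulrC scalerAl mulrC. Qed.

Section FpsComp.
Context {m p : nat} {K : comNzRingType}.
Implicit Types (G : 'I_m -> fps p K) (f g : fps m K).

(** Substituting a series with a nonzero constant term is meaningless; such a
    term is dropped, which makes substitution a ring morphism for every [G]. *)
Definition fps_dc (u : fps p K) : fps p K := u - (fps_coef u mi0)%:A.

Lemma fps_dc_id u : fps_coef u mi0 = 0 -> fps_dc u = u.
Proof. by rewrite /fps_dc => ->; rewrite scale0r subr0. Qed.

Lemma ord_ge_dc u : ord_ge 1 (fps_dc u).
Proof. by apply/ord_ge1; rewrite /= eqxx mulr1 subrr. Qed.

Definition fps_pow G (a : multi_index m) : fps p K := \prod_j fps_dc (G j) ^+ a j.

Lemma fps_pow0 G : fps_pow G mi0 = 1.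
Proof. by rewrite /fps_pow big1 // => j _; rewrite ffunE. Qed.

Lemma fps_powD G a b : fps_pow G (mi_add a b) = fps_pow G a * fps_pow G b.
Proof.
by rewrite /fps_pow -big_split; apply: eq_bigr => j _; rewrite ffunE exprD.
Qed.

Lemma fps_pow1 G i : fps_pow G (mi1 i) = fps_dc (G i).
Proof.
rewrite /fps_pow (bigD1 i) //= ffunE eqxx expr1 big1 ?mulr1 // => j ji.
by rewrite ffunE (negbTE ji).
Qed.

Lemma ord_ge_pow G a : ord_ge (mi_deg a) (fps_pow G a).
Proof.
elim/(@mi_ind m): a => [|a i IH]; first by rewrite mi_deg0.
rewrite fps_powD mi_deg_add mi_deg1 fps_pow1.
by apply: ord_geM => //; apply: ord_ge_dc.
Qed.

Definition fps_ev G n f : fps p K :=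
  \sum_(b : {ffun 'I_m -> 'I_n}) fps_coef f (mi_val b) *: fps_pow G (mi_val b).

(** The coefficient at [c] of the substitution only involves the terms of [f]
    of degree at most that of [c], because the monomial [a] in series without
    constant term has order at least the degree of [a]. *)
Definition fps_comp G f : fps p K :=
  Fps (fun c => fps_coef (fps_ev G (mi_deg c).+1 f) c).

Lemma fps_comp_ev G n f : ord_ge n (fps_comp G f - fps_ev G n f).
Proof.
move=> c cn; set k := (mi_deg c).+1.
have kn : (k <= n)%N by [].
apply/eqP; rewrite fps_coefD -[fps_coef (- _) _]/(- fps_coef _ _) subr_eq0.
rewrite /= -/k /fps_ev !fps_coef_sum.
pose F (a : multi_index m) := fps_coef (fps_coef f a *: fps_pow G a) c.
have seqE q : \sum_(b : {ffun 'I_m -> 'I_q}) F (mi_val b) =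
    \sum_(a <- map (@mi_val m q) (enum {ffun 'I_m -> 'I_q})) F a.
  by rewrite big_map big_enum.
rewrite -/(F _) [X in X == _](seqE k) [X in _ == X](seqE n).
rewrite [X in _ == X](bigID (fun a : multi_index m => [forall i, a i < k]%N)) /=.
rewrite [X in _ == _ + X]big1_seq ?addr0; last first.
  move=> a /andP[/negP aN _].
  have [i ki] : exists i, (k <= a i)%N.
    apply: contrapT => H; apply: aN; apply/fintype.forallP => i.
    by rewrite ltnNge; apply/negP => ki; apply: H; exists i.
   rewrite /F fps_coefZ ord_ge_pow ?mulr0 //.
  exact: leq_trans (mi_le_deg a i).
rewrite -[X in _ == X]big_filter; apply/eqP/perm_big/uniq_perm.
- by rewrite map_inj_uniq ?enum_uniq //; apply: mi_val_inj.
- by rewrite filter_uniq // map_inj_uniq ?enum_uniq //; apply: mi_val_inj.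
move=> a; rewrite mem_filter; apply/mapP/andP => [[b _ ->]|[/fintype.forallP ak _]].
  have bk : forall i, (mi_val b i < k)%N by move=> i; rewrite ffunE.
  split; first exact/fintype.forallP.
  have [b' <-] : exists b' : {ffun 'I_m -> 'I_n}, mi_val b' = mi_val b.
    by apply: mi_val_onto => i; apply: leq_trans kn.
  by apply: map_f; rewrite mem_enum.
by have [b <-] := mi_val_onto ak; exists b => //; rewrite mem_enum.
Qed.

Lemma fps_evB G n f g : fps_ev G n (f - g) = fps_ev G n f - fps_ev G n g.
Proof. by rewrite /fps_ev -sumrB; apply: eq_bigr => b _; rewrite scalerBl. Qed.

Lemma fps_compB G f g : fps_comp G (f - g) = fps_comp G f - fps_comp G g.
Proof. by apply: fps_ext => c; rewrite /= fps_evB. Qed.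

HB.instance Definition _ G :=
  GRing.isZmodMorphism.Build (fps m K) (fps p K) (fps_comp G) (fps_compB G).

Lemma fps_compD G f g : fps_comp G (f + g) = fps_comp G f + fps_comp G g.
Proof. exact: raddfD. Qed.

Lemma fps_compMn G f n : fps_comp G (f *+ n) = fps_comp G f *+ n.
Proof. exact: raddfMn. Qed.

Lemma fps_comp_sum G (I : Type) (s : seq I) (P : pred I) (F : I -> fps m K) :
  fps_comp G (\sum_(i <- s | P i) F i) = \sum_(i <- s | P i) fps_comp G (F i).
Proof. exact: raddf_sum. Qed.

Lemma fps_compZ G (c : K) f : fps_comp G (c *: f) = c *: fps_comp G f.
Proof.
apply: fps_ext => a; rewrite fps_coefZ /= -fps_coefZ /fps_ev scaler_sumr.
by rewrite !fps_coef_sum; apply: eq_bigr => b _; rewrite scalerA.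
Qed.

HB.instance Definition _ G :=
  GRing.isScalable.Build K (fps m K) (fps p K) *:%R (fps_comp G) (fps_compZ G).

Lemma ord_ge_comp G n f : ord_ge n f -> ord_ge n (fps_comp G f).
Proof.
move=> fn c cn /=; rewrite fps_coef_sum big1 // => b _; rewrite fps_coefZ.
have [bc|cb] := ltnP (mi_deg (mi_val b)) n; first by rewrite fn ?mul0r.
by rewrite ord_ge_pow ?mulr0 //; apply: leq_trans cb.
Qed.

Arguments fps_comp : simpl never.

Lemma fps_comp_mono G a : fps_comp G (fps_mono a) = fps_pow G a.
Proof.
apply/eqP; rewrite -subr_eq0; apply/eqP/ord_ge_eq0 => n.
pose N := (n + (mi_deg a).+1)%N.
have -> : fps_pow G a = fps_ev G N (fps_mono a).
  have [i|b ba] := @mi_val_onto m N a.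
    by rewrite (leq_ltn_trans (mi_le_deg a i)) // /N leq_addl.
  rewrite /fps_ev (bigD1 b) //= ba eqxx scale1r big1 ?addr0 // => c cb.
  by rewrite -ba (inj_eq (@mi_val_inj m N)) (negbTE cb) scale0r.
by apply: ord_geW (@fps_comp_ev G N _); apply: leq_addr.
Qed.

Lemma fps_comp1 G : fps_comp G 1 = 1.
Proof. by rewrite -fps_mono0 fps_comp_mono fps_pow0. Qed.

Lemma fps_compM G : {morph fps_comp G : f g / f * g}.
Proof.
move=> f g; apply/eqP; rewrite -subr_eq0; apply/eqP.
pose E f := fps_comp G (f * g) - fps_comp G f * fps_comp G g.
rewrite -/(E f); apply: (@fps_dense _ _ _ _ E 0) => [u v|c a|n u nu].
- by rewrite /E mulrBl !raddfB /= mulrBl; ring.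
- rewrite /E -scalerAl !linearZ /= -scalerAl -scalerBr.
  rewrite [X in _ *: X](_ : _ = 0) ?scaler0 // => {c}.
  pose E' g := fps_comp G (fps_mono a * g) - fps_comp G (fps_mono a) * fps_comp G g.
  rewrite -/(E' g); apply: (@fps_dense _ _ _ _ E' 0) => [u v|c b|n u nu].
  + by rewrite /E' mulrBr !raddfB /= mulrBr; ring.
  + rewrite /E' -fps_scaleAr !linearZ /= -fps_scaleAr -scalerBr -fps_monoD.
    by rewrite !fps_comp_mono fps_powD subrr scaler0.
  + rewrite addn0 in nu; apply: ord_geB; first by apply/ord_ge_comp/ord_geMl.
    by apply/ord_geMl/ord_ge_comp.
- rewrite addn0 in nu; apply: ord_geB; first by apply/ord_ge_comp/ord_geMr.
  by apply/ord_geMr/ord_ge_comp.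
Qed.

HB.instance Definition _ G :=
  GRing.isMonoidMorphism.Build (fps m K) (fps p K) (fps_comp G)
    (fps_comp1 G, fps_compM G).

Lemma fps_compX_dc G i : fps_comp G (fpsX i) = fps_dc (G i).
Proof. by rewrite -fps_mono1 fps_comp_mono fps_pow1. Qed.

Lemma fps_compX G i : fps_coef (G i) mi0 = 0 -> fps_comp G (fpsX i) = G i.
Proof. by rewrite fps_compX_dc; apply: fps_dc_id. Qed.

Lemma fps_comp_coef0 G f : fps_coef (fps_comp G f) mi0 = fps_coef f mi0.
Proof.
have f1 : ord_ge 1 (fps_comp G (f - (fps_coef f mi0)%:A)).
  by apply/ord_ge_comp/ord_ge1; rewrite /= eqxx mulr1 subrr.
have := f1 mi0; rewrite mi_deg0 => /(_ isT)/eqP.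
have -> : fps_comp G (f - (fps_coef f mi0)%:A) = fps_comp G f - (fps_coef f mi0)%:A.
  by rewrite fps_compB fps_compZ fps_comp1.
by rewrite fps_coefD /= eqxx mulr1 subr_eq0 => /eqP ->.
Qed.

(** A ring morphism that is linear and continuous is a substitution. *)
Lemma fps_comp_uniq G (X : fps m K -> fps p K) :
    (forall f g, X (f - g) = X f - X g) ->
    (forall f g, X (f * g) = X f * X g) ->
    (forall c f, X (c *: f) = c *: X f) -> X 1 = 1 ->
    (forall n f, ord_ge n f -> ord_ge n (X f)) ->
    (forall i, X (fpsX i) = fps_dc (G i)) ->
  forall f, X f = fps_comp G f.
Proof.
move=> XB XM XZ X1 Xo XX f; apply/eqP; rewrite -subr_eq0; apply/eqP.
pose E f := X f - fps_comp G f.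
rewrite -/(E f); apply: (@fps_dense _ _ _ _ E 0) => [u v|c a|n u nu].
- by rewrite /E XB raddfB /=; ring.
- rewrite /E XZ linearZ /= -scalerBr [X in _ *: X](_ : _ = 0) ?scaler0 // => {c}.
  apply/eqP; rewrite subr_eq0; apply/eqP.
  elim/(@mi_ind m): a => [|a i IH]; first by rewrite fps_mono0 X1 fps_comp1.
  by rewrite fps_monoD XM rmorphM /= IH XX fps_mono1 fps_compX_dc.
- by rewrite addn0 in nu; apply: ord_geB; [apply: Xo|apply: ord_ge_comp].
Qed.

(** The difference of the two sides is additive, continuous and a derivation
    over the substitution, so it vanishes since it vanishes on the
    coordinates. *)
Lemma fps_deriv_comp G i f :
  fps_deriv i (fps_comp G f) =
  \sum_j fps_deriv i (G j) * fps_comp G (fps_deriv j f).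
Proof.
apply/eqP; rewrite -subr_eq0; apply/eqP.
pose E f := fps_deriv i (fps_comp G f)
  - \sum_j fps_deriv i (G j) * fps_comp G (fps_deriv j f).
have dG j : fps_deriv i (fps_dc (G j)) = fps_deriv i (G j).
  by rewrite raddfB /= linearZ /= fps_deriv1 scaler0 subr0.
have EM f1 g1 : E (f1 * g1) = E f1 * fps_comp G g1 + fps_comp G f1 * E g1.
  rewrite /E rmorphM /= fps_derivM mulrBl mulrBr mulr_suml mulr_sumr.
  rewrite addrACA -opprD -big_split /=; congr (_ - _); apply: eq_bigr => j _.
  by rewrite fps_derivM rmorphD !rmorphM /=; ring.
rewrite -/(E f); apply: (@fps_dense _ _ _ _ E 1) => [u v|c a|n u nu].
- have SB : \sum_j fps_deriv i (G j) * fps_comp G (fps_deriv j (u - v)) =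
      \sum_j fps_deriv i (G j) * fps_comp G (fps_deriv j u)
      - \sum_j fps_deriv i (G j) * fps_comp G (fps_deriv j v).
    by rewrite -sumrB; apply: eq_bigr => j _; rewrite !raddfB /= mulrBr.
  by rewrite /E SB !raddfB /=; ring.
- have -> : E (c *: fps_mono a) = c *: E (fps_mono a).
    rewrite /E !linearZ /= scalerBr scaler_sumr; congr (_ - _).
    by apply: eq_bigr => j _; rewrite !linearZ /= -fps_scaleAr.
  rewrite [X in _ *: X](_ : _ = 0) ?scaler0 // => {c}.
  elim/(@mi_ind m): a => [|a k IH].
    rewrite fps_mono0 /E rmorph1 fps_deriv1 big1 ?subrr // => j _.
    by rewrite fps_deriv1 rmorph0 mulr0.
  rewrite fps_monoD EM IH mul0r add0r fps_mono1 /E fps_compX_dc dG.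
  rewrite (bigD1 k) //= fps_derivX eqxx rmorph1 mulr1 big1 ?addr0 ?subrr ?mulr0 //.
  by move=> j jk; rewrite fps_derivX (negbTE jk) rmorph0 mulr0.
- rewrite addn1 in nu; apply: ord_geB; first by apply/ord_ge_deriv/ord_ge_comp.
  by apply: ord_ge_sum => j _; apply/ord_geMl/ord_ge_comp/ord_ge_deriv.
Qed.

End FpsComp.

Arguments fps_comp : simpl never.

(** The composite is again linear, multiplicative and continuous, hence a
    substitution by [fps_comp_uniq]. *)
Lemma fps_comp_comp m p q (K : comNzRingType) (H : 'I_p -> fps q K)
    (G : 'I_m -> fps p K) f :
  fps_comp H (fps_comp G f) = fps_comp (fun i => fps_comp H (G i)) f.
Proof.
apply: (fps_comp_uniq (X := fps_comp H \o fps_comp G)) => /=.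
- by move=> u v; rewrite !raddfB.
- by move=> u v; rewrite !rmorphM.
- by move=> c u; rewrite !linearZ.
- by rewrite !rmorph1.
- by move=> n u nu; do 2 apply: ord_ge_comp.
- move=> i; rewrite fps_compX_dc {1}/fps_dc raddfB /= linearZ /= rmorph1 /fps_dc.
  by rewrite fps_comp_coef0.
Qed.

Lemma fps_comp_id m (K : comNzRingType) (f : fps m K) : fps_comp fpsX f = f.
Proof.
apply/esym/(fps_comp_uniq (X := id)) => // i.
rewrite fps_dc_id //=; case: eqVneq => // /ffunP/(_ i).
by rewrite !ffunE eqxx.
Qed.

Lemma eq_fps_comp m p (K : comNzRingType) (G H : 'I_m -> fps p K) :
  G =1 H -> fps_comp G =1 fps_comp H.
Proof. by move=> /funext ->. Qed.

(** Reduction to monomials, where [a b - a' b' = (a - a') b + a' (b - b')]. *)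
Lemma ord_ge_compB m p (K : comNzRingType) (G H : 'I_m -> fps p K) n f :
    (forall i, ord_ge n (G i - H i)) ->
  ord_ge n (fps_comp G f - fps_comp H f).
Proof.
move=> GH.
have dcB i : ord_ge n (fps_dc (G i) - fps_dc (H i)).
  have -> : fps_dc (G i) - fps_dc (H i) = fps_dc (G i - H i).
    by rewrite /fps_dc /= scalerBl; ring.
  apply: ord_geB => // a an; rewrite fps_coefZ; have [->|a0] := eqVneq a mi0.
    by rewrite (GH i) ?mul0r // mi_deg0 (leq_ltn_trans _ an).
  by rewrite /= (negbTE a0) mulr0.
have powB a : ord_ge n (fps_pow G a - fps_pow H a).
  elim/(@mi_ind m): a => [|a i IH]; first by rewrite !fps_pow0 subrr.
  rewrite !fps_powD !fps_pow1.
  have -> : fps_pow G a * fps_dc (G i) - fps_pow H a * fps_dc (H i) =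
    (fps_pow G a - fps_pow H a) * fps_dc (G i)
    + fps_pow H a * (fps_dc (G i) - fps_dc (H i)) by ring.
  by apply: ord_geD; [apply: ord_geMr|apply: ord_geMl].
have -> : fps_comp G f - fps_comp H f =
    (fps_comp G f - fps_ev G n f) + (fps_ev G n f - fps_ev H n f)
    - (fps_comp H f - fps_ev H n f) by ring.
apply: ord_geB; last exact: fps_comp_ev.
apply: ord_geD; first exact: fps_comp_ev.
rewrite /fps_ev -sumrB; apply: ord_ge_sum => b _.
by rewrite -scalerBr; apply: ord_geZ.
Qed.

(** ** Change of coefficients *)
Section FpsMap.
Context {K K' : comNzRingType} (s : {rmorphism K -> K'}).

Lemma fps_mapB m (f g : fps m K) : fps_map s (f - g) = fps_map s f - fps_map s g.
Proof. by apply: fps_ext => a /=; rewrite rmorphB. Qed.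

HB.instance Definition _ m :=
  GRing.isZmodMorphism.Build (fps m K) (fps m K') (fps_map s) (@fps_mapB m).

Lemma fps_map1 m : fps_map s (1 : fps m K) = 1.
Proof. by apply: fps_ext => a /=; case: eqP; rewrite ?rmorph1 ?rmorph0. Qed.

Lemma fps_mapM m : {morph (fps_map s : fps m K -> fps m K') : f g / f * g}.
Proof.
by move=> f g; apply: fps_ext => a /=; rewrite rmorph_sum; apply: eq_bigr => b _; rewrite rmorphM.
Qed.

HB.instance Definition _ m :=
  GRing.isMonoidMorphism.Build (fps m K) (fps m K') (fps_map s)
    (@fps_map1 m, @fps_mapM m).

Lemma fps_mapZ m c (f : fps m K) : fps_map s (c *: f) = s c *: fps_map s f.
Proof. by apply: fps_ext => a /=; rewrite rmorphM. Qed.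

Lemma fps_map_deriv m i (f : fps m K) :
  fps_map s (fps_deriv i f) = fps_deriv i (fps_map s f).
Proof. by apply: fps_ext => a /=; rewrite rmorphMn. Qed.

Lemma fps_mapX m (i : 'I_m) : fps_map s (fpsX i) = fpsX i.
Proof. by apply: fps_ext => a /=; rewrite rmorph_nat. Qed.

Lemma fps_map_pow m p (G : 'I_m -> fps p K) a :
  fps_map s (fps_pow G a) = fps_pow (fun i => fps_map s (G i)) a.
Proof.
rewrite /fps_pow rmorph_prod; apply: eq_bigr => j _.
by rewrite rmorphXn /= rmorphB /= fps_mapZ rmorph1.
Qed.

Lemma fps_map_comp m p (G : 'I_m -> fps p K) f :
  fps_map s (fps_comp G f) = fps_comp (fun i => fps_map s (G i)) (fps_map s f).
Proof.
apply: fps_ext => c; rewrite /fps_comp /= -[LHS]/(fps_coef (fps_map s _) c).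
rewrite /fps_ev rmorph_sum !fps_coef_sum; apply: eq_bigr => b _.
by rewrite -fps_map_pow /= rmorphM.
Qed.

End FpsMap.

Global Opaque fps_comp.

(** * The formal inverse function theorem *)

Section Contraction.
Context {m : nat} {K : comNzRingType}.
Implicit Types (f g h : fps m K) (T : fps m K -> fps m K).

(** Picard iteration: the iterates form a Cauchy sequence for the order
    filtration, in which power series are complete. *)
Lemma fps_fixpoint T :
    (forall n f g, ord_ge n (f - g) -> ord_ge n.+1 (T f - T g)) ->
  exists f, T f = f.
Proof.
move=> Tc; pose u n := iter n T 0.
have uS n : ord_ge n (u n.+1 - u n).
  by elim: n => [|n IH]; [exact: ord_ge0|exact: Tc].
have u_stable n k : ord_ge n (u (n + k)%N - u n).
  elim: k => [|k IH]; first by rewrite addn0 subrr.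
  rewrite addnS; have -> : u (n + k).+1 - u n = (u (n + k).+1 - u (n + k)%N) +
     (u (n + k)%N - u n) by ring.
  by apply: ord_geD => //; apply: ord_geW (uS _); apply: leq_addr.
pose f : fps m K := Fps (fun a => fps_coef (u (mi_deg a).+1) a).
have fu n : ord_ge n (f - u n).
  move=> a an; have := u_stable (mi_deg a).+1 (n - (mi_deg a).+1)%N a (ltnSn _).
  by rewrite subnKC // !fps_coefD /= => /eqP; rewrite subr_eq0 => /eqP ->; rewrite subrr.
exists f; apply/eqP; rewrite -subr_eq0; apply/eqP/ord_ge_eq0 => n.
have -> : T f - f = (T f - T (u n)) - (f - u n.+1) by rewrite /u /=; ring.
apply: (@ord_geW _ _ n.+1) => //.
by apply: ord_geB; [apply: Tc|]; apply: fu.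
Qed.

Lemma fps_inv1 f : fps_coef f mi0 = 1 -> exists g, f * g = 1.
Proof.
move=> f1; have [|g gE] := @fps_fixpoint (fun g => 1 - (f - 1) * g).
  move=> n u v uv; have -> : 1 - (f - 1) * u - (1 - (f - 1) * v) =
    - ((f - 1) * (u - v)) by ring.
  apply: ord_geN; rewrite -add1n; apply: ord_geM => //.
  by apply/ord_ge1; rewrite fps_coefD /= f1 eqxx subrr.
exists g; have -> : f * g = g + (f - 1) * g by ring.
by rewrite -{1}gE subrK.
Qed.

Section NearIdentity.
Context (H : 'I_m -> fps m K) (HX : forall i, ord_ge 2 (H i - fpsX i)).

Lemma near_id_coef0 i : fps_coef (H i) mi0 = 0.
Proof.
have := HX (a := @mi0 m) i; rewrite mi_deg0 => /(_ isT).
rewrite fps_coefD /=; case: eqVneq => [/ffunP/(_ i)|_].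
  by rewrite !ffunE eqxx.
by rewrite oppr0 addr0.
Qed.

(** A substitution tangent to the identity acts as the identity on each graded
    piece of the order filtration. *)
Lemma near_id_comp n f : ord_ge n f -> ord_ge n.+1 (fps_comp H f - f).
Proof.
have dcH i : fps_dc (H i) = H i by rewrite fps_dc_id ?near_id_coef0.
have mono a : ord_ge (mi_deg a).+1 (fps_pow H a - fps_mono a).
  elim/(@mi_ind m): a => [|a i IH]; first by rewrite fps_pow0 fps_mono0 subrr.
  rewrite fps_powD fps_monoD fps_pow1 fps_mono1 dcH mi_deg_add mi_deg1.
  have -> : fps_pow H a * H i - fps_mono a * fpsX i =
    fps_pow H a * (H i - fpsX i) + (fps_pow H a - fps_mono a) * fpsX i by ring.
  apply: ord_geD.
    by rewrite -addnS; apply: ord_geM => //; apply: ord_ge_pow.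
  rewrite -addSn; apply: ord_geM => //.
  by rewrite -(mi_deg1 i); apply: ord_ge_mono.
move=> fn.
have -> : fps_comp H f - f = (fps_comp H f - fps_ev H n.+1 f) -
  (f - fps_trunc n.+1 f) + (fps_ev H n.+1 f - fps_trunc n.+1 f) by ring.
apply: ord_geD.
  by apply: ord_geB; [apply: fps_comp_ev|apply: ord_ge_trunc].
rewrite /fps_ev /fps_trunc -sumrB; apply: ord_ge_sum => b _.
rewrite -scalerBr; have [bn|nb] := ltnP (mi_deg (mi_val b)) n.
  by rewrite fn // scale0r.
by apply: ord_geZ; apply: ord_geW (mono _); rewrite ltnS.
Qed.

Lemma near_id_inj f : fps_comp H f = 0 -> f = 0.
Proof.
move=> f0; apply: ord_ge_eq0; elim=> [|n IH]; first exact: ord_ge0.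
have := near_id_comp IH; rewrite f0 sub0r => /ord_geN; rewrite opprK.
exact.
Qed.

(** Solve [f = g - (H^* f - f)], where the right-hand side is a contraction in
    [f] by [near_id_comp]. *)
Lemma near_id_surj g : exists f, fps_comp H f = g.
Proof.
have [|f fE] := @fps_fixpoint (fun f => g - (fps_comp H f - f)).
  move=> n u v uv.
  have -> : g - (fps_comp H u - u) - (g - (fps_comp H v - v)) =
    - (fps_comp H (u - v) - (u - v)) by rewrite raddfB /=; ring.
  by apply: ord_geN; apply: near_id_comp.
exists f; apply/eqP; rewrite -subr_eq0; apply/eqP.
have -> : fps_comp H f - g = f - (g - (fps_comp H f - f)) by ring.
by rewrite fE subrr.
Qed.

End NearIdentity.
End Contraction.

Lemma fps_inv m (K : fieldType) (f : fps m K) :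
  fps_coef f mi0 != 0 -> exists g, f * g = 1.
Proof.
move=> f0; have [|g fg] := @fps_inv1 m K ((fps_coef f mi0)^-1 *: f).
  by rewrite fps_coefZ mulVf.
by exists ((fps_coef f mi0)^-1 *: g); rewrite -fps_scaleAr scalerAl.
Qed.

Lemma mi_deg_eq1 m (a : multi_index m) : mi_deg a = 1%N -> exists i, a = mi1 i.
Proof.
elim/(@mi_ind m): a => [|a i _]; first by rewrite mi_deg0.
rewrite mi_deg_add mi_deg1 addn1 => -[/mi_deg_eq0 ->].
by exists i; rewrite mi_add0.
Qed.

Lemma mi1_inj m : injective (@mi1 m).
Proof.
move=> i j /ffunP/(_ i); rewrite !ffunE eqxx.
by case: eqVneq.
Qed.

Section LinearSubst.
Context {K : comNzRingType}.

Definition linX q m (B : 'M[K]_(q, m)) (i : 'I_q) : fps m K :=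
  \sum_l B i l *: fpsX l.

Lemma fpsX_coef0 m (l : 'I_m) : fps_coef (fpsX l : fps m K) mi0 = 0.
Proof.
by rewrite /=; case: eqVneq => // /ffunP/(_ l); rewrite !ffunE eqxx.
Qed.

Lemma linX_coef0 q m (B : 'M[K]_(q, m)) i : fps_coef (linX B i) mi0 = 0.
Proof.
rewrite fps_coef_sum big1 // => l _.
by rewrite fps_coefZ fpsX_coef0 mulr0.
Qed.

Lemma fps_comp_linX q m p (B : 'M[K]_(q, m)) (G : 'I_m -> fps p K) i :
    (forall l, fps_coef (G l) mi0 = 0) ->
  fps_comp G (linX B i) = \sum_l B i l *: G l.
Proof.
move=> G0; rewrite raddf_sum; apply: eq_bigr => l _ /=.
by rewrite linearZ /= fps_compX.
Qed.

Lemma linXM q m p (A : 'M[K]_(q, m)) (B : 'M[K]_(m, p)) i :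
  fps_comp (linX B) (linX A i) = linX (A *m B) i.
Proof.
rewrite fps_comp_linX; last exact: linX_coef0.
under eq_bigr do rewrite scaler_sumr; rewrite exchange_big /=.
apply: eq_bigr => l _; rewrite mxE scaler_suml.
by apply: eq_bigr => j _; rewrite scalerA.
Qed.

Lemma linX1 m i : linX (1%:M : 'M[K]_m) i = fpsX i.
Proof.
rewrite /linX (bigD1 i) //= mxE eqxx scale1r big1 ?addr0 // => j ji.
by rewrite mxE eq_sym (negbTE ji) scale0r.
Qed.

(** Factor the substitution into its linear part, which is inverted by linear
    algebra, and a substitution tangent to the identity. *)
Lemma fps_inverse_function p m (Phi : 'I_p -> fps m K) (N : 'M[K]_(m, p)) :
    let M := \matrix_(i < p, l < m) fps_coef (Phi i) (mi1 l) in
    (forall i, fps_coef (Phi i) mi0 = 0) -> N *m M = 1%:M -> M *m N = 1%:M ->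
  exists Psi : 'I_m -> fps p K,
    [/\ forall l, fps_coef (Psi l) mi0 = 0,
        forall f, fps_comp Phi (fps_comp Psi f) = f &
        forall g, fps_comp Psi (fps_comp Phi g) = g].
Proof.
move=> M Phi0 NM MN; pose H l := fps_comp Phi (linX N l).
have HE l : H l = \sum_i N l i *: Phi i by rewrite /H fps_comp_linX.
have HX l : ord_ge 2 (H l - fpsX l).
  move=> a; rewrite ltnS leq_eqVlt => /predU1P[/mi_deg_eq1[j ->]|].
    have := congr1 (fun A : 'M[K]_m => A l j) NM; rewrite !mxE HE fps_coefD fps_coef_sum /=.
    move=> NMlj; rewrite (inj_eq (@mi1_inj m)) (eq_sym j) -NMlj.
    by apply/eqP; rewrite subr_eq0; apply/eqP/eq_bigr => i _; rewrite mxE.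
  rewrite ltnS leqn0 => /eqP/mi_deg_eq0 ->.
  rewrite fps_coefD HE fps_coef_sum -[fps_coef (- _) _]/(- fps_coef _ _) fpsX_coef0.
  by rewrite oppr0 addr0 big1 // => i _; rewrite fps_coefZ Phi0 mulr0.
have /choice[Psi1 Psi1E] : forall l, exists u, fps_comp H u = fpsX l.
  by move=> l; apply: near_id_surj.
have Psi10 l : fps_coef (Psi1 l) mi0 = 0.
  by rewrite -(fps_comp_coef0 H) Psi1E fpsX_coef0.
have HPsi f : fps_comp H (fps_comp Psi1 f) = f.
  by rewrite fps_comp_comp -[RHS]fps_comp_id; apply: eq_fps_comp => l; apply: Psi1E.
pose Psi l := fps_comp (linX N) (Psi1 l).
have HH f : fps_comp H f = fps_comp Phi (fps_comp (linX N) f).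
  by rewrite fps_comp_comp.
have PhiPsi f : fps_comp Phi (fps_comp Psi f) = f.
  by rewrite -[RHS]HPsi HH; congr fps_comp; rewrite fps_comp_comp.
have Phi_inj g : fps_comp Phi g = 0 -> g = 0.
  have -> : g = fps_comp (linX N) (fps_comp (linX M) g).
    rewrite fps_comp_comp -[LHS]fps_comp_id; apply: eq_fps_comp => i.
    by rewrite linXM MN linX1.
  by rewrite -HH => /(near_id_inj HX) ->; rewrite raddf0.
exists Psi; split=> // [l|g]; first by rewrite /Psi fps_comp_coef0.
apply/eqP; rewrite -subr_eq0; apply/eqP/Phi_inj.
by rewrite raddfB /= PhiPsi subrr.
Qed.

End LinearSubst.

(** * Straightening manifold ideals *)

(** Distribute each monomial over the first variable of [E] that occurs in it. *)
Lemma coordinate_ideal m (K : comNzRingType) (E : pred 'I_m) (f : fps m K) :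
    (forall a : multi_index m, (forall i, E i -> a i = 0%N) -> fps_coef f a = 0) ->
  exists g : 'I_m -> fps m K, f = \sum_(i | E i) fpsX i * g i.
Proof.
move=> f0; pose first (b : multi_index m) := [pick e | E e && (0 < b e)%N].
pose g i : fps m K :=
  Fps (fun a => let b := mi_add a (mi1 i) in
    if first b == Some i then fps_coef f b else 0).
exists g; apply: fps_ext => b; rewrite fps_coef_sum.
have termE i : fps_coef (fpsX i * g i) b = if first b == Some i then fps_coef f b else 0.
  have [/mi_pred[a ->]|] := ltnP 0 (b i).
    by rewrite -fps_mono1 mi_addC fps_coef_monoM mi_addC.
  rewrite leqn0 => /eqP bi; rewrite -fps_mono1 fps_coef_monoM0.
    by rewrite /first; case: pickP => //= e /andP[_ be]; case: eqP => // -[ei]; rewrite ei bi in be.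
  by move=> c /ffunP/(_ i); rewrite !ffunE bi eqxx.
under eq_bigr do rewrite termE.
rewrite /first; case: pickP => [i0 /andP[Ei0 bi0]|noE].
  rewrite (bigD1 i0) //= eqxx big1 ?addr0 // => j /andP[_ ji].
  by case: eqP => // -[ij]; rewrite ij eqxx in ji.
rewrite f0 ?big1 // => i Ei; apply/eqP; rewrite -leqn0 leqNgt; apply/negP => bi.
by have := noE i; rewrite Ei bi.
Qed.

Lemma is_ideal_sum (A : comNzRingType) (I : set A) (T : Type) (s : seq T)
    (P : pred T) (F : T -> A) : is_ideal I ->
  (forall i, P i -> I (F i)) -> I (\sum_(i <- s | P i) F i).
Proof. by move=> [I0 ID _] IF; elim/big_rec: _ => // i x Pi; apply: ID; apply: IF. Qed.

Lemma smallest_ideal (A : comNzRingType) (G : set A) : is_ideal (smallest (@is_ideal A) G).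
Proof.
split=> [I [[I0 _ _] _]|f g fI gI I IG|f g gI I IG] //.
  by case: (IG) => -[_ ID _] _; apply: ID; [apply: fI|apply: gI].
by case: (IG) => -[_ _ IM] _; apply: IM; apply: gI.
Qed.

Lemma smallest_ideal_sub (A : comNzRingType) (G J : set A) :
  is_ideal J -> G `<=` J -> smallest (@is_ideal A) G `<=` J.
Proof. by move=> JI GJ f; apply. Qed.

Lemma smallest_ideal_gen (A : comNzRingType) (G : set A) :
  G `<=` smallest (@is_ideal A) G.
Proof. by move=> f Gf J [_]; apply. Qed.

Section Straighten.
Context {m : nat} {K : fieldType}.

(** In suitable formal coordinates, the [Phi], a manifold ideal is generated by
    the first [k] coordinates: it consists of the series that vanish once these
    coordinates are set to zero. *)
Lemma manifold_ideal_chart k (I : set (fps m K)) : manifold_ideal k I ->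
  exists d (Phi : 'I_(k + d) -> fps m K) (Psi : 'I_m -> fps (k + d) K),
  [/\ (k + d = m)%N, forall i, fps_coef (Phi i) mi0 = 0,
      forall l, fps_coef (Psi l) mi0 = 0,
      (forall f, fps_comp Phi (fps_comp Psi f) = f) /\
      (forall g, fps_comp Psi (fps_comp Phi g) = g) &
      forall f, I f <-> (forall a : multi_index (k + d),
         (forall j, a (lshift d j) = 0%N) -> fps_coef (fps_comp Psi f) a = 0)].
Proof.
move=> [F [F0 Fdiff ->]]; set A := \matrix_j _ in Fdiff.
pose B := row_base (A^C)%MS; pose d := \rank (A^C)%MS.
have rkA : \rank A = k by apply/eqP.
have kd : (k + d = m)%N.
  by rewrite /d mxrank_compl rkA subnKC // -rkA rank_leq_col.
have rk : \rank (col_mx A B) = m.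
  apply/eqP; rewrite -/(row_full _) -sub1mx -addsmxE.
  apply: submx_trans (_ : (A + A^C <= _)%MS); first by rewrite sub1mx addsmx_compl_full.
  by apply: addsmxS => //; rewrite eq_row_base.
have /row_freeP[N1 MN1] : row_free (col_mx A B) by rewrite /row_free rk kd.
have /row_fullP[N N2M] : row_full (col_mx A B) by rewrite /row_full rk.
have NN1 : N = N1 by rewrite -[RHS]mul1mx -N2M -mulmxA MN1 mulmx1.
pose Phi (i : 'I_(k + d)) : fps m K :=
  match fintype.split i with inl j => F j | inr l => linX B l end.
have Phil j : Phi (lshift d j) = F j by rewrite /Phi (unsplitK (inl j)).
have Phi0 i : fps_coef (Phi i) mi0 = 0.
  by rewrite /Phi; case: fintype.split => j; rewrite ?F0 ?linX_coef0.
have ME : \matrix_(i, l) fps_coef (Phi i) (mi1 l) = col_mx A B.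
  apply/matrixP => i l; rewrite mxE /Phi mxE; case: fintype.splitP => j _.
    by rewrite !mxE.
  rewrite fps_coef_sum (bigD1 l) //= eqxx mulr1 big1 ?addr0 // => l' l'l.
  by rewrite (inj_eq (@mi1_inj m)) eq_sym (negbTE l'l) mulr0.
have [||Psi [Psi0 PhiPsi PsiPhi]] := @fps_inverse_function K _ _ Phi N Phi0.
- by rewrite ME.
- by rewrite ME NN1.
exists d, Phi, Psi; split=> // f; split.
  have kerI : is_ideal [set f | forall a : multi_index (k + d),
      (forall j, a (lshift d j) = 0%N) -> fps_coef (fps_comp Psi f) a = 0].
    split=> [a _|u v ku kv a a0|u v kv a a0].
    - by rewrite raddf0.
    - by rewrite raddfD fps_coefD ku // kv // addr0.
    rewrite rmorphM /= big_seq big1 // => -[x y] /=.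
    rewrite mem_mi_splits => /eqP xya; rewrite kv ?mulr0 // => j.
    by have /eqP := a0 j; rewrite -xya ffunE addn_eq0 => /andP[_ /eqP].
  move=> fI; apply: (smallest_ideal_sub kerI _ fI) => _ [j _ <-] a a0 /=.
  rewrite -Phil -(@fps_compX _ _ _ Phi) // PsiPhi /=.
  case: eqVneq => // aE; have := a0 j.
  by rewrite aE ffunE eqxx.
move=> f0; have [|g gE] := @coordinate_ideal _ _
    (fun i : 'I_(k + d) => if fintype.split i is inl _ then true else false) (fps_comp Psi f).
  move=> a a0; apply: f0 => j; apply: a0.
  by rewrite (unsplitK (inl j)).
rewrite -[f]PhiPsi gE raddf_sum /=; apply: is_ideal_sum; first exact: smallest_ideal.
move=> i; case: (fintype.splitP i) => // j ij _.
have -> : i = lshift d j by apply: val_inj.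
rewrite rmorphM /= fps_compX // Phil mulrC.
have [_ _ IM] := smallest_ideal (range F); apply: IM.
by apply: smallest_ideal_gen; exists j.
Qed.

End Straighten.

(** * Polarization *)

Section Polarization.
Context {A : zmodType}.

Lemma iter_binomial (D E : A -> A) n f :
    (forall u v, D (u + v) = D u + D v) -> (forall u v, E (u + v) = E u + E v) ->
    (forall u, D (E u) = E (D u)) ->
  iter n (fun u => D u + E u) f =
  \sum_(i < n.+1) iter (n - i) D (iter i E f) *+ 'C(n, i).
Proof.
move=> DD ED DE.
have D0 : D 0 = 0 by apply: (addIr (D 0)); rewrite -DD !add0r.
have E0 : E 0 = 0 by apply: (addIr (E 0)); rewrite -ED !add0r.
have Dn k u : D (u *+ k) = D u *+ k by elim: k => [|k IH]; rewrite ?mulr0n // !mulrS DD IH.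
have En k u : E (u *+ k) = E u *+ k by elim: k => [|k IH]; rewrite ?mulr0n // !mulrS ED IH.
have EDi k u : E (iter k D u) = iter k D (E u) by elim: k => //= k <-; rewrite DE.
elim: n => [|n IH] /=; first by rewrite big_ord1 mulr1n.
rewrite IH (big_morph D DD D0) (big_morph E ED E0).
rewrite big_ord_recl [X in _ + X]big_ord_recr /= [RHS]big_ord_recl [in RHS]big_ord_recr /=.
rewrite !bin0 !subn0 !subnn !binn !mulr1n /= -!addrA; congr (_ + _).
rewrite addrA; congr (_ + _).
rewrite -big_split /=; apply: eq_bigr => i _.
have bE : bump 0 i = i.+1 by [].
rewrite bE add0n Dn En EDi binS mulrnDr subSS; congr (_ *+ _ + _).
by rewrite -iterS subnSK.
Qed.

Context {K : numDomainType} {J : finType} (delta : J -> A -> A).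
Hypothesis deltaD : forall j u v, delta j (u + v) = delta j u + delta j v.
Hypothesis deltaC : forall i j u, delta i (delta j u) = delta j (delta i u).

Definition dirN (b : J -> nat) u : A := \sum_j delta j u *+ b j.

Lemma dirND b u v : dirN b (u + v) = dirN b u + dirN b v.
Proof. by rewrite /dirN -big_split; apply: eq_bigr => j _; rewrite deltaD mulrnDl. Qed.

Lemma delta0 j : delta j 0 = 0.
Proof. by apply: (addIr (delta j 0)); rewrite -deltaD !add0r. Qed.

Lemma deltaMn j k u : delta j (u *+ k) = delta j u *+ k.
Proof. by elim: k => [|k IH]; rewrite ?mulr0n ?delta0 // !mulrS deltaD IH. Qed.

Lemma delta_dirN j b u : delta j (dirN b u) = dirN b (delta j u).
Proof.
rewrite /dirN (big_morph _ (deltaD j) (delta0 j)); apply: eq_bigr => i _.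
by rewrite deltaMn deltaC.
Qed.

(** Expand the power of the derivative in the direction [b + t * e_j] as a
    polynomial in [t]. All natural numbers are roots of it, so its linear
    coefficient vanishes; this coefficient is one derivative along [e_j]
    followed by a power of the derivative along [b], and induction applies. *)
Lemma polarization (c : A -> K) (l : nat) (g : A) :
    (forall u v, c (u + v) = c u + c v) ->
    (forall b, c (iter l (dirN b) g) = 0) ->
  forall s, size s = l -> c (foldr delta g s) = 0.
Proof.
move=> cD; elim: l g => [|l IH] g cg s sl.
  by have := cg (fun=> 0%N); move/size0nil: sl => ->.
case/lastP: s sl => // s j; rewrite size_rcons => -[sl].
rewrite foldr_rcons; apply: IH => // b {s sl}.
have c0 : c 0 = 0 by apply: (addIr (c 0)); rewrite -cD !add0r.
have cMn k u : c (u *+ k) = c u *+ k.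
  by elim: k => [|k IHk]; rewrite ?mulr0n // !mulrS cD IHk.
pose q (i : nat) := c (iter (l.+1 - i) (dirN b) (iter i (delta j) g)) *+ 'C(l.+1, i).
pose p : {poly K} := \poly_(i < l.+2) q i.
have p_root (t : nat) : root p t%:R.
  apply/rootP; rewrite horner_poly.
  have := cg (fun i => b i + (i == j) * t)%N.
  pose E u := delta j u *+ t.
  have dE u : dirN (fun i => b i + (i == j) * t)%N u = dirN b u + E u.
    rewrite /dirN /E; under eq_bigr do rewrite mulrnDr.
    rewrite big_split /=; congr (_ + _).
    rewrite (bigD1 j) //= eqxx mul1n big1 ?addr0 // => i /negbTE ->.
    by rewrite mul0n mulr0n.
  rewrite (eq_iter dE) iter_binomial.
  - rewrite (big_morph c cD c0) => cs; rewrite -[RHS]cs; apply: eq_bigr => i _.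
    have -> : iter i E g = iter i (delta j) g *+ t ^ i.
      elim: (nat_of_ord i) => //= k ->.
      by rewrite /E deltaMn -mulrnA expnSr.
    have dn k r u : iter k (dirN b) (u *+ r) = iter k (dirN b) u *+ r.
      elim: k => //= k ->; elim: r => [|r IHr].
        by rewrite !mulr0n; apply: (addIr (dirN b 0)); rewrite -dirND !add0r.
      by rewrite !mulrS dirND IHr.
    rewrite dn !cMn /q -mulrnAC -natrX -[in LHS]mulr_natr.
    by rewrite mul1r mulr_natr.
  - exact: dirND.
  - by move=> u v; rewrite /E deltaD mulrnDl.
  - move=> u; rewrite /E delta_dirN; elim: (t) => [|k IHk].
      by rewrite !mulr0n; apply: (addIr (dirN b 0)); rewrite -dirND !add0r.
    by rewrite !mulrS dirND IHk.
have p0 : p = 0.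
  apply/eqP/negPn/negP => pn0.
  suff : (size [seq t%:R : K | t <- iota 0 (size p)] < size p)%N.
    by rewrite size_map size_iota ltnn.
  apply: max_poly_roots => //; first by apply/allP => _ /mapP[t _ ->].
  by rewrite map_inj_uniq ?iota_uniq // => x y /eqP; rewrite eqr_nat => /eqP.
have := congr1 (fun r : {poly K} => r`_1) p0.
rewrite coef_poly /= coef0 /q bin1 subn1 /= => /eqP.
by rewrite mulrn_eq0 /= => /eqP.
Qed.

End Polarization.

(** * Formal curves *)

(** The quantitative form of [fps_dense]: to bound the order of [E f] it
    suffices to bound it on scaled monomials. *)
Lemma fps_dense_ord m p (K K' : comNzRingType) (E : fps m K -> fps p K') (Q l : nat) :
    (forall f g, E (f - g) = E f - E g) ->
    (forall c a, ord_ge Q (E (c *: fps_mono a))) ->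
    (forall n f, ord_ge (n + l) f -> ord_ge n (E f)) ->
  forall f, ord_ge Q (E f).
Proof.
move=> EB Em El f.
have E0 : E 0 = 0 by rewrite -(subrr 0) EB subrr.
have EN g : E (- g) = - E g by rewrite -sub0r EB E0 sub0r.
have ED g h : E (g + h) = E g + E h by rewrite -{1}(opprK h) EB EN opprK.
rewrite -[f](subrK (fps_trunc (Q + l) f)) ED; apply: ord_geD.
  by apply: El; apply: ord_ge_trunc.
by rewrite /fps_trunc (big_morph E ED E0); apply: ord_ge_sum.
Qed.

Section OneVariable.
Context {K : comNzRingType}.
Implicit Types u v : fps 1 K.

Definition mi_one (j : nat) : multi_index 1 := [ffun=> j].
Definition cf (j : nat) u : K := fps_coef u (mi_one j).
Definition sX : fps 1 K := fpsX ord0.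

Lemma mi_oneE (a : multi_index 1) : a = mi_one (a ord0).
Proof. by apply/ffunP => i; rewrite ffunE ord1. Qed.

Lemma mi_deg_one j : mi_deg (mi_one j) = j.
Proof. by rewrite /mi_deg big_ord1 ffunE. Qed.

Lemma mi_oneD i j : mi_one (i + j) = mi_add (mi_one i) (mi_one j).
Proof. by apply/ffunP => l; rewrite !ffunE. Qed.

Lemma mi_one_inj : injective mi_one.
Proof. by move=> i j /ffunP/(_ ord0); rewrite !ffunE. Qed.

Lemma sXE j : sX ^+ j = fps_mono (mi_one j).
Proof.
elim: j => [|j IH].
  by rewrite expr0 -fps_mono0; congr fps_mono; apply/ffunP => i; rewrite !ffunE.
have -> : mi_one j.+1 = mi_add (mi_one j) (mi1 ord0).
  by apply/ffunP => i; rewrite !ffunE ord1 addn1.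
by rewrite exprSr IH fps_monoD.
Qed.

Lemma cf_sXM j i u : cf (j + i) (sX ^+ j * u) = cf i u.
Proof. by rewrite sXE /cf mi_oneD fps_coef_monoM. Qed.

Lemma ord_ge_cf n u : ord_ge n u <-> forall j, (j < n)%N -> cf j u = 0.
Proof.
split=> [un j jn|un a an]; first by apply: un; rewrite mi_deg_one.
by rewrite (mi_oneE a); apply: un; rewrite -(mi_deg_one (a ord0)) -mi_oneE.
Qed.

Lemma fps1_eq0 u : (forall j, cf j u = 0) -> u = 0.
Proof. by move=> u0; apply: fps_ext => a; rewrite (mi_oneE a); apply: u0. Qed.

Lemma cfD j u v : cf j (u + v) = cf j u + cf j v. Proof. by []. Qed.
Lemma cfZ j (c : K) u : cf j (c *: u) = c * cf j u. Proof. by []. Qed.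
Lemma cfN j u : cf j (- u) = - cf j u. Proof. by []. Qed.

Lemma cf_sXn i j : cf j (sX ^+ i) = (j == i)%:R.
Proof. by rewrite sXE /cf /= (inj_eq (@mi_one_inj)). Qed.

Lemma cf_poly N (c : nat -> K) j :
  cf j (\sum_(i < N) c i *: sX ^+ i) = if (j < N)%N then c j else 0.
Proof.
rewrite /cf fps_coef_sum; have [jN|Nj] := ltnP.
  rewrite (bigD1 (Ordinal jN)) //= -/(cf _ _) cf_sXn eqxx mulr1 big1 ?addr0 // => i ij.
  rewrite -/(cf _ _) cf_sXn; have -> : (j == i)%N = false.
    by apply: contraNF ij => /eqP ji; apply/eqP/val_inj.
  by rewrite mulr0.
rewrite big1 // => i _; rewrite fps_coefZ -/(cf _ _) cf_sXn.
by rewrite (gtn_eqF (leq_trans (ltn_ord i) Nj)) mulr0.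
Qed.

Lemma ord_ge_sX j : ord_ge j (sX ^+ j).
Proof. by rewrite sXE -{1}(mi_deg_one j); apply: ord_ge_mono. Qed.

End OneVariable.

Arguments sX {K}.

Section Taylor.
Context {m : nat} {K : numFieldType}.
Implicit Types (f g h : fps m K) (om : 'I_m -> fps 1 K) (b : 'I_m -> K).

Definition dirD b f : fps m K := \sum_i b i *: fps_deriv i f.

Lemma dirDB b f g : dirD b (f - g) = dirD b f - dirD b g.
Proof. by rewrite /dirD -sumrB; apply: eq_bigr => i _; rewrite raddfB /= scalerBr. Qed.

HB.instance Definition _ b :=
  GRing.isZmodMorphism.Build (fps m K) (fps m K) (dirD b) (dirDB b).

Lemma dirDZ b (c : K) f : dirD b (c *: f) = c *: dirD b f.
Proof.
rewrite /dirD scaler_sumr; apply: eq_bigr => i _.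
by rewrite linearZ /= !scalerA mulrC.
Qed.

HB.instance Definition _ b :=
  GRing.isScalable.Build K (fps m K) (fps m K) *:%R (dirD b) (dirDZ b).

Lemma dirD1 b : dirD b 1 = 0.
Proof. by rewrite /dirD big1 // => i _; rewrite fps_deriv1 scaler0. Qed.

Lemma dirDXM b i f : dirD b (f * fpsX i) = dirD b f * fpsX i + b i *: f.
Proof.
rewrite /dirD mulr_suml.
rewrite [X in _ = _ + X](_ : _ = \sum_j b j *: (f * (j == i)%:R)); last first.
  rewrite (bigD1 i) //= eqxx mulr1 big1 ?addr0 // => j /negbTE ->.
  by rewrite mulr0 scaler0.
rewrite -big_split /=; apply: eq_bigr => j _.
by rewrite fps_derivM fps_derivX scalerDr scalerAl.
Qed.

Lemma ord_ge_dirD n b f : ord_ge n.+1 f -> ord_ge n (dirD b f).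
Proof. by move=> fn; apply: ord_ge_sum => i _; apply/ord_geZ/ord_ge_deriv. Qed.

Definition taylor_sum om b M N f : fps 1 K :=
  \sum_(j < N) j`!%:R^-1 *: (sX ^+ (M * j) * fps_comp om (iter j (dirD b) f)).

(** Taylor expansion of a series along the curve [om] displaced by [s ^ M * b].
    Both sides are multiplicative against the coordinates up to order [M * N]. *)
Lemma taylor_curve om b M N f : (0 < M)%N ->
    (forall i, fps_coef (om i) mi0 = 0) ->
  ord_ge (M * N) (fps_comp (fun i => om i + b i *: sX ^+ M) f - taylor_sum om b M N f).
Proof.
move=> M0 om0; set omb := fun i => _.
have omb0 i : fps_coef (omb i) mi0 = 0.
  have : ord_ge 1 (omb i).
    apply: ord_geD; first exact/ord_ge1.
    by apply: ord_geZ; apply: (@ord_geW _ _ M) => //; apply: ord_ge_sX.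
  by move/ord_ge1.
have itB n u v : iter n (dirD b) (u - v) = iter n (dirD b) u - iter n (dirD b) v.
  by elim: n => //= n ->; rewrite dirDB.
have itZ n c u : iter n (dirD b) (c *: u) = c *: iter n (dirD b) u.
  by elim: n => //= n ->; rewrite dirDZ.
have it1 n : iter n.+1 (dirD b) 1 = 0.
  elim: n => [|n IH]; rewrite iterS ?dirD1 // IH.
  by rewrite raddf0.
have itXM n i u : iter n.+1 (dirD b) (u * fpsX i) =
    iter n.+1 (dirD b) u * fpsX i + (b i *: iter n (dirD b) u) *+ n.+1.
  elim: n => [|n IH]; first by rewrite /= dirDXM mulr1n.
  rewrite iterS IH raddfD raddfMn /= dirDXM linearZ /= -!iterS.
  by rewrite [in RHS]mulrS addrA.
case: N => [|N']; first by rewrite muln0.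
pose E f := fps_comp omb f - taylor_sum om b M N'.+1 f.
rewrite -/(E f); apply: (@fps_dense_ord _ _ _ _ E _ N'.+1) => [u v|c a|n u nu].
- rewrite /E /taylor_sum raddfB /=.
  under eq_bigr do rewrite itB raddfB /= mulrBr scalerBr.
  by rewrite sumrB; ring.
- have -> : E (c *: fps_mono a) = c *: E (fps_mono a).
    rewrite /E /taylor_sum linearZ /= scalerBr scaler_sumr; congr (_ - _).
    by apply: eq_bigr => j _; rewrite itZ linearZ /= -fps_scaleAr !scalerA mulrC.
  apply: ord_geZ; elim/(@mi_ind m): a => {c} [|a i IH].
    rewrite fps_mono0 /E rmorph1 /taylor_sum.
    rewrite big_ord_recl /= fact0 invr1 scale1r muln0 expr0 rmorph1 mulr1.
    rewrite big1 ?addr0 ?subrr // => j _.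
    by rewrite -iterS it1 raddf0 mulr0 scaler0.
  rewrite fps_monoD fps_mono1; set u := fps_mono a.
  have -> : E (u * fpsX i) = E u * omb i
      + N'`!%:R^-1 *: (b i *: (sX ^+ (M * N'.+1) * fps_comp om (iter N' (dirD b) u))).
    rewrite /E rmorphM /= fps_compX // mulrBl -addrA; congr (_ + _).
    have -> : taylor_sum om b M N'.+1 (u * fpsX i) = taylor_sum om b M N'.+1 u * om i
        + b i *: (sX ^+ M * taylor_sum om b M N' u).
      rewrite /taylor_sum big_ord_recl [in X in _ = X * _ + _]big_ord_recl.
      rewrite /= muln0 expr0 fact0 invr1 !scale1r !mul1r rmorphM /= fps_compX //.
      rewrite mulrDl -!addrA; congr (_ + _).
      rewrite mulr_suml mulr_sumr scaler_sumr -big_split /=; apply: eq_bigr => j _.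
      rewrite /bump /= add0n add1n -!iterS.
      have -> : fps_comp om (iter j.+1 (dirD b) (u * fpsX i)) =
          fps_comp om (iter j.+1 (dirD b) u) * om i
          + (b i *: fps_comp om (iter j (dirD b) u)) *+ j.+1.
        by rewrite itXM fps_compD fps_compM fps_compMn fps_compX // fps_compZ.
      rewrite mulrDr scalerDr; congr (_ + _); first by rewrite mulrA scalerAl.
      rewrite -scaler_nat scalerA -!fps_scaleAr !scalerA mulrA -exprD -mulnS.
      congr (_ *: _); rewrite factS natrM invfM mulrACA mulVf ?pnatr_eq0 //.
      by rewrite mul1r mulrC.
    have TE : taylor_sum om b M N'.+1 u = taylor_sum om b M N' u
        + N'`!%:R^-1 *: (sX ^+ (M * N') * fps_comp om (iter N' (dirD b) u)).
      by rewrite /taylor_sum big_ord_recr.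
    rewrite /omb mulrDr !opprD -!addrA; congr (_ + _).
    rewrite [_ * (b i *: _)]mulrC -scalerAl TE mulrDr scalerDr opprD -fps_scaleAr.
    rewrite mulrA -exprD -mulnS !scalerA [b i * _]mulrC.
    by rewrite subrK.
  apply: ord_geD; first exact: ord_geMr.
  by do 2 apply: ord_geZ; apply/ord_geMr/ord_ge_sX.
- have itn j w k : ord_ge (k + j) w -> ord_ge k (iter j (dirD b) w).
    elim: j k => [|j IHj] k; first by rewrite addn0.
    by rewrite addnS -addSn iterS => /IHj; apply: ord_ge_dirD.
  apply: ord_geB; first by apply/ord_ge_comp/(ord_geW _ nu)/leq_addr.
  apply: ord_ge_sum => j _; apply/ord_geZ/ord_geMl/ord_ge_comp/itn.
  by apply: ord_geW nu; rewrite leq_add2l ltnW.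
Qed.

End Taylor.

(** * Formal curves detect membership in a manifold ideal *)

Lemma fps_comp0 m p (K : comNzRingType) (F : fps m K) :
  fps_comp (fun=> 0 : fps p K) F = (fps_coef F mi0)%:A.
Proof.
apply/esym/(@fps_comp_uniq _ _ _ (fun=> 0 : fps p K) (fun F => (fps_coef F mi0)%:A)).
- by move=> f g; rewrite fps_coefD scalerDl -[fps_coef (- g) _]/(- fps_coef g _) scaleNr.
- by move=> f g; rewrite fps_coef0M -scalerAl mul1r scalerA.
- by move=> c f; rewrite fps_coefZ scalerA.
- by rewrite /= eqxx scale1r.
- move=> [|n] f fn a an //; rewrite fps_coefZ fn ?mul0r // mi_deg0.
  exact: leq_trans an.
- move=> i; by rewrite fpsX_coef0 /fps_dc /= !scale0r subrr.
Qed.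

Section CurveDetects.
Context {K : numFieldType}.

(** Formal Taylor formula: up to a nonzero factorial, the coefficient at [a]
    is the iterated derivative at the origin. *)
Lemma coef_derivs m (J : Type) (e : J -> 'I_m) (h : fps m K) :
    (forall s : seq J, fps_coef (foldr (fun j => fps_deriv (e j)) h s) mi0 = 0) ->
  forall a : multi_index m, (forall i, (0 < a i)%N -> exists j, i = e j) ->
  fps_coef h a = 0.
Proof.
move=> h0 a; elim/(@mi_ind m): a h h0 => [|a i IH] h h0 ae; first exact: (h0 [::]).
have [j ij] : exists j, i = e j by apply: ae; rewrite !ffunE eqxx addn1.
have := IH (fps_deriv i h) _ _; rewrite fps_coef_deriv => /(_ _ _)/eqP.
rewrite mulrn_eq0 /= => H; apply/eqP/H => [s|l al].
  by have := h0 (rcons s j); rewrite foldr_rcons ij.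
by apply: ae; rewrite !ffunE; apply: leq_trans al _; apply: leq_addr.
Qed.

Definition spread m (J : finType) (e : J -> 'I_m) (t : J -> nat) (i : 'I_m) : K :=
  \sum_j (i == e j)%:R *+ t j.

Lemma dirD_spread m (J : finType) (e : J -> 'I_m) (t : J -> nat) (h : fps m K) :
  dirD (spread e t) h = dirN (fun j => fps_deriv (e j)) t h.
Proof.
rewrite /dirD /dirN; under eq_bigr do rewrite scaler_suml.
rewrite exchange_big /=; apply: eq_bigr => j _.
rewrite (bigD1 (e j)) //= eqxx scaler_nat big1 ?addr0 // => i /negbTE ->.
by rewrite mul0rn scale0r.
Qed.

Definition supported m (J : Type) (e : J -> 'I_m) (a : multi_index m) : Prop :=
  forall i, (0 < a i)%N -> exists j, i = e j.

(** Restrict to the coordinate subspace. If the restriction vanished on all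
    lines with integral direction, then by [taylor_curve] so would all powers
    of directional derivatives at the origin, hence by [polarization] all
    derivatives. *)
Lemma line_detects m q (Psi : 'I_m -> fps q K) (J : finType) (e : J -> 'I_q) (g : fps m K) a :
    (forall l, fps_coef (Psi l) mi0 = 0) -> supported e a -> fps_coef (fps_comp Psi g) a != 0 ->
  exists c : 'I_m -> fps 1 K,
    [/\ forall l, fps_coef (c l) mi0 = 0,
        forall f, (forall b, supported e b -> fps_coef (fps_comp Psi f) b = 0) ->
          fps_comp c f = 0 & fps_comp c g != 0].
Proof.
move=> Psi0 ae ga.
pose h := fps_comp Psi g.
pose om t : 'I_q -> fps 1 K := fun i => spread e t i *: sX.
have om0 t i : fps_coef (om t i) mi0 = 0 by rewrite fps_coefZ fpsX_coef0 mulr0.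
have [[t ht]|H] := pselect (exists t, fps_comp (om t) h != 0).
  exists (fun l => fps_comp (om t) (Psi l)); split.
  - by move=> l; rewrite fps_comp_coef0.
  - move=> f f0; rewrite -fps_comp_comp.
    have [|u ->] := @coordinate_ideal _ _ (fun i => `[< forall j, i <> e j >]) (fps_comp Psi f).
      move=> b b0; apply: f0 => i bi; apply: contrapT => ie.
      by move: bi; rewrite b0 //; apply/asboolP => j ij; apply: ie; exists j.
    rewrite fps_comp_sum big1 // => i /asboolP ie.
    rewrite fps_compM fps_compX // /om /spread big1 ?scale0r ?mul0r // => j _.
    by case: eqP => [/ie //|]; rewrite mul0rn.
  - by rewrite -fps_comp_comp.
suff : fps_coef h a = 0 by move/eqP; rewrite (negbTE ga).
apply: (@coef_derivs _ _ e) ae => s.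
apply: (@polarization _ K _ (fun j => fps_deriv (e j)) _ _ (fun u => fps_coef u mi0)
  (size s)) => // [j u v|i j u|t]; first exact: raddfD; first exact: fps_derivC.
rewrite -(eq_iter (dirD_spread e t)).
have ht : fps_comp (om t) h = 0 by apply/eqP/negPn/negP => /negP ht; apply: H; exists t; apply/negP.
have := @taylor_curve _ K (fun=> 0) (spread e t) 1 (size s).+1 h isT (fun=> erefl).
rewrite (_ : fps_comp _ h = 0) ?sub0r; last first.
  by rewrite -[RHS]ht; apply: eq_fps_comp => i; rewrite add0r expr1.
move=> /ord_geN; rewrite opprK mul1n => /ord_ge_cf/(_ (size s) (ltnSn _)).
have -> : taylor_sum (fun=> 0) (spread e t) 1 (size s).+1 h =
    \sum_(i < (size s).+1) (i`!%:R^-1 * fps_coef (iter i (dirD (spread e t)) h) mi0)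
      *: sX ^+ i.
  apply: eq_bigr => i _.
  by rewrite fps_comp0 -fps_scaleAr mulr1 scalerA mul1n.
rewrite (cf_poly _ (fun i => i`!%:R^-1 * fps_coef (iter i (dirD (spread e t)) h) mi0)).
rewrite ltnSn => /eqP; rewrite mulf_eq0 invr_eq0 pnatr_eq0.
by rewrite -leqn0 leqNgt fact_gt0 /= => /eqP.
Qed.

Lemma supported_rshift k d (a : multi_index (k + d)) :
  supported (@rshift k d) a <-> forall j, a (lshift d j) = 0%N.
Proof.
split=> [ae j|a0 i ai].
  apply/eqP; rewrite -leqn0 leqNgt; apply/negP => /ae[l /eqP].
  by rewrite eq_lrshift.
by case: (split_ordP i) ai => [j ->|l ->]; [rewrite a0|exists l].
Qed.

(** In a chart the submanifold is a coordinate subspace and [line_detects]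
    applies. *)
Lemma curve_detects m k (I : set (fps m K)) (g : fps m K) :
    manifold_ideal k I -> ~ I g ->
  exists c : 'I_m -> fps 1 K,
    [/\ forall l, fps_coef (c l) mi0 = 0,
        forall f, I f -> fps_comp c f = 0 & fps_comp c g != 0].
Proof.
move=> /manifold_ideal_chart[d [Phi [Psi [_ _ Psi0 _ IE]]]] Ig.
have [a /supported_rshift ae ga] : exists2 a : multi_index (k + d),
    (forall j, a (lshift d j) = 0%N) & fps_coef (fps_comp Psi g) a != 0.
  apply: contrapT => H; apply/Ig/IE => a a0; apply/eqP/negPn/negP => ga.
  by apply: H; exists a.
have [c [c0 cI cg]] := line_detects Psi0 ae ga; exists c; split=> // f /IE fI.
by apply: cI => b /supported_rshift; apply: fI.
Qed.

End CurveDetects.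

(** * Powers of an ideal along a family of commuting derivations *)

Section IdealOrder.
Context {A : comNzRingType} {J : Type} (delta : J -> A -> A) (I : set A).
Hypothesis deltaD : forall j u v, delta j (u + v) = delta j u + delta j v.
Hypothesis deltaM : forall j u v, delta j (u * v) = delta j u * v + u * delta j v.
Hypothesis deltaC : forall i j u, delta i (delta j u) = delta j (delta i u).
Hypothesis II : is_ideal I.

(** Vanishing to order [k] on the locus of [I], as seen by differentiation
    along the [delta] only. *)
Fixpoint Iord (k : nat) (f : A) : Prop :=
  if k is k'.+1 then I f /\ forall j, Iord k' (delta j f) else True.

Lemma Iord_foldr k f :
  Iord k f <-> forall s, (size s < k)%N -> I (foldr delta f s).
Proof.
elim: k f => [|k IH] f /=; first by split.
split=> [[If df] s|H].
  case/lastP: s => // s j; rewrite size_rcons ltnS foldr_rcons => sk.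
  by have /IH := df j; apply.
split=> [|j]; first exact: (H [::]).
by apply/IH => s sk; have := H (rcons s j); rewrite size_rcons foldr_rcons; apply.
Qed.

Lemma Iord0 k : Iord k 0.
Proof.
have d0 j : delta j 0 = 0 by apply: (addIr (delta j 0)); rewrite -deltaD !add0r.
have [I0 _ _] := II.
by elim: k => //= k IH; split=> // j; rewrite d0.
Qed.

Lemma IordD k f g : Iord k f -> Iord k g -> Iord k (f + g).
Proof.
have [_ ID _] := II.
elim: k f g => //= k IH f g [If df] [Ig dg]; split; first exact: ID.
by move=> j; rewrite deltaD; apply: IH.
Qed.

Lemma IordS k f : Iord k.+1 f -> Iord k f.
Proof. by elim: k f => //= k IH f [If df]; split=> // j; apply: IH. Qed.

Lemma IordW k l f : (l <= k)%N -> Iord k f -> Iord l f.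
Proof.
move=> /subnK <-; elim: (k - l)%N => //= i IH h; apply: IH.
exact: (@IordS (i + l)).
Qed.

Lemma Iord_deriv k j f : Iord k.+1 f -> Iord k (delta j f).
Proof. by case=> _; apply. Qed.

(** Leibniz rule: of the fewer than [k + l] derivatives of a product, either
    fewer than [k] fall on [f] or fewer than [l] on [g]. *)
Lemma Iord_mul k l f g : Iord k f -> Iord l g -> Iord (k + l) (f * g).
Proof.
have [_ ID IM] := II.
move: {2}(k + l)%N (erefl (k + l)%N) => n; elim: n k l f g => [|n IH] k l f g kln.
  by move: kln => /eqP; rewrite addn_eq0 => /andP[/eqP -> /eqP ->].
rewrite kln => fk gl /=; split.
  case: k kln fk => [|k] kln; last by move=> [If _]; rewrite mulrC; apply: IM.
  by move: gl; rewrite -[l]add0n kln => -[Ig _] _; apply: IM.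
move=> j; rewrite deltaM; apply: IordD.
  case: k kln fk => [|k] kln fk.
    rewrite -[n]add0n; apply: IH => //; apply: IordS.
    by rewrite -[l]add0n kln in gl.
  move: kln; rewrite addSn => -[kln]; rewrite -kln; apply: IH => //.
  exact: Iord_deriv.
case: l kln gl => [|l] kln gl.
  rewrite -[n]addn0; apply: IH => //; first exact: addn0.
  by apply: IordS; rewrite addn0 in kln; rewrite -kln.
move: kln; rewrite addnS => -[kln]; rewrite -kln; apply: IH => //.
exact: Iord_deriv.
Qed.

Lemma IordMl k f g : Iord k g -> Iord k (f * g).
Proof. by move=> gk; apply: (@Iord_mul 0 k). Qed.

Lemma IordN k f : Iord k f -> Iord k (- f).
Proof. by rewrite -mulN1r; apply: IordMl. Qed.

Lemma IordB k f g : Iord k f -> Iord k g -> Iord k (f - g).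
Proof. by move=> fk gk; apply: IordD => //; apply: IordN. Qed.

Lemma Iord_sum k (T : Type) (s : seq T) (P : pred T) (F : T -> A) :
  (forall i, P i -> Iord k (F i)) -> Iord k (\sum_(i <- s | P i) F i).
Proof.
by move=> Fk; elim/big_rec: _ => [|i x Pi]; [exact: Iord0|apply: IordD; apply: Fk].
Qed.

Lemma Iord_ideal k : is_ideal (Iord k).
Proof. by split=> [|f g|f g]; [exact: Iord0|exact: IordD|exact: IordMl]. Qed.

End IdealOrder.

(** * Holomorphic substitutions in real coordinates *)

Section Sharp.
Context {R : realType}.
Local Notation C := R[i].

Definition cj m : fps m C -> fps m C := fps_map conjc.
Definition rc m : fps m R -> fps m C := fps_map (real_complex R).
Definition reS m (f : fps m C) : fps m R := fps_map (@complex.Re R) f.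
Definition imS m (f : fps m C) : fps m R := fps_map (@complex.Im R) f.

Lemma cjK m (f : fps m C) : cj (cj f) = f.
Proof. by apply: fps_ext => a /=; rewrite conjcK. Qed.

Lemma cjD m (f g : fps m C) : cj (f + g) = cj f + cj g.
Proof. exact: raddfD. Qed.
Lemma cjB m (f g : fps m C) : cj (f - g) = cj f - cj g.
Proof. exact: raddfB. Qed.
Lemma cjM m (f g : fps m C) : cj (f * g) = cj f * cj g.
Proof. exact: rmorphM. Qed.
Lemma cjZ m (c : C) (f : fps m C) : cj (c *: f) = conjc c *: cj f.
Proof. exact: fps_mapZ. Qed.
Lemma cj_deriv m i (f : fps m C) : cj (fps_deriv i f) = fps_deriv i (cj f).
Proof. exact: fps_map_deriv. Qed.
Lemma cj_comp m p (G : 'I_m -> fps p C) f :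
  cj (fps_comp G f) = fps_comp (fun i => cj (G i)) (cj f).
Proof. exact: fps_map_comp. Qed.
Lemma cj_sum m (I : Type) (s : seq I) (P : pred I) (F : I -> fps m C) :
  cj (\sum_(i <- s | P i) F i) = \sum_(i <- s | P i) cj (F i).
Proof. exact: raddf_sum. Qed.

Lemma cj_rc m (f : fps m R) : cj (rc f) = rc f.
Proof. by apply: fps_ext => a /=; rewrite oppr0. Qed.

Lemma rc_reS m (f : fps m C) : rc (reS f) = (2^-1 : C) *: (f + cj f).
Proof.
apply: fps_ext => a /=; case: (fps_coef f a) => x y /=.
have -> : (x +i* y)%C + (x +i* - y)%C = (2 : C) * x%:C.
  by apply/eqP; rewrite eq_complex /=; apply/andP; split; apply/eqP; ring.
by rewrite mulrA mulVf ?mul1r // pnatr_eq0.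
Qed.

Lemma rc_imS m (f : fps m C) : rc (imS f) = (- 'i / 2 : C) *: (f - cj f).
Proof.
apply: fps_ext => a /=; case: (fps_coef f a) => x y /=.
have -> : (x +i* y)%C - (x +i* - y)%C = (2 : C) * ('i * y%:C).
  by apply/eqP; rewrite eq_complex /=; apply/andP; split; apply/eqP; ring.
rewrite mulrA -[_ / 2 * 2]mulrA mulVf ?mulr1 ?pnatr_eq0 // mulrA mulNr.
by rewrite -expr2 sqr_i opprK mul1r.
Qed.

Lemma reS_imS m (f : fps m C) : f = rc (reS f) + 'i *: rc (imS f).
Proof.
apply: fps_ext => a /=; case: (fps_coef f a) => x y /=.
by apply/eqP; rewrite eq_complex /=; apply/andP; split; apply/eqP; ring.
Qed.

Lemma half_double m (f : fps m C) : (2^-1 : C) *: (f + f) = f.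
Proof.
apply: fps_ext => a; rewrite fps_coefZ fps_coefD -mulr2n mulrnAr -mulrnAl -mulr_natr.
by rewrite mulVf ?mul1r // pnatr_eq0.
Qed.

Lemma conjc_i : conjc ('i : C) = - 'i.
Proof. by apply/eqP; rewrite eq_complex /= oppr0 !eqxx. Qed.

Lemma rc_inj m : injective (@rc m).
Proof.
move=> f g fg; apply: fps_ext => a.
by have := congr1 (fun h => complex.Re (fps_coef h a)) fg.
Qed.

Lemma reS_rc m (f : fps m R) : reS (rc f) = f.
Proof. exact: fps_ext. Qed.

Lemma imS_rc m (f : fps m R) : imS (rc f) = 0.
Proof. exact: fps_ext. Qed.

Lemma reim_mul m (G H : fps m C) : reS (G * H) = reS G * reS H - imS G * imS H /\
  imS (G * H) = reS G * imS H + imS G * reS H.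
Proof.
have E : G * H = rc (reS G * reS H - imS G * imS H) + 'i *: rc (reS G * imS H + imS G * reS H).
  rewrite {1}(reS_imS G) {1}(reS_imS H) /rc raddfB raddfD /= !rmorphM /= -!/(rc _).
  rewrite mulrDl !mulrDr -!scalerAl -!fps_scaleAr scalerA -expr2 sqr_i scaleN1r.
  by rewrite scalerDr; ring.
by rewrite E; split; apply: fps_ext => a /=; ring.
Qed.

Lemma complexifyP n (I : set (fps (n + n) R)) (f : fps (n + n) C) :
  complexify I f <-> I (reS f) /\ I (imS f).
Proof.
split=> [[u Iu [v Iv <-]]|[Ir Ii]].
  have -> : reS (fps_map (real_complex R) u + 'i *: fps_map (real_complex R) v) = u.
    by apply: fps_ext => a /=; ring.
  have -> // : imS (fps_map (real_complex R) u + 'i *: fps_map (real_complex R) v) = v.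
  by apply: fps_ext => a /=; ring.
by exists (reS f) => //; exists (imS f) => //; rewrite -!/(rc _) -reS_imS.
Qed.

Lemma complexify_ideal n (I : set (fps (n + n) R)) :
  is_ideal I -> is_ideal (complexify I).
Proof.
move=> II; have [I0 ID IM] := II.
have IB f g : I f -> I g -> I (f - g).
  by move=> If Ig; apply: ID => //; rewrite -mulN1r; apply: IM.
split=> [|f g /complexifyP[fr fi] /complexifyP[gr gi]|f g /complexifyP[gr gi]];
  apply/complexifyP.
- have -> : reS (0 : fps (n + n) C) = 0 by apply: fps_ext.
  by have -> : imS (0 : fps (n + n) C) = 0 by apply: fps_ext.
- have -> : reS (f + g) = reS f + reS g by apply: fps_ext => a /=; rewrite raddfD.
  have -> : imS (f + g) = imS f + imS g by apply: fps_ext => a /=; rewrite raddfD.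
  by split; apply: ID.
have [-> ->] := reim_mul f g.
by split; [apply: IB|apply: ID]; apply: IM.
Qed.

Lemma complexify_cj n (I : set (fps (n + n) R)) f :
  is_ideal I -> complexify I f -> complexify I (cj f).
Proof.
move=> [_ _ IM] /complexifyP[fr fi]; apply/complexifyP.
have -> : reS (cj f) = reS f by apply: fps_ext => a /=; case: (fps_coef f a).
have -> : imS (cj f) = - imS f by apply: fps_ext => a /=; case: (fps_coef f a).
by split=> //; rewrite -mulN1r; apply: IM.
Qed.

Definition zX n (j : 'I_n) : fps (n + n) C := fpsX (lshift n j) + 'i *: fpsX (rshift n j).

Lemma zX_coef0 n (j : 'I_n) : fps_coef (zX j) mi0 = 0.
Proof. by rewrite fps_coefD fps_coefZ !fpsX_coef0 mulr0 addr0. Qed.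

Lemma holo_deriv_l n (f : fps n C) j :
  fps_deriv (lshift n j) (fps_holo f) = fps_holo (fps_deriv j f).
Proof.
apply: fps_ext => ab; rewrite fps_coef_deriv /= -mulr_natr -!mulrA mulrnAl.
rewrite (_ : finfun _ = mi_add [ffun j0 => (ab (lshift n j0) + ab (rshift n j0))%N] (mi1 j)).
  rewrite -mulrnAr; congr (_ * _).
  rewrite (bigD1 j) // [in RHS](bigD1 j) //= !ffunE eq_lshift eqxx eq_rlshift addn0.
  rewrite -[in RHS]mulr_natr mulrAC [RHS]mulrAC; congr (_ * _); last first.
    apply: eq_bigr => l lj; rewrite !ffunE !eq_lshift eq_rlshift.
    by rewrite (negbTE lj) !addn0.
  rewrite -!mulrA -!natrM; congr (_ * _%:R).
  set a := ab _; set b := ab _.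
  rewrite addn1 addSn mulnC; have := mul_bin_down (a + b).+1 b.
  by rewrite /= subSn ?leq_addl // addnK => <-; rewrite mulnC.
by apply/ffunP => l; rewrite !ffunE eq_lshift eq_rlshift addn0 addnAC.
Qed.

Lemma holo_deriv_r n (f : fps n C) j :
  fps_deriv (rshift n j) (fps_holo f) = 'i *: fps_holo (fps_deriv j f).
Proof.
apply: fps_ext => ab; rewrite fps_coefZ fps_coef_deriv /= -mulr_natr -!mulrA mulrnAl.
rewrite (_ : finfun _ = mi_add [ffun j0 => (ab (lshift n j0) + ab (rshift n j0))%N] (mi1 j)).
  rewrite -mulrnAr [RHS]mulrCA; congr (_ * _).
  rewrite (bigD1 j) // [in RHS](bigD1 j) //= !ffunE eq_rshift eqxx eq_lrshift addn0.
  rewrite -[in RHS]mulr_natr mulrAC [in RHS]mulrAC [RHS]mulrA; congr (_ * _); last first.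
    apply: eq_bigr => l lj; rewrite !ffunE !eq_rshift eq_lrshift.
    by rewrite (negbTE lj) !addn0.
  set a := ab _; set b := ab _.
  rewrite addn1 exprS -!mulrA -!natrM; congr (_ * (_ * _%:R)).
  rewrite addnS mulnC; have := mul_bin_diag (b + a).+1 a.
  by rewrite /= => <-; rewrite mulnC.
by apply/ffunP => l; rewrite !ffunE eq_rshift eq_lrshift addn0 addnA.
Qed.

(** Both sides agree at the origin and satisfy the same first-order system
    [d/dx_j F(f) = F(f_j)], [d/dy_j F(f) = i F(f_j)], which determines the
    coefficients by induction on the degree. *)
Lemma holoE n (f : fps n C) : fps_holo f = fps_comp (@zX n) f.
Proof.
apply/eqP; rewrite -subr_eq0; apply/eqP.
pose E f := fps_holo f - fps_comp (@zX n) f; rewrite -/(E f).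
have compl g j : fps_deriv (lshift n j) (fps_comp (@zX n) g) = fps_comp (@zX n) (fps_deriv j g).
  rewrite fps_deriv_comp (bigD1 j) //= big1 ?addr0 => [|l lj].
    rewrite /zX raddfD /= linearZ /= !fps_derivX eqxx eq_lrshift scaler0 addr0.
    by rewrite mul1r.
  by rewrite /zX raddfD /= linearZ /= !fps_derivX eq_lshift eq_lrshift eq_sym
    (negbTE lj) scaler0 addr0 mul0r.
have compr g j : fps_deriv (rshift n j) (fps_comp (@zX n) g) =
    'i *: fps_comp (@zX n) (fps_deriv j g).
  rewrite fps_deriv_comp (bigD1 j) //= big1 ?addr0 => [|l lj].
    rewrite /zX raddfD /= linearZ /= !fps_derivX eqxx eq_rlshift add0r.
    by rewrite -scalerAl mul1r.
  by rewrite /zX raddfD /= linearZ /= !fps_derivX eq_rshift eq_rlshift eq_sym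
    (negbTE lj) scaler0 addr0 mul0r.
apply: fps_ext => a; elim/(@mi_ind (n + n)): a f => [|a i IH] f.
  rewrite fps_coefD -[fps_coef (- _) _]/(- fps_coef _ _) fps_comp_coef0 /=.
  rewrite big1 => [|j _]; last by rewrite !ffunE mulr1.
  rewrite mulr1 (_ : finfun _ = mi0) ?subrr //.
  by apply/ffunP => j; rewrite !ffunE.
suff : fps_coef (fps_deriv i (E f)) a = 0.
  by rewrite fps_coef_deriv => /eqP; rewrite mulrn_eq0 => /eqP.
case: (split_ordP i) => j ->; rewrite /E fps_derivB.
  by rewrite holo_deriv_l compl -/(E _) IH.
by rewrite holo_deriv_r compr -scalerBr -/(E _) fps_coefZ IH mulr0.
Qed.

Lemma holo_coef0 n (f : fps n C) : fps_coef (fps_holo f) mi0 = fps_coef f mi0.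
Proof. by rewrite holoE fps_comp_coef0. Qed.

Lemma holoX n (j : 'I_n) : fps_holo (fpsX j) = zX j.
Proof. by rewrite holoE fps_compX ?zX_coef0. Qed.

(** The real coordinates [x, y] of the source, pulled back by [G]: real and
    imaginary parts of [G (x + i y)], with complex coefficients so that [z]
    and [zbar] remain expressible. *)
Definition sharp_coord a b (G : 'I_a -> fps b C) (i : 'I_(a + a)) : fps (b + b) C :=
  match fintype.split i with
  | inl j => rc (reS (fps_holo (G j)))
  | inr j => rc (imS (fps_holo (G j)))
  end.

(** The action on functions of [x, y] of the holomorphic substitution [G]; on
    series in [z] alone it is substitution of [G] ([sharp_holo]), and it
    commutes with conjugation ([sharp_cj]). *)
Definition sharp a b (G : 'I_a -> fps b C) : fps (a + a) C -> fps (b + b) C :=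
  fps_comp (sharp_coord G).

Section SharpTheory.
Context {a b : nat} (G : 'I_a -> fps b C) (G0 : forall j, fps_coef (G j) mi0 = 0).

Lemma sharp_coord0 i : fps_coef (sharp_coord G i) mi0 = 0.
Proof.
rewrite /sharp_coord; case: fintype.split => j.
  by rewrite -[LHS]/((complex.Re (fps_coef (fps_holo (G j)) mi0))%:C) holo_coef0 G0.
by rewrite -[LHS]/((complex.Im (fps_coef (fps_holo (G j)) mi0))%:C) holo_coef0 G0.
Qed.

Lemma sharp_coord_cj i : cj (sharp_coord G i) = sharp_coord G i.
Proof. by rewrite /sharp_coord; case: fintype.split => j; rewrite cj_rc. Qed.

Lemma sharpX i : sharp G (fpsX i) = sharp_coord G i.
Proof. by rewrite /sharp fps_compX // sharp_coord0. Qed.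

Lemma sharp_zX j : sharp G (zX j) = fps_holo (G j).
Proof.
rewrite /zX /sharp fps_compD fps_compZ -!/(sharp G _) !sharpX /sharp_coord.
by rewrite (unsplitK (inl j)) (unsplitK (inr j)) -reS_imS.
Qed.

Lemma sharp_holo f : sharp G (fps_holo f) = fps_holo (fps_comp G f).
Proof.
rewrite [in LHS]holoE /sharp fps_comp_comp [RHS]holoE fps_comp_comp.
by apply: eq_fps_comp => j; rewrite -/(sharp G _) sharp_zX holoE.
Qed.

Lemma sharp_cj f : sharp G (cj f) = cj (sharp G f).
Proof.
rewrite /sharp cj_comp; apply: eq_fps_comp => i.
by rewrite sharp_coord_cj.
Qed.

End SharpTheory.

Lemma sharp_sharp a b c (H : 'I_b -> fps c C) (G : 'I_a -> fps b C) f :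
    (forall j, fps_coef (H j) mi0 = 0) ->
  sharp H (sharp G f) = sharp (fun j => fps_comp H (G j)) f.
Proof.
move=> H0; rewrite {2}/sharp [sharp H _]fps_comp_comp; apply: eq_fps_comp => i.
rewrite -/(sharp H _) /sharp_coord; case: fintype.split => j.
  by rewrite !rc_reS /sharp fps_compZ fps_compD -!/(sharp H _) sharp_cj sharp_holo.
by rewrite !rc_imS /sharp fps_compZ fps_compB -!/(sharp H _) sharp_cj sharp_holo.
Qed.

Lemma sharp_id a (G : 'I_a -> fps a C) f : (forall j, G j = fpsX j) -> sharp G f = f.
Proof.
move=> GX; rewrite -[RHS]fps_comp_id; apply: eq_fps_comp => i.
rewrite /sharp_coord; case: (split_ordP i) => j ->; rewrite GX holoX.
  rewrite rc_reS /zX cjD cjZ /cj !fps_mapX conjc_i.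
  by rewrite scaleNr addrACA subrr addr0 half_double.
rewrite rc_imS /zX cjD cjZ /cj !fps_mapX conjc_i.
rewrite scaleNr opprD opprK addrACA subrr add0r [- 'i / 2]mulrC -scalerA.
rewrite scalerDr !scalerA mulNr -expr2 sqr_i opprK !scale1r.
exact: half_double.
Qed.

End Sharp.

(** * Calculus of several variables *)

Section LineDerivative.
Context {R : realType} {V : normedModType R}.
Implicit Types (f : V -> R) (x v : V).

Lemma line_quotient (W : normedModType R) (f : V -> W) x v (t : R) :
  (fun h : R => h^-1 *: (((fun s : R => f (x + s *: v)) \o shift t) (h *: 1) - f (x + t *: v))) =
  (fun h : R => h^-1 *: ((f \o shift (x + t *: v)) (h *: v) - f (x + t *: v))).
Proof.
apply/funext => h /=; congr (_ *: (f _ - _)).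
by rewrite [h *: 1]mulr1 scalerDl addrCA.
Qed.

Lemma line_derivable (W : normedModType R) (f : V -> W) x v (t : R) :
  derivable f (x + t *: v) v -> derivable (fun s : R => f (x + s *: v)) t 1.
Proof. by rewrite /derivable line_quotient. Qed.

Lemma line_derive (W : normedModType R) (f : V -> W) x v (t : R) :
  'D_1 (fun s : R => f (x + s *: v)) t = 'D_v f (x + t *: v).
Proof. by rewrite /derive line_quotient. Qed.

Lemma mvt_line f x v (a : R) :
    (forall t : R, `|t| <= `|a| -> derivable f (x + t *: v) v) ->
  exists2 t : R, `|t| <= `|a| & f (x + a *: v) - f x = a * 'D_v f (x + t *: v).
Proof.
move=> df; pose g (s : R) := f (x + s *: v).
have dg (t : R) : `|t| <= `|a| -> is_derive t 1 g ('D_v f (x + t *: v)).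
  by move=> ta; rewrite -line_derive; apply: derivableP; apply/line_derivable/df.
have cg (c d : R) : `|c| <= `|a| -> `|d| <= `|a| -> {within `[c, d], continuous g}.
  move=> ca da; apply: derivable_within_continuous => t.
  rewrite in_itv /= => /andP[ct td].
  have ta : `|t| <= `|a|.
    by move: ca da; rewrite !ler_norml => /andP[? ?] /andP[? ?]; apply/andP; split; lra.
  by case: (dg t ta).
have g0 : g 0 = f x by rewrite /g scale0r addr0.
have [a0|a0] := leP 0 a.
  have [||c] := @MVT_segment R g (fun t => 'D_v f (x + t *: v)) 0 a a0.
  - move=> t; rewrite in_itv /= => /andP[t0 ta]; apply: dg.
    by rewrite (gtr0_norm t0) (ger0_norm a0) ltW.
  - by apply: cg; rewrite ?normr0.
  rewrite in_itv /= => /andP[c0 ca] gE; exists c; first by rewrite !ger0_norm.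
  by rewrite -/(g a) -g0 gE subr0 mulrC.
have [||c] := @MVT_segment R g (fun t => 'D_v f (x + t *: v)) a 0 (ltW a0).
- move=> t; rewrite in_itv /= => /andP[ta t0]; apply: dg.
  by rewrite (ltr0_norm t0) (ltr0_norm a0) lerN2 ltW.
- by apply: cg; rewrite ?normr0.
rewrite in_itv /= => /andP[ca c0] gE; exists c.
  by rewrite (ler0_norm c0) (ltr0_norm a0) lerN2.
by rewrite -/(g a) -g0 -opprB gE; ring.
Qed.

End LineDerivative.

Section PartialDerivatives.
Context {R : realType} {m : nat}.
Implicit Types (f g : 'rV[R]_m -> R) (x h : 'rV[R]_m).
Local Notation e i := (delta_mx (0 : 'I_1) i : 'rV[R]_m).

Lemma norm_coord h i : `|h 0 i| <= `|h|.
Proof. by rewrite [leRHS]/Num.Def.normr /= mx_normrE; apply: (le_bigmax _ _ (0, i)). Qed.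

Lemma norm_rV_le h (c : R) : 0 <= c -> (forall i, `|h 0 i| <= c) -> `|h| <= c.
Proof.
move=> c0 hc; rewrite [leLHS]/Num.Def.normr /= mx_normrE.
by apply: bigmax_le => // -[j i] _; rewrite ord1.
Qed.

Definition headv (k : nat) h : 'rV[R]_m := \row_i (if (i < k)%N then h 0 i else 0).

Lemma headv0 h : headv 0 h = 0.
Proof. by apply/rowP => i; rewrite !mxE. Qed.

Lemma headv_all h : headv m h = h.
Proof. by apply/rowP => i; rewrite !mxE ltn_ord. Qed.

Lemma headvS h (i : 'I_m) : headv i.+1 h = headv i h + h 0 i *: e i.
Proof.
apply/rowP => j; rewrite !mxE ltnS leq_eqVlt eqxx /=.
have [ji|ji] := eqVneq j i; first by rewrite ji ltnn eqxx /= mulr1 add0r.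
by rewrite mulr0 addr0 -val_eqE in ji *; rewrite (negbTE ji).
Qed.

Lemma norm_headv h (i : 'I_m) (t : R) : `|t| <= `|h| -> `|headv i h + t *: e i| <= `|h|.
Proof.
move=> th; apply: norm_rV_le => // j; rewrite !mxE eqxx /=.
have [ji|ji] := eqVneq j i; first by rewrite ji ltnn mulr1 add0r.
by rewrite mulr0 addr0; case: ifP => _; rewrite ?norm_coord // normr0.
Qed.

(** Mean value theorem along one coordinate direction at a time. *)
Lemma increment_le f (x h : 'rV[R]_m) (c : 'I_m -> R) (eps : R) :
    (forall y, `|y| <= `|h| -> forall i, derivable f (x + y) (e i) /\
       `|partial i f (x + y) - c i| <= eps) ->
  `|f (x + h) - f x - \sum_i h 0 i * c i| <= m%:R * eps * `|h|.
Proof.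
move=> fh.
have step (i : 'I_m) : `|f (x + headv i.+1 h) - f (x + headv i h) - h 0 i * c i|
    <= eps * `|h|.
  have [t ht|t ti] := @mvt_line R _ f (x + headv i h) (e i) (h 0 i).
    rewrite -addrA; have [] := fh (headv i h + t *: e i) _ i => //.
    by apply: norm_headv => //; apply: le_trans ht (norm_coord _ _).
  rewrite -[_ + _ + h 0 i *: _]addrA -headvS => ->; rewrite -mulrBr normrM mulrC.
  apply: ler_pM => //; last exact: norm_coord.
  rewrite -addrA; have [|_] := fh (headv i h + t *: e i) _ i => //.
  by apply: norm_headv => //; apply: le_trans ti (norm_coord _ _).
have tel : f (x + h) - f x = \sum_(i < m) (f (x + headv i.+1 h) - f (x + headv i h)).
  rewrite -(big_mkord xpredT (fun i => f (x + headv i.+1 h) - f (x + headv i h))).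
  by rewrite telescope_sumr // headv_all headv0 addr0.
rewrite tel -sumrB; apply: le_trans (ler_norm_sum _ _ _) _.
apply: le_trans (ler_sum _ (fun i _ => step i)) _.
by rewrite sumr_const card_ord -[_ *+ m]mulr_natl mulrA.
Qed.

Definition C1_at f x := forall i,
  (\forall y \near x, derivable f y (e i)) /\ {for x, continuous (partial i f)}.

Definition grad_lin f x : 'rV[R]_m -> R := fun h => \sum_i h 0 i * partial i f x.

Lemma grad_lin_is_linear f x : linear (grad_lin f x).
Proof.
move=> a u v; rewrite /grad_lin scaler_sumr -big_split /=; apply: eq_bigr => i _.
by rewrite !mxE mulrDl -mulrA.
Qed.

HB.instance Definition _ f x :=
  GRing.isLinear.Build R 'rV[R]_m R _ (grad_lin f x) (grad_lin_is_linear f x).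

Lemma grad_lin_continuous f x : continuous (grad_lin f x).
Proof.
have cadd : continuous (fun z : R * R => z.1 + z.2) by exact: add_continuous.
apply: (@continuous_big R 'I_m +%R 0 xpredT cadd 'rV[R]_m (index_enum _)
  (fun i (h : 'rV[R]_m) => h 0 i * partial i f x)) => i _ y.
apply: (@cvgM R _ (nbhs y) _ (fun h : 'rV[R]_m => h 0 i) (fun=> partial i f x)).
- exact: coord_continuous.
- exact: cvg_cst.
Qed.

(** Continuity of the partial derivatives makes [increment_le] applicable with
    [c] the gradient at [x] and an arbitrarily small [eps]. *)
Lemma C1_differentiable f x : C1_at f x ->
  differentiable f x /\ 'd f x = grad_lin f x :> (_ -> _).
Proof.
move=> fC.
have dE := @diff_unique R _ _ f (grad_lin f x) x (@grad_lin_continuous f x).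
lazymatch type of dE with ?P -> _ => assert (fo : P) end.
  apply/eqaddoP => _/posnumP[eps].
  pose d := eps%:num / m.+1%:R.
  have d0 : 0 < d by rewrite divr_gt0 ?ltr0n.
  have near_x : \forall y \near x, forall i, derivable f y (e i) /\
      `|partial i f y - partial i f x| <= d.
    apply: (@filter_forall _ 'I_m (fun i y => derivable f y (e i) /\
      `|partial i f y - partial i f x| <= d) (nbhs x)) => i; have [dfi /cvgrPdist_le/(_ _ d0) ci] := fC i.
    by near=> y; split; [near: y|rewrite distrC; near: y].
  have /nbhs_ballP[r /= r0 rP] := near_x.
  have n0 : \forall h \near (0 : 'rV[R]_m), `|h| < r.
    by apply/nbhs_ballP; exists r => // h; rewrite -ball_normE /= sub0r normrN.
  apply: filterS n0 => h hr; rewrite -[_ h]/(f (h + x) - (f x + grad_lin f x h)).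
  rewrite [h + x]addrC opprD addrA.
  apply: le_trans (@increment_le f x h (fun i => partial i f x) d _) _.
    move=> y yh i; apply: rP; rewrite -ball_normE /= opprD addNKr normrN.
    exact: le_lt_trans yh hr.
  apply: ler_wpM2r => //; rewrite /d mulrCA ler_piMr // ler_pdivrMr ?ltr0n //.
  by rewrite mul1r ler_nat.
have {}dE := dE fo.
split=> //; apply/diff_locallyP; rewrite dE; split=> //.
exact: grad_lin_continuous.
Unshelve. all: by end_near. Qed.

Lemma shift_derive f (w x v : 'rV[R]_m) :
  'D_v (fun y => f (y + w)) x = 'D_v f (x + w).
Proof.
rewrite /derive; set g := (X in lim (X @ _)); set g' := (X in _ = lim (X @ _)).
by have -> : g = g' by apply/funext => h; rewrite /g /g' /= addrA.
Qed.

Lemma shift_derivable f (w x v : 'rV[R]_m) :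
  derivable f (x + w) v -> derivable (fun y => f (y + w)) x v.
Proof.
rewrite /derivable; set g := (X in cvg (X @ _) -> _); set g' := (X in _ -> cvg (X @ _)).
by have -> : g = g' by apply/funext => h; rewrite /g /g' /= addrA.
Qed.

Definition sdiff f x i j (s : R) : R :=
  f (x + s *: e i + s *: e j) - f (x + s *: e i) - f (x + s *: e j) + f x.

Lemma sdiffC f x i j s : sdiff f x i j s = sdiff f x j i s.
Proof. rewrite /sdiff; have -> : x + s *: e i + s *: e j = x + s *: e j + s *: e i by rewrite addrAC.
by congr (_ + _); apply: addrAC. Qed.

Lemma second_difference f x i j (s : R) :
    (forall a b : R, `|a| <= `|s| -> `|b| <= `|s| ->
       let y := x + a *: e i + b *: e j in
       derivable f y (e i) /\ derivable (partial i f) y (e j)) ->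
  exists a b, [/\ `|a| <= `|s|, `|b| <= `|s| &
    sdiff f x i j s = s * s * partial j (partial i f) (x + a *: e i + b *: e j)].
Proof.
move=> df; pose g y := f (y + s *: e j) - f y.
have dg (t : R) : `|t| <= `|s| -> is_derive (x + t *: e i) (e i) g
   (partial i f (x + t *: e i + s *: e j) - partial i f (x + t *: e i)).
  move=> ts; have [d1 _] := df t s ts (lexx _).
  have [|d0 _] := df t 0 ts; first by rewrite normr0.
  rewrite scale0r addr0 in d0.
  apply: is_deriveB; last exact: derivableP.
  rewrite /partial -shift_derive; apply: derivableP.
  exact: shift_derivable.
have [t ts|a as_] := @mvt_line R _ g x (e i) s; first by have [] := dg t ts.
have [_ ->] := dg a as_.
have [t ts|b bs ->] := @mvt_line R _ (partial i f) (x + a *: e i) (e j) s.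
  by have [] := df a t as_ ts.
by move=> gE; exists a, b; split=> //; rewrite -mulrA -gE /g /sdiff; ring.
Qed.

Lemma close3 (u v w w' eps : R) :
  w = w' -> `|u - w| <= eps / 2 -> `|v - w'| <= eps / 2 -> `|u - v| <= eps.
Proof.
move=> -> uw vw; have -> : u - v = (u - w') - (v - w') by ring.
apply: le_trans (ler_normB _ _) _; rewrite (splitr eps).
exact: lerD.
Qed.

(** Both are limits of the symmetric second difference [sdiff], by two
    applications of the mean value theorem in either order. *)
Lemma schwarz f x i j :
    (\forall y \near x, [/\ derivable f y (e i), derivable f y (e j),
       derivable (partial i f) y (e j) & derivable (partial j f) y (e i)]) ->
    {for x, continuous (partial j (partial i f))} ->
    {for x, continuous (partial i (partial j f))} ->
  partial j (partial i f) x = partial i (partial j f) x.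
Proof.
move=> df cji cij; apply/eqP; rewrite -subr_eq0 -normr_le0.
apply/ler_addgt0Pr => eps eps0; rewrite add0r.
have eps20 : 0 < eps / 2 by rewrite divr_gt0.
have : \forall y \near x, [/\ derivable f y (e i), derivable f y (e j),
    derivable (partial i f) y (e j) & derivable (partial j f) y (e i)] /\
    (`|partial j (partial i f) x - partial j (partial i f) y| <= eps / 2 /\
     `|partial i (partial j f) x - partial i (partial j f) y| <= eps / 2).
  have /cvgrPdist_le/(_ _ eps20) n1 := cji.
  have /cvgrPdist_le/(_ _ eps20) n2 := cij.
  by apply: filterS3 df n1 n2 => y H1 H2 H3; exact: (conj H1 (conj H2 H3)).
move=> /nbhs_ballP[r /= r0 rP].
pose s := r / 3; have s0 : 0 < s by rewrite divr_gt0.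
have norm_e k (a : R) : `|a *: e k| <= `|a|.
  apply: norm_rV_le => // l; rewrite !mxE normrM ler_piMr // eqxx /=.
  by case: eqP; rewrite ?normr1 ?normr0.
have inball k l (a b : R) : `|a| <= `|s| -> `|b| <= `|s| ->
    ball x r (x + a *: e k + b *: e l).
  move=> a_s b_s; rewrite -ball_normE /= -addrA opprD addNKr normrN.
  apply: le_lt_trans (ler_normD _ _) _.
  apply: le_lt_trans (_ : s + s < r); last by rewrite /s; lra.
  by apply: lerD; apply: le_trans (norm_e _ _) _; rewrite -(gtr0_norm s0).
have [a b as_ bs|a [b [as_ bs E1]]] := @second_difference f x i j s.
  have [[d1 _ d3 _] _] := rP _ (inball i j _ _ as_ bs); exact: (conj d1 d3).
have [a' b' as_' bs'|a' [b' [as_' bs' E2]]] := @second_difference f x j i s.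
  have [[_ d2 _ d4] _] := rP _ (inball j i _ _ as_' bs'); exact: (conj d2 d4).
have [_ [H1 _]] := rP _ (inball i j _ _ as_ bs).
have [_ [_ H2]] := rP _ (inball j i _ _ as_' bs').
have ss : s * s != 0 by rewrite mulf_neq0 ?gt_eqF.
exact: (close3 (mulfI ss (etrans (esym E1) (etrans (sdiffC f x i j s) E2))) H1 H2).
Qed.

End PartialDerivatives.

(** * The algebra of smooth functions *)

Section ChainRule.
Context {R : realType}.

(** Restricted to the line through [x] in direction [v] this is the chain rule
    for [f] and a curve. *)
Lemma chain_rule m k (f : 'rV[R]_k -> R) (G : 'rV[R]_m -> 'rV[R]_k) (x v : 'rV[R]_m) :
    C1_at f (G x) -> (forall j, derivable (fun y => G y 0 j) x v) ->
  derivable (f \o G) x v /\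
  'D_v (f \o G) x = \sum_j 'D_v (fun y => G y 0 j) x * partial j f (G x).
Proof.
move=> fC dG; have [df dfE] := C1_differentiable fC.
pose h (t : R) := G (x + t *: v).
have x0 : x = x + 0 *: v by rewrite scale0r addr0.
have dGx : derivable G x v by apply/derivable_mxP => i j; rewrite ord1.
have dh : derivable h 0 1 by apply: line_derivable; rewrite -x0.
have h0 : h 0 = G x by rewrite /h -x0.
have dfh : differentiable f (h 0) by rewrite h0.
have dfoh : differentiable (f \o h) (0 : R).
  by apply: differentiable_comp => //; apply/derivable1_diffP.
have dfGx : derivable (f \o G) x v.
  have /derivable1_diffP := dfoh; rewrite /derivable {3}x0.
  by rewrite (line_quotient (f \o G)) -x0.
split=> //; rewrite {1}x0 -(line_derive (f \o G)) -[fun s : R => _]/(f \o h).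
rewrite deriveE // diff_comp //; last exact/derivable1_diffP.
rewrite /= h0 dfE -deriveE; last exact/derivable1_diffP.
have -> : 'D_1 h 0 = 'D_v G x by rewrite (line_derive G) -x0.
rewrite /grad_lin (derive_mx dGx); apply: eq_bigr => j _.
by rewrite mxE.
Qed.

Lemma cvg_row m k (F : set_system 'rV[R]_m) (FF : Filter F)
    (G : 'rV[R]_m -> 'rV[R]_k) (l : 'rV[R]_k) :
  (forall j, G y 0 j @[y --> F] --> l 0 j) -> G y @[y --> F] --> l.
Proof.
move=> Gl; apply/cvgrPdist_le => eps eps0.
have : \forall y \near F, forall j, `|l 0 j - G y 0 j| <= eps.
  apply: (@filter_forall _ 'I_k (fun j y => `|l 0 j - G y 0 j| <= eps) F) => j.
  by have /cvgrPdist_le/(_ _ eps0) := Gl j.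
apply: filterS => y H; apply: norm_rV_le; first exact: ltW.
by move=> j; rewrite !mxE; apply: H.
Qed.

End ChainRule.

Section SmoothOn.
Context {R : realType}.

Definition smooth_at m (x : 'rV[R]_m) (f : 'rV[R]_m -> R) : Prop :=
  forall s : seq 'I_m, {for x, continuous (partials s f)} /\
    forall i, derivable (partials s f) x (delta_mx 0 i).

Definition smooth_on m (U : set 'rV[R]_m) (f : 'rV[R]_m -> R) : Prop :=
  forall x, U x -> smooth_at x f.

Lemma open_near m (U : set 'rV[R]_m) (P : 'rV[R]_m -> Prop) x :
  open U -> U x -> (forall y, U y -> P y) -> \forall y \near x, P y.
Proof. by move=> Uo Ux UP; apply: filterS (open_nbhs_nbhs (conj Uo Ux)). Qed.

Lemma eq_on_partial m (U : set 'rV[R]_m) (f g : 'rV[R]_m -> R) i :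
  open U -> (forall x, U x -> f x = g x) ->
  forall x, U x -> partial i f x = partial i g x.
Proof.
move=> Uo fg x Ux; apply: near_eq_derive.
exact: open_near Uo Ux fg.
Qed.

Lemma eq_on_partials m (U : set 'rV[R]_m) (f g : 'rV[R]_m -> R) s :
  open U -> (forall x, U x -> f x = g x) ->
  forall x, U x -> partials s f x = partials s g x.
Proof.
by move=> Uo fg; elim: s => //= i s IH x Ux; apply: eq_on_partial IH x Ux.
Qed.

Lemma smooth_on_partial m (U : set 'rV[R]_m) (f : 'rV[R]_m -> R) i :
  smooth_on U f -> smooth_on U (partial i f).
Proof.
move=> fU x Ux s; have := fU x Ux (rcons s i).
by rewrite /partials foldr_rcons.
Qed.

Lemma smooth_on_partials m (U : set 'rV[R]_m) (f : 'rV[R]_m -> R) s :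
  smooth_on U f -> smooth_on U (partials s f).
Proof.
by move=> fU; elim: s => [|i s IH]; [exact: fU|exact: smooth_on_partial IH].
Qed.

Lemma smooth_on_C1 m (U : set 'rV[R]_m) (f : 'rV[R]_m -> R) x :
  open U -> smooth_on U f -> U x -> C1_at f x.
Proof.
move=> Uo fU Ux i; split; last by have [] := fU x Ux [:: i].
by apply: open_near Uo Ux _ => y Uy; have [_] := fU y Uy [::]; apply.
Qed.

(** An inductive class of functions that is closed under sums, products and
    composition by construction and under partial derivatives by the Leibniz
    and chain rules ([salg_partial]). Its members being continuous, it
    consists of smooth functions ([salg_smooth_on]); this replaces an analysis
    of the higher derivatives of a composite. *)
Inductive salg m (U : set 'rV[R]_m) : ('rV[R]_m -> R) -> Prop :=
| salg_smooth f : smooth_on U f -> salg U f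
| salg_eq f g : (forall x, U x -> f x = g x) -> salg U f -> salg U g
| salg_add f g : salg U f -> salg U g -> salg U (f \+ g)
| salg_mul f g : salg U f -> salg U g -> salg U (f \* g)
| salg_comp k (W : set 'rV[R]_k) (f : 'rV[R]_k -> R) (G : 'rV[R]_m -> 'rV[R]_k) :
    open W -> smooth_on W f -> (forall x, U x -> W (G x)) ->
    (forall j, salg U (fun x => G x 0 j)) -> salg U (f \o G).

Lemma salg_C0 m (U : set 'rV[R]_m) f : open U -> salg U f ->
  forall x, U x -> {for x, continuous f} /\ forall i, derivable f x (delta_mx 0 i).
Proof.
move=> Uo; elim=> {f} [f fU|f g fg _ IH|f g _ IHf _ IHg|f g _ IHf _ IHg
    |k W f G Wo fW UW _ IHG] x Ux.
- exact: (fU x Ux [::]).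
- have [cf df] := IH x Ux; have nfg := open_near Uo Ux fg; split.
    rewrite /prop_for /continuous_at -(fg x Ux).
    apply: cvg_trans cf; exact: (@near_eq_cvg _ _ (nbhs x) _ f g nfg).
  by move=> i; apply: near_eq_derivable nfg (df i).
- have [cf df] := IHf x Ux; have [cg dg] := IHg x Ux; split.
    exact: (@cvgD _ _ _ (nbhs x) _ f g _ _ cf cg).
  by move=> i; apply: derivableD.
- have [cf df] := IHf x Ux; have [cg dg] := IHg x Ux; split.
    exact: (@cvgM _ _ (nbhs x) _ f g _ _ cf cg).
  by move=> i; apply: derivableM.
have fC := smooth_on_C1 Wo fW (UW x Ux); split; last first.
  by move=> i; have [] := chain_rule fC (fun j => (IHG j x Ux).2 i).
apply: continuous_comp; last by have [] := fW _ (UW x Ux) [::].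
by apply: (@cvg_row R m k (nbhs x) _ G (G x)) => j; have [] := IHG j x Ux.
Qed.

Lemma smooth_on_cst m (U : set 'rV[R]_m) (c : R) : smooth_on U (cst c).
Proof.
move=> x _ s.
have [d ->] : exists d, partials s (cst c) = cst d :> ('rV[R]_m -> R).
  elim: s => [|i s [d dE]]; first by exists c.
  by exists 0; rewrite /= dE; apply/funext => y; rewrite /partial derive_cst.
by split=> [|i]; [exact: cst_continuous|exact: derivable_cst].
Qed.

Lemma salg_cst m (U : set 'rV[R]_m) (c : R) : salg U (cst c).
Proof. by apply/salg_smooth/smooth_on_cst. Qed.

Lemma salg_sum m (U : set 'rV[R]_m) (I : Type) (r : seq I) (P : pred I) F :
  (forall i, P i -> salg U (F i)) -> salg U (fun x => \sum_(i <- r | P i) F i x).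
Proof.
move=> FU; elim: r => [|i r IH].
  by apply: salg_eq (salg_cst U 0) => x _; rewrite big_nil.
have [Pi|Pi] := boolP (P i).
  by apply: salg_eq (salg_add (FU i Pi) IH) => x _ /=; rewrite big_cons Pi.
by apply: salg_eq IH => x _; rewrite big_cons (negbTE Pi).
Qed.

Lemma salg_partial m (U : set 'rV[R]_m) f i : open U -> salg U f -> salg U (partial i f).
Proof.
move=> Uo; elim=> {f} [f fU|f g fg fa IH|f g fa IHf ga IHg|f g fa IHf ga IHg
    |k W f G Wo fW UW Ga IHG].
- exact/salg_smooth/smooth_on_partial.
- by apply: salg_eq IH => x Ux; apply: eq_on_partial Ux.
- apply: salg_eq (salg_add IHf IHg) => x Ux /=.
  by rewrite /partial deriveD //; apply: (salg_C0 Uo _ Ux).2.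
- apply: salg_eq (salg_add (salg_mul fa IHg) (salg_mul ga IHf)) => x Ux /=.
  by rewrite /partial deriveM //; apply: (salg_C0 Uo _ Ux).2.
have step j : salg U ((partial j f \o G) \* partial i (fun x => G x 0 j)).
  by apply: salg_mul => //; apply: (salg_comp Wo (smooth_on_partial j fW)).
apply: (@salg_eq _ _ (fun x => \sum_j ((partial j f \o G) \*
    partial i (fun x => G x 0 j)) x)); last by apply: salg_sum => j _; apply: step.
move=> x Ux /=.
have fC := smooth_on_C1 Wo fW (UW x Ux).
have [_ E] := chain_rule fC (fun j => (salg_C0 Uo (Ga j) Ux).2 i).
rewrite [RHS]E.
by apply: eq_bigr => j _; rewrite mulrC.
Qed.

Lemma salg_smooth_on m (U : set 'rV[R]_m) f : open U -> salg U f -> smooth_on U f.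
Proof.
move=> Uo fa x Ux s; apply: (salg_C0 Uo _ Ux).
by elim: s => //= i s IH; apply: salg_partial.
Qed.

End SmoothOn.

Section SmoothNear.
Context {R : realType} {m : nat}.
Implicit Types (f g : 'rV[R]_m -> R) (p x : 'rV[R]_m).

Lemma smooth_near_open p f : smooth_near p f ->
  exists U : set 'rV[R]_m, [/\ open U, U p & smooth_on U f].
Proof.
move=> fp; exists (interior (fun x => smooth_at x f)); split.
- exact: open_interior.
- exact: fp.
- by move=> x /interior_subset.
Qed.

Lemma smooth_on_near (U : set 'rV[R]_m) p f :
  open U -> U p -> smooth_on U f -> smooth_near p f.
Proof. by move=> Uo Up fU; apply: open_near Uo Up fU. Qed.

Lemma smooth_near_open2 p f g : smooth_near p f -> smooth_near p g ->
  exists U : set 'rV[R]_m, [/\ open U, U p, smooth_on U f & smooth_on U g].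
Proof.
move=> /smooth_near_open[U [Uo Up fU]] /smooth_near_open[W [Wo Wp gW]].
exists (U `&` W); split=> //; first exact: openI.
  by move=> x [Ux _]; apply: fU.
by move=> x [_ Wx]; apply: gW.
Qed.

Lemma smooth_near_cst p (c : R) : smooth_near p (cst c).
Proof. by apply: (smooth_on_near openT) => //; apply: smooth_on_cst. Qed.

Lemma smooth_nearD p f g : smooth_near p f -> smooth_near p g ->
  smooth_near p (fun x => f x + g x).
Proof.
move=> fp /(smooth_near_open2 fp)[U [Uo Up fU gU]]; apply: (smooth_on_near Uo Up).
by apply: (salg_smooth_on Uo); apply: (@salg_add _ _ _ f g); apply: salg_smooth.
Qed.

Lemma smooth_nearM p f g : smooth_near p f -> smooth_near p g ->
  smooth_near p (fun x => f x * g x).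
Proof.
move=> fp /(smooth_near_open2 fp)[U [Uo Up fU gU]]; apply: (smooth_on_near Uo Up).
by apply: (salg_smooth_on Uo); apply: (@salg_mul _ _ _ f g); apply: salg_smooth.
Qed.

Lemma smooth_near_eq p f g : (\forall x \near p, f x = g x) ->
  smooth_near p f -> smooth_near p g.
Proof.
move=> fg /smooth_near_open[U [Uo Up fU]].
have UWo := openI Uo (@open_interior _ (fun x => f x = g x)).
apply: (smooth_on_near UWo) => //; apply: (salg_smooth_on UWo).
apply: salg_eq (salg_smooth (f := f) _) => x [Ux]; first by move=> /interior_subset.
by move=> _; apply: fU.
Qed.

Lemma smooth_near_scale p (c : R) f : smooth_near p f -> smooth_near p (fun x => c * f x).
Proof. by apply: smooth_nearM; apply: smooth_near_cst. Qed.

Lemma smooth_nearN p f : smooth_near p f -> smooth_near p (fun x => - f x).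
Proof.
move=> /(smooth_near_scale (-1)); apply: smooth_near_eq.
by near=> x; rewrite mulN1r.
Unshelve. all: by end_near. Qed.

Lemma smooth_nearB p f g : smooth_near p f -> smooth_near p g ->
  smooth_near p (fun x => f x - g x).
Proof. by move=> fp /smooth_nearN; apply: smooth_nearD. Qed.

Lemma smooth_near_sum p (I : Type) (r : seq I) (P : pred I) (F : I -> 'rV[R]_m -> R) :
  (forall i, P i -> smooth_near p (F i)) ->
  smooth_near p (fun x => \sum_(i <- r | P i) F i x).
Proof.
move=> Fp; elim: r => [|i r IH].
  apply: smooth_near_eq (smooth_near_cst p 0).
  by near=> x; rewrite big_nil.
have [Pi|Pi] := boolP (P i).
  apply: smooth_near_eq (smooth_nearD (Fp i Pi) IH).
  by near=> x; rewrite big_cons Pi.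
apply: smooth_near_eq IH.
by near=> x; rewrite big_cons (negbTE Pi).
Unshelve. all: by end_near. Qed.

Lemma smooth_near_partial p i f : smooth_near p f -> smooth_near p (partial i f).
Proof.
move=> /smooth_near_open[U [Uo Up fU]]; apply: (smooth_on_near Uo Up).
exact: smooth_on_partial.
Qed.

Lemma partial_coord i j :
  partial i (fun x : 'rV[R]_m => x 0 j) = cst ((i == j)%:R : R).
Proof.
apply/funext => x; rewrite /partial /derive.
apply: (@lim_near_cst _ _ _ (0 : R)^' _) => //.
near=> h; rewrite /= !mxE addrK /= eq_sym.
have h0 : h != 0 by near: h; apply: nbhs_dnbhs_neq.
by rewrite /GRing.scale /= mulrA mulVf // mul1r.
Unshelve. all: by end_near. Qed.

Lemma smooth_near_coord p j : smooth_near p (fun x : 'rV[R]_m => x 0 j).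
Proof.
apply: (smooth_on_near openT) => // x _ s.
case/lastP: s => [|s i].
  split=> [|i] /=; first exact: coord_continuous.
  exact: diff_derivable (differentiable_coord _ _ _).
rewrite /partials foldr_rcons partial_coord -/(partials s _).
exact: (@smooth_on_cst _ _ setT).
Qed.

Lemma smooth_near_near p f : smooth_near p f -> \forall q \near p, smooth_near q f.
Proof. by move=> fp; apply: near_join. Qed.

Lemma smooth_near_at p f : smooth_near p f -> smooth_at p f.
Proof. exact: nbhs_singleton. Qed.

Lemma smooth_near_continuous p f : smooth_near p f -> {for p, continuous f}.
Proof. by move=> /smooth_near_at/(_ [::])[]. Qed.

Lemma smooth_near_derivable p f i : smooth_near p f -> derivable f p (delta_mx 0 i).
Proof. by move=> /smooth_near_at/(_ [::])[_]; apply. Qed.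

Lemma smooth_near_C1 p f : smooth_near p f -> C1_at f p.
Proof. by move=> /smooth_near_open[U [Uo Up fU]]; apply: smooth_on_C1 Uo fU Up. Qed.

Lemma smooth_near_diff p f : smooth_near p f -> differentiable f p.
Proof. by move=> /smooth_near_C1/C1_differentiable[]. Qed.

Lemma smooth_near_derive p f v : smooth_near p f ->
  'D_v f p = \sum_i v 0 i * partial i f p.
Proof.
by move=> /smooth_near_C1/C1_differentiable[df dE]; rewrite deriveE // dE.
Qed.

Lemma smooth_partialC p f i j : smooth_near p f ->
  partial i (partial j f) p = partial j (partial i f) p.
Proof.
move=> fp; have := fp => /smooth_near_at fp0; apply: schwarz.
- apply: filterS fp => y fy; split.
  + by have [_] := fy [::]; apply.
  + by have [_] := fy [::]; apply.
  + by have [_] := fy [:: j]; apply.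
  + by have [_] := fy [:: i]; apply.
- by have [] := fp0 [:: i; j].
- by have [] := fp0 [:: j; i].
Qed.

Lemma partialD p f g i : smooth_near p f -> smooth_near p g ->
  partial i (fun x => f x + g x) p = partial i f p + partial i g p.
Proof. by move=> fp gp; apply: deriveD; apply: smooth_near_derivable. Qed.

Lemma partialM p f g i : smooth_near p f -> smooth_near p g ->
  partial i (fun x => f x * g x) p = partial i f p * g p + f p * partial i g p.
Proof.
move=> fp gp; rewrite /partial [LHS]deriveM; try exact: smooth_near_derivable.
by rewrite addrC /GRing.scale /= [X in X + _]mulrC.
Qed.

End SmoothNear.

Section SmoothComp.
Context {R : realType} {m k : nat}.
Implicit Types (f : 'rV[R]_k -> R) (G : 'rV[R]_m -> 'rV[R]_k) (p : 'rV[R]_m).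

Lemma smooth_map_continuous p G : smooth_map_near p G -> {for p, continuous G}.
Proof. move=> Gp; apply: (@cvg_row R m k (nbhs p) _ G (G p)) => j.
exact: smooth_near_continuous (Gp j). Qed.

Lemma smooth_map_near_near p G : smooth_map_near p G ->
  \forall q \near p, smooth_map_near q G.
Proof.
move=> Gp.
by apply: (@filter_forall _ 'I_k (fun j q => smooth_near q (fun x => G x 0 j)) (nbhs p))
  => j; apply: smooth_near_near (Gp j).
Qed.

Lemma smooth_near_comp p f G : smooth_near (G p) f -> smooth_map_near p G ->
  smooth_near p (f \o G).
Proof.
move=> /smooth_near_open[W [Wo WGp fW]] Gp.
have Gc := smooth_map_continuous Gp.
pose U0 : set 'rV[R]_m := interior (fun x => W (G x)).
pose U1 : set 'rV[R]_m := interior (fun x => forall j, smooth_at x (fun x => G x 0 j)).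
have Uo : open (U0 `&` U1) by apply: openI; apply: open_interior.
apply: (smooth_on_near Uo).
  split; first by apply: Gc; apply: open_nbhs_nbhs.
  by apply: (@filter_forall _ 'I_k (fun j x => smooth_at x (fun x => G x 0 j)) (nbhs p)).
apply: (salg_smooth_on Uo); apply: (salg_comp Wo fW).
  by move=> x [/interior_subset].
by move=> j; apply: salg_smooth => x [_ /interior_subset].
Qed.

Lemma partial_comp p f G i : smooth_near (G p) f -> smooth_map_near p G ->
  partial i (f \o G) p = \sum_j partial i (fun x => G x 0 j) p * partial j f (G p).
Proof.
move=> fp Gp; have [_ E] := chain_rule (smooth_near_C1 fp)
  (fun j => @smooth_near_derivable _ _ _ _ i (Gp j)).
exact: E.
Qed.

End SmoothComp.

Section Taylor0.
Context {R : realType}.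

Lemma partial_partialsC m (U : set 'rV[R]_m) f i s : open U -> smooth_on U f ->
  forall x, U x -> partial i (partials s f) x = partials s (partial i f) x.
Proof.
move=> Uo fU; elim: s => [//|j s IH] x Ux /=.
rewrite -(eq_on_partial j Uo IH Ux); apply: smooth_partialC.
by apply: (smooth_on_near Uo Ux); apply: smooth_on_partials.
Qed.

Lemma partials_perm m (U : set 'rV[R]_m) f s s' : open U -> smooth_on U f ->
  perm_eq s s' -> forall x, U x -> partials s f x = partials s' f x.
Proof.
move=> Uo fU; elim: s s' => [|i s IH] s' ss' x Ux.
  by move: ss'; rewrite perm_sym => /perm_nilP ->.
have is' : i \in s' by rewrite -(perm_mem ss') mem_head.
case/path.splitPr: is' ss' => s1 s2 ss'.
have {}ss' : perm_eq s (s1 ++ s2).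
  by rewrite -(perm_cons i) (permPl ss') -cat1s perm_catCA.
rewrite /= (eq_on_partial i Uo (IH _ ss') Ux) /partials !foldr_cat -!/(partials _ _).
rewrite (partial_partialsC i s1 Uo (smooth_on_partials s2 fU) Ux).
by [].
Qed.

(** The order of differentiation used in the coefficients of Taylor series; by
    symmetry any permutation of it gives the same derivative
    ([partials_perm]). *)
Definition mi_seq m (a : multi_index m) : seq 'I_m :=
  flatten [seq nseq (a i) i | i <- enum 'I_m].

Lemma count_mi_seq m (a : multi_index m) i : count_mem i (mi_seq a) = a i.
Proof.
rewrite /mi_seq count_flatten -map_comp sumnE big_map.
rewrite (bigD1_seq i) ?mem_enum ?enum_uniq //= count_nseq /= eqxx mul1n.
rewrite big1 ?addn0 // => j ji.
by rewrite count_nseq /= (negbTE ji) mul0n.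
Qed.

Definition mi_fact m (a : multi_index m) : nat := \prod_i (a i)`!.

Lemma coef_taylor0 m (f : 'rV[R]_m -> R) a :
  fps_coef (taylor0 f) a = partials (mi_seq a) f 0 / (mi_fact a)%:R.
Proof.
rewrite /= /mi_fact /mi_seq; congr (_ 0 / _).
elim: (enum 'I_m) => //= i s ->; rewrite /partials foldr_cat.
by elim: (a i) => //= k ->.
Qed.

Lemma taylor0_coef0 m (f : 'rV[R]_m -> R) : fps_coef (taylor0 f) mi0 = f 0.
Proof.
rewrite coef_taylor0 (_ : mi_seq mi0 = [::]); last first.
  by rewrite /mi_seq; elim: (enum _) => //= i s ->; rewrite ffunE.
by rewrite /mi_fact big1 ?divr1 // => i _; rewrite ffunE.
Qed.

Lemma taylor0_partial m (f : 'rV[R]_m -> R) i : smooth_near 0 f ->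
  taylor0 (partial i f) = fps_deriv i (taylor0 f).
Proof.
move=> /smooth_near_open[U [Uo U0 fU]]; apply: fps_ext => a.
rewrite -[RHS]/(fps_coef (taylor0 f) (mi_add a (mi1 i)) *+ (a i).+1) !coef_taylor0.
have -> : partials (mi_seq a) (partial i f) = partials (rcons (mi_seq a) i) f.
  by rewrite /partials foldr_rcons.
rewrite (@partials_perm _ U f _ (mi_seq (mi_add a (mi1 i)))) //; last first.
  apply/allP => j _ /=; apply/eqP.
  rewrite -cats1 count_cat !count_mi_seq !ffunE /= addn0.
  by rewrite eq_sym.
have -> : mi_fact (mi_add a (mi1 i)) = (mi_fact a * (a i).+1)%N.
  rewrite /mi_fact (bigD1 i) //= [in RHS](bigD1 i) //= !ffunE eqxx addn1 factS.
  rewrite -[LHS]mulnA [LHS]mulnC; congr (_ * _ * _)%N.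
  by apply: eq_bigr => j ji; rewrite !ffunE (negbTE ji) addn0.
by rewrite -[RHS]mulr_natr natrM invfM mulrA divfK // pnatr_eq0.
Qed.

Lemma eq_near_taylor0 m (f g : 'rV[R]_m -> R) :
  (\forall x \near (0 : 'rV[R]_m), f x = g x) -> taylor0 f = taylor0 g.
Proof.
move=> fg; apply: fps_ext => a; rewrite !coef_taylor0; congr (_ / _).
by apply: (@eq_on_partials _ _ (interior (fun x => f x = g x))) => // [|x /interior_subset];
  first exact: open_interior.
Qed.

End Taylor0.

(** * Taylor series at the origin *)

Section TaylorMorphism.
Context {R : realType}.

Lemma near_all m (p : 'rV[R]_m) (P : 'rV[R]_m -> Prop) :
  (forall x, P x) -> \forall x \near p, P x.
Proof.
by move=> H; near=> x; apply: H.
Unshelve. all: by end_near. Qed.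

Lemma taylor0D m (f g : 'rV[R]_m -> R) : smooth_near 0 f -> smooth_near 0 g ->
  taylor0 (fun x => f x + g x) = taylor0 f + taylor0 g.
Proof.
move=> f0 g0; apply: fps_ext => a.
elim/(@mi_ind m): a f g f0 g0 => [|a i IH] f g f0 g0.
  by rewrite fps_coefD !taylor0_coef0.
have dE : fps_deriv i (taylor0 (fun x => f x + g x)) =
    taylor0 (fun x => partial i f x + partial i g x).
  rewrite -taylor0_partial; last exact: smooth_nearD.
  apply: eq_near_taylor0; have nf := smooth_near_near f0; have ng := smooth_near_near g0.
  by apply: filterS2 nf ng => x fx gx; apply: partialD.
have := congr1 (fun h => fps_coef h a) dE.
rewrite IH; [|exact: smooth_near_partial..].
rewrite !taylor0_partial // fps_coefD !fps_coef_deriv -mulrnDl => /eqP.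
by rewrite -subr_eq0 -mulrnBl mulrn_eq0 /= subr_eq0 => /eqP.
Qed.

Lemma ord_geS_deriv m (f : fps m R) n : fps_coef f mi0 = 0 ->
  (forall i, ord_ge n (fps_deriv i f)) -> ord_ge n.+1 f.
Proof.
move=> f0 df a; elim/(@mi_ind m): a => // a i _.
rewrite mi_deg_add mi_deg1 addn1 ltnS => an; have := df i a an.
by rewrite fps_coef_deriv => /eqP; rewrite mulrn_eq0 => /eqP.
Qed.

(** Both sides have the same value at the origin and, by induction on the
    order, the same first derivatives. *)
Lemma taylor0M m (f g : 'rV[R]_m -> R) : smooth_near 0 f -> smooth_near 0 g ->
  taylor0 (fun x => f x * g x) = taylor0 f * taylor0 g.
Proof.
move=> f0 g0; apply/eqP; rewrite -subr_eq0; apply/eqP/ord_ge_eq0 => n.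
elim: n f g f0 g0 => [|n IH] f g f0 g0; first exact: ord_ge0.
apply: ord_geS_deriv => [|i].
  by rewrite fps_coefD -[fps_coef (- _) _]/(- fps_coef _ _) fps_coef0M !taylor0_coef0 subrr.
rewrite fps_derivB fps_derivM -taylor0_partial; last exact: smooth_nearM.
have df := smooth_near_partial i f0; have dg := smooth_near_partial i g0.
rewrite (_ : taylor0 (partial i _) =
    taylor0 (fun x => partial i f x * g x + f x * partial i g x)); last first.
  apply: eq_near_taylor0; have nf := smooth_near_near f0; have ng := smooth_near_near g0.
  by apply: filterS2 nf ng => x fx gx; apply: partialM.
rewrite taylor0D; [|exact: smooth_nearM..].
rewrite opprD addrACA; apply: ord_geD; rewrite -taylor0_partial //; exact: IH.
Qed.

Lemma taylor0_cst m (c : R) : taylor0 (cst c : 'rV[R]_m -> R) = c%:A.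
Proof.
apply/eqP; rewrite -subr_eq0; apply/eqP/ord_ge_eq0 => n.
elim: n c => [|n IH] c; first exact: ord_ge0.
apply: ord_geS_deriv => [|i].
  rewrite fps_coefD -[fps_coef (- _) _]/(- fps_coef _ _) taylor0_coef0.
  by rewrite fps_coefZ /= eqxx mulr1 subrr.
rewrite fps_derivB fps_derivZ fps_deriv1 scaler0 subr0 -taylor0_partial.
  have -> : partial i (cst c : 'rV[R]_m -> R) = cst 0.
    by apply/funext => y; rewrite /partial derive_cst.
  by have := IH 0; rewrite scale0r subr0.
exact: smooth_near_cst.
Qed.

Lemma taylor0_coord m (j : 'I_m) : taylor0 (fun x : 'rV[R]_m => x 0 j) = fpsX j.
Proof.
apply: fps_ext => a; elim/(@mi_ind m): a => [|a i _].
  by rewrite taylor0_coef0 mxE fpsX_coef0.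
have := congr1 (fun h => fps_coef h a)
  (taylor0_partial i (smooth_near_coord (0 : 'rV[R]_m) j)).
rewrite partial_coord taylor0_cst.
have -> : ((i == j)%:R : R)%:A = fps_deriv i (fpsX j) :> fps m R.
  by rewrite fps_derivX; case: eqP; rewrite ?scale1r ?scale0r.
rewrite !fps_coef_deriv => /esym/eqP.
by rewrite -subr_eq0 -mulrnBl mulrn_eq0 /= subr_eq0 => /eqP.
Qed.

(** Smoothness at the origin together with the Taylor series, so that
    expressions in smooth functions can be expanded structurally. *)
Definition has_jet m (f : 'rV[R]_m -> R) (F : fps m R) : Prop :=
  smooth_near 0 f /\ taylor0 f = F.

Section HasJet.
Context {m : nat}.
Implicit Types (f g : 'rV[R]_m -> R) (F G : fps m R).

Lemma has_jet_taylor f : smooth_near 0 f -> has_jet f (taylor0 f).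
Proof. by []. Qed.

Lemma has_jet_cst c : has_jet (fun=> c : R) (c%:A : fps m R).
Proof. by split; [exact: smooth_near_cst|exact: taylor0_cst]. Qed.

Lemma has_jet_coord j : has_jet (fun x : 'rV[R]_m => x 0 j) (fpsX j).
Proof. by split; [exact: smooth_near_coord|exact: taylor0_coord]. Qed.

Lemma has_jetD f g F G : has_jet f F -> has_jet g G ->
  has_jet (fun x => f x + g x) (F + G).
Proof. by move=> [f0 <-] [g0 <-]; split; [exact: smooth_nearD|exact: taylor0D]. Qed.

Lemma has_jetM f g F G : has_jet f F -> has_jet g G ->
  has_jet (fun x => f x * g x) (F * G).
Proof. by move=> [f0 <-] [g0 <-]; split; [exact: smooth_nearM|exact: taylor0M]. Qed.

Lemma has_jet_eq f g F G : (\forall x \near (0 : 'rV[R]_m), f x = g x) -> F = G ->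
  has_jet f F -> has_jet g G.
Proof.
move=> fg <- [f0 <-]; split; first exact: smooth_near_eq fg f0.
exact/esym/eq_near_taylor0.
Qed.

Lemma has_jetZ c f F : has_jet f F -> has_jet (fun x => c * f x) (c *: F).
Proof.
move=> fF; have := has_jetM (has_jet_cst c) fF; rewrite -scalerAl mul1r.
exact.
Qed.

Lemma has_jetN f F : has_jet f F -> has_jet (fun x => - f x) (- F).
Proof.
move=> /(has_jetZ (-1)); apply: has_jet_eq; last by rewrite scaleN1r.
by apply: near_all => x; rewrite mulN1r.
Qed.

Lemma has_jetB f g F G : has_jet f F -> has_jet g G ->
  has_jet (fun x => f x - g x) (F - G).
Proof. by move=> fF /has_jetN; apply: has_jetD. Qed.

Lemma has_jet_sum (I : Type) (s : seq I) (P : pred I) (f : I -> 'rV[R]_m -> R)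
    (F : I -> fps m R) :
  (forall i, P i -> has_jet (f i) (F i)) ->
  has_jet (fun x => \sum_(i <- s | P i) f i x) (\sum_(i <- s | P i) F i).
Proof.
move=> fF; elim: s => [|i s IH].
  rewrite big_nil -(scale0r (1 : fps m R)); apply: has_jet_eq (has_jet_cst 0) => //.
  by apply: near_all => x; rewrite big_nil.
rewrite big_cons; have [Pi|Pi] := boolP (P i); last first.
  by apply: has_jet_eq IH => //; apply: near_all => x; rewrite big_cons (negbTE Pi).
apply: has_jet_eq (has_jetD (fF i Pi) IH) => //.
by apply: near_all => x; rewrite big_cons Pi.
Qed.

Lemma has_jetX f F n : has_jet f F -> has_jet (fun x => f x ^+ n) (F ^+ n).
Proof.
move=> fF; elim: n => [|n IH].
  rewrite expr0 -(scale1r (1 : fps m R)); apply: has_jet_eq (has_jet_cst 1) => //.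
  by apply: near_all => x; rewrite expr0.
rewrite exprS; apply: has_jet_eq (has_jetM fF IH) => //.
by apply: near_all => x; rewrite exprS.
Qed.

Lemma has_jet_partial f F i : has_jet f F -> has_jet (partial i f) (fps_deriv i F).
Proof.
by move=> [f0 <-]; split; [exact: smooth_near_partial|exact: taylor0_partial].
Qed.

End HasJet.

(** As for products: equal values at the origin, and by the chain rule and
    induction equal first derivatives. *)
Lemma taylor0_comp m k (f : 'rV[R]_k -> R) (G : 'rV[R]_m -> 'rV[R]_k) :
    G 0 = 0 -> smooth_near 0 f -> smooth_map_near 0 G ->
  taylor0 (f \o G) = fps_comp (fun j => taylor0 (fun x => G x 0 j)) (taylor0 f).
Proof.
move=> G0 f0 GS; apply/eqP; rewrite -subr_eq0; apply/eqP/ord_ge_eq0 => n.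
have fG (h : 'rV[R]_k -> R) : smooth_near 0 h -> smooth_near 0 (h \o G).
  move=> h0; apply: smooth_near_comp; last exact: GS.
  rewrite G0; exact: h0.
elim: n f f0 => [|n IH] f f0; first exact: ord_ge0.
apply: ord_geS_deriv => [|i].
  rewrite fps_coefD -[fps_coef (- _) _]/(- fps_coef _ _) fps_comp_coef0.
  by rewrite !taylor0_coef0 /= G0 subrr.
rewrite fps_derivB fps_deriv_comp -taylor0_partial; last exact: fG.
have [_ ->] : has_jet (partial i (f \o G))
   (\sum_j taylor0 (partial i (fun x => G x 0 j)) * taylor0 (partial j f \o G)).
  apply: (has_jet_eq (f := fun x => \sum_j partial i (fun x => G x 0 j) x *
      (partial j f \o G) x) _ (erefl _)); last first.
    apply: has_jet_sum => j _; apply: has_jetM; apply: has_jet_taylor.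
      exact: smooth_near_partial (GS j).
    exact/fG/smooth_near_partial.
  have nG := smooth_map_near_near GS.
  have nf : \forall x \near (0 : 'rV[R]_m), smooth_near (G x) f.
    have Gc := smooth_map_continuous GS.
    have nG0 : nbhs (G 0) (fun y => smooth_near y f).
      by rewrite G0; exact: smooth_near_near f0.
    exact: (Gc _ nG0).
  by apply: filterS2 nf nG => x fx Gx; rewrite -partial_comp.
rewrite -sumrB; apply: ord_ge_sum => j _; rewrite (taylor0_partial i (GS j)) -mulrBr.
by apply: ord_geMl; rewrite -(taylor0_partial j f0); apply: (IH _ (smooth_near_partial j f0)).
Qed.

Lemma has_jet_comp m k (f : 'rV[R]_k -> R) F (G : 'rV[R]_m -> 'rV[R]_k) H :
    G 0 = 0 -> has_jet f F -> (forall j, has_jet (fun x => G x 0 j) (H j)) ->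
  has_jet (f \o G) (fps_comp H F).
Proof.
move=> G0 [f0 <-] GH; have GS : smooth_map_near 0 G by move=> j; have [] := GH j.
split; first by apply: smooth_near_comp; [rewrite G0; exact: f0|exact: GS].
rewrite (taylor0_comp G0 f0 GS); apply: eq_fps_comp => j.
by have [_ ->] := GH j.
Qed.

(** By induction the partial derivatives are O(|x| ^ (n - 1)), and
    [increment_le] bounds the function by them. *)
Lemma taylor_remainder m (f : 'rV[R]_m -> R) n : smooth_near 0 f ->
    ord_ge n (taylor0 f) ->
  exists2 C, 0 <= C & \forall x \near (0 : 'rV[R]_m), `|f x| <= C * `|x| ^+ n.
Proof.
elim: n f => [|n IH] f f0 fn.
  exists (`|f 0| + 1); first by rewrite addr_ge0.
  have /cvgrPdist_le/(_ _ ltr01) := smooth_near_continuous f0.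
  apply: filterS => x fx; rewrite expr0 mulr1.
  rewrite -[f x](subrK (f 0)) addrC; apply: le_trans (ler_normD _ _) _.
  by rewrite lerD2l distrC.
have dfn i : ord_ge n (taylor0 (partial i f)).
  by rewrite taylor0_partial //; apply: ord_ge_deriv.
have dfi i : exists2 C, 0 <= C & \forall x \near (0 : 'rV[R]_m),
    `|partial i f x| <= C * `|x| ^+ n.
  by apply: IH (dfn i); apply: smooth_near_partial.
have /choice[C HC] : forall i, exists C, 0 <= C /\
    \forall x \near (0 : 'rV[R]_m), `|partial i f x| <= C * `|x| ^+ n.
  by move=> i; have [C C0 HC] := dfi i; exists C.
pose D := \sum_i C i; have D0 : 0 <= D by apply: sumr_ge0 => i _; have [] := HC i.
exists (m%:R * D); first by rewrite mulr_ge0.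
have f00 : f 0 = 0.
  by rewrite -taylor0_coef0; apply: fn; rewrite mi_deg0.
have : \forall x \near (0 : 'rV[R]_m), smooth_near x f /\
    forall i, `|partial i f x| <= D * `|x| ^+ n.
  apply: filterI; first exact: smooth_near_near.
  apply: (@filter_forall _ 'I_m (fun i x => `|partial i f x| <= D * `|x| ^+ n)
     (nbhs (0 : 'rV[R]_m))) => i.
  have [Ci0 nCi] := HC i; apply: filterS nCi => x Hx; apply: le_trans Hx _.
  apply: ler_wpM2r; first exact: exprn_ge0.
  rewrite /D (bigD1 i) //= lerDl; apply: sumr_ge0 => j _; have [Cj _] := HC j; exact: Cj.
move=> /nbhs_ballP[r /= r0 rP]; apply/nbhs_ballP; exists r => // x.
rewrite -ball_normE /= sub0r normrN => xr.
have := @increment_le R m f 0 x (fun=> 0) (D * `|x| ^+ n) _.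
rewrite add0r f00 subr0 big1 => [|i _]; last by rewrite mulr0.
rewrite subr0 exprSr !mulrA; apply => y yx i.
have [|fy dfy] := rP y; first by rewrite -ball_normE /= sub0r normrN (le_lt_trans yx).
rewrite add0r subr0; split; first exact: smooth_near_derivable.
apply: le_trans (dfy i) _; apply: ler_wpM2l => //.
by apply: lerXn2r; rewrite ?nnegrE.
Qed.

End TaylorMorphism.

(** * Points of the hypersurface near a given point *)

Section Hypersurface.
Context {R : realType} {m : nat}.
Implicit Types (S : set 'rV[R]_m) (r : 'rV[R]_m -> R) (p q x : 'rV[R]_m).
Local Notation e i := (delta_mx (0 : 'I_1) i : 'rV[R]_m).

Lemma norm_scale_e (a : R) i : `|a *: e i| <= `|a|.
Proof.
apply: norm_rV_le => // l; rewrite !mxE normrM ler_piMr // eqxx /=.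
by case: eqP; rewrite ?normr1 ?normr0.
Qed.

(** Moving in a direction transversal to [S], the intermediate value theorem
    gives a point of [S] at distance O(|r|), where all the [h i] have changed
    by O(|r|) only. *)
Lemma nearest_point (I : finType) S p r (h : I -> 'rV[R]_m -> R) :
    defining_function S p r -> r p = 0 -> (forall i, smooth_near p (h i)) ->
  exists2 C, 0 <= C & forall N : set 'rV[R]_m, nbhs p N ->
    \forall x \near p, exists y, [/\ N y, S y &
      forall i, `|h i y - h i x| <= C * `|r x|].
Proof.
move=> [rS Sr [l Dn0]] rp hS; set D := partial l r p in Dn0.
have D20 : 0 < `|D| / 2 by rewrite divr_gt0 ?normr_gt0.
have nr : \forall x \near p, derivable r x (e l) /\ `|D - partial l r x| <= `|D| / 2.
  apply: filterI.
    apply: filterS (smooth_near_near rS) => x; exact: smooth_near_derivable.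
  have /cvgrPdist_le := smooth_near_continuous (smooth_near_partial l rS).
  by apply.
have nh : \forall x \near p, forall i, derivable (h i) x (e l) /\
    `|partial l (h i) x| <= `|partial l (h i) p| + 1.
  apply: (@filter_forall _ I (fun i x => derivable (h i) x (e l) /\
     `|partial l (h i) x| <= `|partial l (h i) p| + 1) (nbhs p)) => i.
  apply: filterI.
    apply: filterS (smooth_near_near (hS i)) => x; exact: smooth_near_derivable.
  have /cvgrPdist_le/(_ _ ltr01) := smooth_near_continuous (smooth_near_partial l (hS i)).
  apply: filterS => x Hx; rewrite -[partial l (h i) x](subrK (partial l (h i) p)) addrC.
  apply: le_trans (ler_normD _ _) _.
  by rewrite lerD2l distrC.
pose M := \sum_i (`|partial l (h i) p| + 1).
have M0 : 0 <= M by apply: sumr_ge0 => i _; rewrite addr_ge0.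
exists (M * (2 / `|D|)); first by rewrite mulr_ge0 // divr_ge0.
move=> N Np.
have nn : \forall x \near p,
    ((derivable r x (e l) /\ `|D - partial l r x| <= `|D| / 2) /\
     (forall i, derivable (h i) x (e l) /\
        `|partial l (h i) x| <= `|partial l (h i) p| + 1)) /\
    (N x /\ (S x <-> r x = 0)).
  by apply: filterI; apply: filterI.
move/nbhs_ballP: nn => [d /= d0 dP].
have d20 : 0 < d / 2 by rewrite divr_gt0.
have dD0 : 0 < d / 2 * (`|D| / 2) by rewrite mulr_gt0.
have /cvgrPdist_lt/(_ _ dD0) rc := smooth_near_continuous rS.
have nb : \forall x \near p, ball p (d / 2) x by apply: nbhsx_ballx.
apply: filterS2 rc nb => x rx xb.
rewrite rp sub0r normrN in rx.
pose t0 := 2 / `|D| * `|r x|.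
have t00 : 0 <= t0 by rewrite mulr_ge0 // divr_ge0.
have Dp : 0 < `|D| by rewrite normr_gt0.
have t0d : t0 < d / 2.
  have -> : t0 = `|r x| / (`|D| / 2) by rewrite /t0 invf_div mulrC.
  by rewrite ltr_pdivrMr.
have inb (t : R) : `|t| <= t0 -> ball p d (x + t *: e l).
  move=> tt0; move: xb; rewrite -!ball_normE /= => xb.
  rewrite opprD addrA (splitr d); apply: le_lt_trans (ler_normB _ _) _.
  by apply: ltrD => //; apply: le_lt_trans (norm_scale_e _ _) (le_lt_trans tt0 t0d).
(* increasing in [t], with slope at least [D ^ 2 / 2], whatever the sign of [D] *)
pose f (t : R) := D * r (x + t *: e l).
have fc : {within `[- t0, t0], continuous f}.
  apply: derivable_within_continuous => t; rewrite in_itv /= => /andP[t1 t2].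
  apply: derivableM; first exact: derivable_cst.
  apply: line_derivable; have [|[[]]] := dP (x + t *: e l) => //.
  by apply: inb; rewrite ler_norml t1 t2.
have slope (t : R) : `|t| <= t0 -> `|D| ^+ 2 / 2 <= D * partial l r (x + t *: e l).
  move=> tt0; have [[_ Hs] _] := (dP _ (inb t tt0)).1.
  set z := partial l r _ in Hs *.
  have -> : D * z = D ^+ 2 - D * (D - z) by ring.
  rewrite -normrX ger0_norm ?sqr_ge0 //.
  have := ler_norm (D * (D - z)); rewrite normrM => h1.
  have h2 : `|D| * `|D - z| <= `|D| * (`|D| / 2) by apply: ler_wpM2l.
  have h3 : `|D| * (`|D| / 2) = D ^+ 2 / 2 by rewrite mulrA -expr2 -normrX ger0_norm ?sqr_ge0.
  lra.
have Dr : `|D * r x| = t0 * (`|D| ^+ 2 / 2).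
  by rewrite normrM /t0; field; rewrite gt_eqF.
have f1 : 0 <= f t0.
  have [t tt0|t tt0 E] := @mvt_line R _ r x (e l) t0.
    rewrite (ger0_norm t00) in tt0.
    by have [[]] := (dP _ (inb t tt0)).1.
  rewrite (ger0_norm t00) in tt0.
  rewrite /f; have -> : r (x + t0 *: e l) = r x + t0 * partial l r (x + t *: e l).
    by rewrite -[r (x + _)](subrK (r x)) E addrC.
  rewrite mulrDr mulrCA; have := ler_norm (- (D * r x)); rewrite normrN Dr.
  have := ler_wpM2l t00 (slope t tt0); lra.
have f2 : f (- t0) <= 0.
  have [t tt0|t tt0 E] := @mvt_line R _ r x (e l) (- t0).
    rewrite normrN (ger0_norm t00) in tt0.
    by have [[]] := (dP _ (inb t tt0)).1.
  rewrite normrN (ger0_norm t00) in tt0.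
  rewrite /f; have -> : r (x + - t0 *: e l) = r x - t0 * partial l r (x + t *: e l).
    by rewrite -[r (x + _)](subrK (r x)) E mulNr addrC.
  rewrite mulrBr mulrCA; have := ler_norm (D * r x); rewrite Dr.
  have := ler_wpM2l t00 (slope t tt0); lra.
have t0le : - t0 <= t0 by rewrite ge0_cp.
have [|t] := @IVT R f (- t0) t0 0 t0le fc.
  by rewrite ge_min f2 le_max f1 orbT.
rewrite in_itv /= => /andP[t1 t2] /eqP; rewrite /f mulf_eq0 (negbTE Dn0) /= => /eqP rt.
have tt0 : `|t| <= t0 by rewrite ler_norml t1 t2.
have [_ [Ny Sy]] := dP _ (inb t tt0).
exists (x + t *: e l); split=> //; first exact/Sy.
move=> i; have [u ut|u ut ->] := @mvt_line R _ (h i) x (e l) t.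
  by have [_ /(_ i)[]] := (dP _ (inb u (le_trans ut tt0))).1.
have [_ /(_ i)[_ Hi]] := (dP _ (inb u (le_trans ut tt0))).1.
rewrite normrM mulrC -mulrA; apply: ler_pM => //.
apply: le_trans Hi _; rewrite /M (bigD1 i) //= lerDl.
by apply: sumr_ge0 => j _; rewrite addr_ge0.
Qed.

Lemma defining_function_near S p r : defining_function S p r ->
  \forall q \near p, defining_function S q r.
Proof.
move=> [rS Sr [l Dn0]].
have nl : \forall q \near p, partial l r q != 0.
  have := smooth_near_continuous (smooth_near_partial l rS).
  by move=> /cvgr_neq0; apply.
have n1 := smooth_near_near rS.
have n2 : \forall q \near p, \forall x \near q, S x <-> r x = 0 by apply: near_join.
by apply: filterS3 n1 n2 nl => q q1 q2 q3; split=> //; exists l.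
Qed.

Lemma defining_function0 S p r : defining_function S p r -> S p -> r p = 0.
Proof. by move=> [_ /nbhs_singleton Sr _] /Sr. Qed.

Lemma defining_function_vanishes S p r : defining_function S p r -> vanishes_on S p r.
Proof. by move=> [_ Sr _]; apply: filterS Sr => x Sx /Sx. Qed.

(** Compare [f x] with the value of [f] at a point of [S] at distance
    O(|r x|), where [f] vanishes. *)
Lemma vanishing_le S p r f : defining_function S p r -> S p ->
    smooth_near p f -> vanishes_on S p f ->
  exists2 C, 0 <= C & \forall x \near p, `|f x| <= C * `|r x|.
Proof.
move=> dr Sp fS fv; have rp := defining_function0 dr Sp.
have [C C0 HC] := @nearest_point unit S p r (fun=> f) dr rp (fun=> fS).
exists C => //; apply: filterS (HC _ fv) => x [y [fy Sy /(_ tt)]].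
by rewrite (fy Sy) sub0r normrN.
Qed.

(** A function vanishing on [S] is O(|r|), so its derivative vanishes in every
    direction in which that of [r] does. *)
Lemma tangentP S p r v : defining_function S p r -> S p ->
  tangent S p v <-> \sum_i v 0 i * partial i r p = 0.
Proof.
move=> dr Sp; have [rS _ _] := dr; have rp := defining_function0 dr Sp; split.
  move=> /(_ r rS (defining_function_vanishes dr)).
  by rewrite (smooth_near_derive v rS).
rewrite -(smooth_near_derive v rS) => Dr f fS fv.
have fp : f p = 0 by have /nbhs_singleton := fv; apply.
have [C C0 HC] := vanishing_le dr Sp fS fv.
have df : derivable f p v by apply/diff_derivable/smooth_near_diff.
have drv : derivable r p v by apply/diff_derivable/smooth_near_diff.
have f_lim : (fun h => h^-1 *: ((f \o shift p) (h *: v) - f p)) @ 0^' --> 'D_v f p := df.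
have r_lim : (fun h => h^-1 *: ((r \o shift p) (h *: v) - r p)) @ 0^' --> 'D_v r p := drv.
rewrite Dr in r_lim.
have f_lim0 : (fun h => h^-1 *: ((f \o shift p) (h *: v) - f p)) @ 0^' --> (0 : R).
  apply/cvgrPdist_le => eps eps0.
  have e0 : 0 < eps / (C + 1) by rewrite divr_gt0 // ltr_wpDl.
  have /cvgrPdist_le/(_ _ e0) Hr := r_lim.
  have HC' : \forall h \near 0^', `|f (h *: v + p)| <= C * `|r (h *: v + p)|.
    move/nbhs_ballP: HC => [d /= d0 dP].
    have d'0 : 0 < d / (`|v| + 1) by rewrite divr_gt0 // ltr_wpDl.
    have n0 : \forall h \near (0 : R)^', `|h| < d / (`|v| + 1) by apply: dnbhs0_lt.
    apply: filterS n0 => h hd; apply: dP; rewrite -ball_normE /=.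
    rewrite opprD addrCA subrr addr0 normrN normrZ.
    rewrite ltr_pdivlMr ?ltr_wpDl // in hd; apply: le_lt_trans hd.
    by rewrite ler_wpM2l // lerDl.
  apply: filterS2 Hr HC' => h; rewrite !sub0r !normrN /= fp rp !subr0 => Hr HC'.
  rewrite normrZ; apply: le_trans (ler_wpM2l (normr_ge0 _) HC') _.
  rewrite normrZ in Hr; rewrite mulrCA.
  apply: le_trans (ler_wpM2l C0 Hr) _.
  rewrite mulrA ler_pdivrMr ?ltr_wpDl // mulrC ler_pM2l //.
  by rewrite lerDl.
exact: (cvg_unique _ f_lim f_lim0).
Qed.

End Hypersurface.

(** * The Levi form of a defining function *)

Section LeviAlgebra.
Context {n : nat}.

(** The complex structure of [C ^ n] in the coordinates [x, y], over any ring. *)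
Definition Jf (Q : comPzRingType) (v : 'I_(n + n) -> Q) (i : 'I_(n + n)) : Q :=
  match fintype.split i with inl j => - v (rshift n j) | inr j => v (lshift n j) end.

Definition dotf (Q : comPzRingType) (p v : 'I_(n + n) -> Q) : Q := \sum_i p i * v i.

Definition quadf (Q : comPzRingType) (H : 'I_(n + n) -> 'I_(n + n) -> Q)
  (v : 'I_(n + n) -> Q) : Q := \sum_i \sum_j H i j * v i * v j.

(** [|p|^2] times the real part of the projection of [v - i J v] to the complex
    tangent space [p = p o J = 0]; the factor clears denominators. *)
Definition ctan (Q : comPzRingType) (p v : 'I_(n + n) -> Q) (i : 'I_(n + n)) : Q :=
  dotf p p * v i - dotf p v * p i + dotf p (Jf v) * Jf p i.

(** The Levi form of [r], with gradient [p] and Hessian [H], on the projection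
    of [v] to the complex tangent space: the Hessian on [v] plus the Hessian
    on [J v] is a multiple of the sum of [r_(j kbar) v_j vbar_k]. Having the
    projection built in makes positivity a condition on all [v], and a
    polynomial one. *)
Definition levi (Q : comPzRingType) (p : 'I_(n + n) -> Q)
    (H : 'I_(n + n) -> 'I_(n + n) -> Q) (v : 'I_(n + n) -> Q) : Q :=
  quadf H (ctan p v) + quadf H (Jf (ctan p v)).

Section Rel.
Context {Q1 Q2 : comPzRingType} (rel : Q1 -> Q2 -> Prop).
Hypothesis rel0 : rel 0 0.
Hypothesis relD : forall a a' b b', rel a a' -> rel b b' -> rel (a + b) (a' + b').
Hypothesis relM : forall a a' b b', rel a a' -> rel b b' -> rel (a * b) (a' * b').
Hypothesis relN : forall a a', rel a a' -> rel (- a) (- a').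

Lemma rel_sum (I : Type) (s : seq I) (F : I -> Q1) (F' : I -> Q2) :
  (forall i, rel (F i) (F' i)) -> rel (\sum_(i <- s) F i) (\sum_(i <- s) F' i).
Proof.
move=> FF; elim: s => [|i s IH]; first by rewrite !big_nil.
by rewrite !big_cons; apply: relD.
Qed.

Lemma rel_Jf v v' : (forall i, rel (v i) (v' i)) -> forall i, rel (Jf v i) (Jf v' i).
Proof. by move=> vv i; rewrite /Jf; case: fintype.split => j //; apply: relN. Qed.

Lemma rel_dotf p p' v v' : (forall i, rel (p i) (p' i)) -> (forall i, rel (v i) (v' i)) ->
  rel (dotf p v) (dotf p' v').
Proof. by move=> pp vv; apply: rel_sum => i; apply: relM. Qed.

Lemma rel_ctan p p' v v' : (forall i, rel (p i) (p' i)) -> (forall i, rel (v i) (v' i)) ->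
  forall i, rel (ctan p v i) (ctan p' v' i).
Proof.
move=> pp vv i; have Jv := rel_Jf vv; have Jp := rel_Jf pp.
by apply: relD; [apply: relD; [|apply: relN]|]; apply: relM => //; apply: rel_dotf.
Qed.

Lemma rel_quadf H H' v v' : (forall i j, rel (H i j) (H' i j)) ->
  (forall i, rel (v i) (v' i)) -> rel (quadf H v) (quadf H' v').
Proof.
by move=> HH vv; do 2 (apply: rel_sum => ?); apply: relM => //; apply: relM.
Qed.

(** As a polynomial expression the Levi form is compatible with every relation
    between two rings that respects the ring operations. The relations used
    are Taylor expansion, closeness of functions, congruence of jets,
    evaluation and substitution. *)
Lemma levi_rel p p' H H' v v' : (forall i, rel (p i) (p' i)) ->
  (forall i j, rel (H i j) (H' i j)) -> (forall i, rel (v i) (v' i)) ->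
  rel (levi p H v) (levi p' H' v').
Proof.
move=> pp HH vv; have uu := rel_ctan pp vv.
by apply: relD; apply: rel_quadf => //; apply: rel_Jf.
Qed.

End Rel.

Section Identities.
Context {Q : comPzRingType}.
Implicit Types (p v : 'I_(n + n) -> Q).

Lemma JfK v i : Jf (Jf v) i = - v i.
Proof.
rewrite {1}/Jf; case: (split_ordP i) => j ->.
  by rewrite /Jf (unsplitK (inr j)).
by rewrite /Jf (unsplitK (inl j)).
Qed.

Lemma Jf_lin (a b : Q) v w i : Jf (fun k => a * v k + b * w k) i = a * Jf v i + b * Jf w i.
Proof. by rewrite /Jf; case: fintype.split => j; rewrite ?opprD ?mulrN. Qed.

Lemma dotf_split p v : dotf p v =
  \sum_j p (lshift n j) * v (lshift n j) + \sum_j p (rshift n j) * v (rshift n j).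
Proof. by rewrite /dotf big_split_ord. Qed.

Lemma dotfC p v : dotf p v = dotf v p.
Proof. by apply: eq_bigr => i _; rewrite mulrC. Qed.

Lemma dotf_Jself p : dotf p (Jf p) = 0.
Proof.
rewrite dotf_split -big_split /= big1 // => j _.
by rewrite /Jf (unsplitK (inl j)) (unsplitK (inr j)) mulrN mulrC addNr.
Qed.

Lemma dotfD p v w (a b : Q) : dotf p (fun k => a * v k + b * w k) = a * dotf p v + b * dotf p w.
Proof.
rewrite /dotf !mulr_sumr -big_split /=; apply: eq_bigr => i _.
by rewrite mulrDr; congr (_ + _); rewrite mulrCA.
Qed.

Lemma ctanE p v : ctan p v = fun i => dotf p p * v i +
  1 * ((- dotf p v) * p i + dotf p (Jf v) * Jf p i).
Proof. by apply/funext => i; rewrite /ctan mul1r mulNr addrA. Qed.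

(** [p], [J p] are orthogonal and of equal length. *)
Lemma dotf_ctan p v : dotf p (ctan p v) = 0.
Proof.
rewrite ctanE dotfD dotfD dotf_Jself mulr0 addr0 mul1r mulNr mulrC.
by rewrite subrr.
Qed.

Lemma dotf_Jctan p v : dotf p (Jf (ctan p v)) = 0.
Proof.
have -> : Jf (ctan p v) = fun i => dotf p p * Jf v i +
    1 * ((- dotf p v) * Jf p i + (- dotf p (Jf v)) * p i).
  apply/funext => i; rewrite ctanE Jf_lin mul1r Jf_lin JfK mul1r.
  by rewrite mulrN [X in _ = _ + (_ + X)]mulNr.
rewrite dotfD dotfD dotf_Jself mulr0 add0r mul1r mulNr mulrC.
by rewrite subrr.
Qed.

End Identities.
End LeviAlgebra.

Section LeviPositivity.
Context {R : realType} {n : nat}.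
Local Notation C := R[i].
Implicit Types (S : set 'rV[R]_(n + n)) (r : 'rV[R]_(n + n) -> R) (q x : 'rV[R]_(n + n)).

Definition gradf r x : 'I_(n + n) -> R := fun i => partial i r x.
Definition hessf r x : 'I_(n + n) -> 'I_(n + n) -> R := fun i j => partial i (partial j r) x.

Lemma JmapE (A : comPzRingType) (v : 'rV[A]_(n + n)) i : Jmap v 0 i = Jf (v 0) i.
Proof.
rewrite /Jmap /Jf mxE; case: fintype.splitP => j _; last by rewrite !mxE.
by rewrite !mxE.
Qed.

Lemma tangent_dotf S q r (v : 'rV[R]_(n + n)) : defining_function S q r -> S q ->
  tangent S q v <-> dotf (gradf r q) (v 0) = 0.
Proof. by move=> dr Sq; rewrite (tangentP v dr Sq) [in X in _ <-> X]dotfC. Qed.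

Lemma gradf_gt0 S q r : defining_function S q r -> 0 < dotf (gradf r q) (gradf r q).
Proof.
move=> [_ _ [i ri]]; rewrite /dotf (bigD1 i) //= ltr_pwDl //.
  by rewrite -expr2 exprn_even_gt0.
by apply: sumr_ge0 => j _; rewrite -expr2 sqr_ge0.
Qed.

Section Pointwise.
Context (S : set 'rV[R]_(n + n)) (q : 'rV[R]_(n + n)) (r : 'rV[R]_(n + n) -> R).
Context (dr : defining_function S q r) (Sq : S q) (theta : 'rV[C]_(n + n)).
Hypothesis theta0 : forall v w, H10 S q v -> H10 S q w ->
  form_app theta (v + map_mx conjc w) = 0.
Local Notation p := (gradf r q).

(** Up to the complex tangent directions, the tangent space is spanned by
    [- J p], on which [dr o J] takes the value [|p|^2]. *)
Definition reeb : 'rV[R]_(n + n) := \row_i (- Jf p i).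

Definition thetaR (y : 'rV[R]_(n + n)) : C := form_app theta (map_mx (real_complex R) y).

Lemma thetaRE y : thetaR y = \sum_k theta 0 k * (y 0 k)%:C.
Proof. by apply: eq_bigr => k _; rewrite mxE. Qed.

Lemma reeb_tangent : tangent S q reeb.
Proof.
apply/(tangent_dotf _ dr Sq).
have -> : reeb 0 = fun i => (-1) * Jf p i + 0 * p i.
  by apply/funext => i; rewrite mxE mulN1r mul0r addr0.
by rewrite dotfD dotf_Jself mul0r mulr0 addr0.
Qed.

(** A real vector [y] of the complex tangent space is the sum of
    [(y - i J y) / 2], of type (1, 0), and its conjugate. *)
Lemma thetaR_HS (y : 'rV[R]_(n + n)) :
  dotf p (y 0) = 0 -> dotf p (Jf (y 0)) = 0 -> thetaR y = 0.
Proof.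
move=> y0 Jy0.
pose v : 'rV[C]_(n + n) := \row_i ((y 0 i / 2) +i* - (Jf (y 0) i / 2))%C.
have vH : H10 S q v.
  split; last first.
    apply/rowP => i; rewrite JmapE !mxE /Jf; case: (split_ordP i) => j ->.
      rewrite /v !mxE /Jf (unsplitK (inr j)).
      by apply/eqP; rewrite eq_complex /=; apply/andP; split; apply/eqP; ring.
    rewrite /v !mxE /Jf (unsplitK (inl j)).
    by apply/eqP; rewrite eq_complex /=; apply/andP; split; apply/eqP; ring.
  split; apply/(tangent_dotf _ dr Sq).
    have -> : map_mx (@complex.Re R) v 0 = fun i => 2^-1 * y 0 i + 0 * y 0 i.
      by apply/funext => i; rewrite !mxE /= mulrC mul0r addr0.
    by rewrite dotfD y0 mulr0 mul0r addr0.
  have -> : map_mx (@complex.Im R) v 0 = fun i => (- 2^-1) * Jf (y 0) i + 0 * y 0 i.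
    by apply/funext => i; rewrite !mxE /= mulrC mulNr mul0r addr0.
  by rewrite dotfD Jy0 mulr0 mul0r addr0.
rewrite /thetaR -(theta0 vH vH); congr form_app; apply/rowP => i; rewrite !mxE.
by apply/eqP; rewrite eq_complex /=; apply/andP; split; apply/eqP; field.
Qed.

(** Subtracting a multiple of [reeb] from a tangent vector puts it into the
    complex tangent space, on which a contact form vanishes. *)
Lemma thetaR_decomp (y : 'rV[R]_(n + n)) : dotf p (y 0) = 0 ->
  thetaR y = (dotf p (Jf (y 0)) / dotf p p)%:C * thetaR reeb.
Proof.
move=> y0; have pp := gradf_gt0 dr; set c := _ / _.
pose z : 'rV[R]_(n + n) := y - c *: reeb.
have zE : z 0 = fun i => 1 * y 0 i + c * Jf p i.
  by apply/funext => i; rewrite !mxE mul1r mulrN opprK.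
have z0 : thetaR z = 0.
  apply: thetaR_HS; rewrite zE.
    by rewrite dotfD y0 dotf_Jself !mulr0 addr0.
  have -> : Jf (fun i => 1 * y 0 i + c * Jf p i) =
      fun i => 1 * Jf (y 0) i + (- c) * p i.
    by apply/funext => i; rewrite Jf_lin JfK mulrN mulNr.
  by rewrite dotfD mul1r mulNr /c divfK ?subrr // gt_eqF.
apply/eqP; rewrite -subr_eq0 -z0 !thetaRE mulr_sumr -sumrB; apply/eqP.
apply: eq_bigr => k _; rewrite zE mul1r mxE mulrCA -mulrBr; congr (_ * _).
by apply/eqP; rewrite eq_complex /=; apply/andP; split; apply/eqP; ring.
Qed.

Lemma reeb_neq0 : (exists2 v, tangent S q v & thetaR v != 0) -> thetaR reeb != 0.
Proof.
move=> [v /(tangent_dotf _ dr Sq) v0]; rewrite (thetaR_decomp v0).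
by apply: contra_neq => ->; rewrite mulr0.
Qed.

End Pointwise.

Section Bracket.
Context (r : 'rV[R]_(n + n) -> R) (q : 'rV[R]_(n + n)) (rS : smooth_near q r).
Context (v : 'I_(n + n) -> R).

Definition ctan_field x : 'I_(n + n) -> R := ctan (gradf r x) v.
Local Notation u := ctan_field.

Lemma smooth_grad x i : smooth_near x r -> smooth_near x (fun y => gradf r y i).
Proof. exact: smooth_near_partial. Qed.

Lemma smooth_ctan x i : smooth_near x r -> smooth_near x (fun y => u y i).
Proof.
move=> rx.
have dS (a b : 'rV[R]_(n + n) -> 'I_(n + n) -> R) :
    (forall i, smooth_near x (fun y => a y i)) ->
    (forall i, smooth_near x (fun y => b y i)) ->
    smooth_near x (fun y => dotf (a y) (b y)).
  move=> aS bS; apply: smooth_near_sum => k _.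
  exact: (smooth_nearM (aS k) (bS k)).
have gS k := smooth_grad k rx.
have cS (c : 'I_(n + n) -> R) k : smooth_near x (fun=> c k) by apply: smooth_near_cst.
have JS k : smooth_near x (fun y => Jf (gradf r y) k).
  by rewrite /Jf; case: fintype.split => j; [apply: smooth_nearN|]; apply: gS.
apply: smooth_nearD; first apply: smooth_nearB.
- exact: (smooth_nearM (dS _ _ gS gS) (cS v i)).
- exact: (smooth_nearM (dS _ (fun=> v) gS (cS v)) (gS i)).
- exact: (smooth_nearM (dS _ (fun=> Jf v) gS (cS (Jf v))) (JS i)).
Qed.

Lemma smooth_Jctan x i : smooth_near x r -> smooth_near x (fun y => Jf (u y) i).
Proof.
move=> rx; rewrite /Jf; case: fintype.split => j.
  exact: (smooth_nearN (smooth_ctan _ rx)).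
exact: (smooth_ctan _ rx).
Qed.

Lemma partial_Jf (a : 'rV[R]_(n + n) -> 'I_(n + n) -> R) x j i :
    (forall k, smooth_near x (fun y => a y k)) ->
  partial j (fun y => Jf (a y) i) x = Jf (fun k => partial j (fun y => a y k) x) i.
Proof.
move=> aS; rewrite /Jf; case: fintype.split => l //.
have := partialM j (smooth_near_cst x (-1)) (aS (rshift n l)).
rewrite [X in _ = X * _ + _](_ : _ = 0); last by rewrite /partial derive_cst.
rewrite mul0r add0r mulN1r => <-; congr (partial _ _ _).
by apply/funext => y; rewrite mulN1r.
Qed.

(** Differentiate the identity [dr (a) = 0]. *)
Lemma hess_of_tangent (a : 'rV[R]_(n + n) -> 'I_(n + n) -> R) j :
    (forall k, smooth_near q (fun y => a y k)) ->
    (forall x, dotf (gradf r x) (a x) = 0) ->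
  dotf (gradf r q) (fun k => partial j (fun y => a y k) q) =
  - \sum_k hessf r q j k * a q k.
Proof.
move=> aS a0; apply/eqP; rewrite -addr_eq0; apply/eqP.
have E : partial j (fun x => dotf (gradf r x) (a x)) q = 0.
  have -> : (fun x => dotf (gradf r x) (a x)) = cst 0 by apply/funext.
  by rewrite /partial derive_cst.
rewrite -[RHS]E /dotf -big_split /=.
have sumE : forall (s : seq 'I_(n + n)), partial j (fun x => \sum_(k <- s) gradf r x k * a x k) q =
    \sum_(k <- s) (gradf r q k * partial j (fun y => a y k) q + hessf r q j k * a q k).
  elim=> [|k s IH].
    rewrite big_nil (_ : (fun x => _) = cst 0); first by rewrite /partial derive_cst.
    by apply/funext => x; rewrite big_nil.
  rewrite big_cons -IH.
  have -> : (fun x => \sum_(k <- k :: s) gradf r x k * a x k) =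
      (fun x => gradf r x k * a x k + \sum_(k <- s) gradf r x k * a x k).
    by apply/funext => x; rewrite big_cons.
  have gaS l := smooth_nearM (smooth_grad l rS) (aS l).
  rewrite (partialD _ (gaS k) (smooth_near_sum _ (fun l _ => gaS l))).
  congr (_ + _); rewrite (partialM _ (smooth_grad k rS) (aS k)).
  by rewrite addrC.
by rewrite sumE.
Qed.

(** The commutator of the vector fields [u] and [J u] at [q], for [u] the
    projection of the constant field [v]. *)
Definition bracket_field : 'I_(n + n) -> R := fun k =>
  \sum_j (u q j * partial j (fun y => Jf (u y) k) q
         - Jf (u q) j * partial j (fun y => u y k) q).

Lemma dotf_bracket (p : 'I_(n + n) -> R) (b c : 'I_(n + n) -> R)
    (B D : 'I_(n + n) -> 'I_(n + n) -> R) :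
  dotf p (fun k => \sum_j (b j * B j k - c j * D j k)) =
  \sum_j b j * dotf p (B j) - \sum_j c j * dotf p (D j).
Proof.
rewrite /dotf; under eq_bigr do rewrite mulr_sumr; rewrite exchange_big /= -sumrB.
apply: eq_bigr => j _; rewrite !mulr_sumr -sumrB.
by apply: eq_bigr => k _; ring.
Qed.

(** Commutators of tangent fields are tangent: by [hess_of_tangent] the
    expression is the antisymmetrization of a Hessian. *)
Lemma bracket_tangent : dotf (gradf r q) bracket_field = 0.
Proof.
rewrite /bracket_field dotf_bracket.
under eq_bigr do rewrite (hess_of_tangent _ (fun k => smooth_Jctan k rS) (fun x => dotf_Jctan _ _)).
under [X in _ - X]eq_bigr do rewrite (hess_of_tangent _ (fun k => smooth_ctan k rS) (fun x => dotf_ctan _ _)).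
rewrite !(eq_bigr _ (fun i _ => mulrN _ _)) !sumrN opprK.
under eq_bigr do rewrite mulr_sumr.
under [X in _ + X]eq_bigr do rewrite mulr_sumr.
rewrite [X in _ + X]exchange_big /= addrC; apply/eqP; rewrite subr_eq0; apply/eqP.
apply: eq_bigr => j _; apply: eq_bigr => k _.
by rewrite /hessf (smooth_partialC _ _ rS); ring.
Qed.

(** By [hess_of_tangent] the derivatives of the fields [u] and [J u] are
    turned into second derivatives of [r]. *)
Lemma bracket_levi : dotf (gradf r q) (Jf bracket_field) = levi (gradf r q) (hessf r q) v.
Proof.
have -> : Jf bracket_field = fun k =>
    \sum_j (u q j * - partial j (fun y => u y k) q
           - Jf (u q) j * partial j (fun y => Jf (u y) k) q).
  apply/funext => k; transitivity (\sum_j (u q j * Jf (fun k => partial j (fun y => Jf (u y) k) q) k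
        - Jf (u q) j * Jf (fun k => partial j (fun y => u y k) q) k)).
    rewrite /bracket_field {1}/Jf; case: (split_ordP k) => l ->; rewrite -?sumrN; apply: eq_bigr => j _.
      by rewrite ![Jf (fun _ => _) _]/Jf (unsplitK (inl l)); ring.
    by rewrite ![Jf (fun _ => _) _]/Jf (unsplitK (inr l)); ring.
  apply: eq_bigr => j _; congr (_ * _ - _ * _).
    transitivity (Jf (Jf (fun k => partial j (fun y => u y k) q)) k); last exact: JfK.
    congr Jf; apply/funext => l.
    exact: (partial_Jf _ _ (fun i => smooth_ctan i rS)).
  exact/esym/(partial_Jf _ _ (fun i => smooth_ctan i rS)).
rewrite dotf_bracket /levi /quadf; congr (_ + _); rewrite -?sumrN.
  apply: eq_bigr => j _.
  have -> : dotf (gradf r q) (fun k => - partial j (fun y => u y k) q) =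
      - dotf (gradf r q) (fun k => partial j (fun y => u y k) q).
    by rewrite /dotf -sumrN; apply: eq_bigr => k _; rewrite mulrN.
  rewrite (hess_of_tangent _ (fun k => smooth_ctan k rS) (fun x => dotf_ctan _ _)) opprK mulr_sumr.
  by apply: eq_bigr => k _; rewrite mulrCA mulrA.
apply: eq_bigr => j _.
rewrite (hess_of_tangent _ (fun k => smooth_Jctan k rS) (fun x => dotf_Jctan _ _)).
rewrite mulrN opprK mulr_sumr.
by apply: eq_bigr => k _; rewrite mulrCA mulrA.
Qed.

Definition ctan_vf x : 'rV[C]_(n + n) := \row_i (u x i +i* - Jf (u x) i)%C.

(** In the bracket of [u - i J u] and [u + i J u] the two mixed terms are
    equal, and the others vanish. *)
Lemma vf_bracket_ctan :
  vf_bracket ctan_vf (vf_conj ctan_vf) q =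
  \row_k ((2 * 'i : C) * (bracket_field k)%:C).
Proof.
apply/rowP => k; rewrite !mxE /bracket_field raddf_sum mulr_sumr /=.
have uS i := smooth_ctan i rS; have JS i := smooth_Jctan i rS.
have NE j : partial j (fun y => - Jf (u y) k) q = - partial j (fun y => Jf (u y) k) q.
  have := partialM j (smooth_near_cst q (-1)) (JS k).
  rewrite [X in _ = X * _ + _](_ : _ = 0); last by rewrite /partial derive_cst.
  rewrite mul0r add0r mulN1r => <-; congr (partial _ _ _).
  by apply/funext => y; rewrite mulN1r.
apply: eq_bigr => j _; rewrite /cpartial.
have -> : @complex.Re R \o (fun y => ctan_vf y 0 k) = fun y => u y k.
  by apply/funext => y; rewrite /= mxE.
have -> : @complex.Im R \o (fun y => ctan_vf y 0 k) = fun y => - Jf (u y) k.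
  by apply/funext => y; rewrite /= mxE.
have -> : @complex.Re R \o (fun y => vf_conj ctan_vf y 0 k) = fun y => u y k.
  by apply/funext => y; rewrite /= !mxE.
have -> : @complex.Im R \o (fun y => vf_conj ctan_vf y 0 k) = fun y => Jf (u y) k.
  by apply/funext => y; rewrite /= !mxE /= opprK.
rewrite NE !mxE.
by apply/eqP; rewrite eq_complex /=; apply/andP; split; apply/eqP; ring.
Qed.

End Bracket.

(** On real tangent vectors a contact form is a multiple of [dr o J]
    ([thetaR_decomp]), so its value on the bracket of a (1, 0) field and its
    conjugate is a nonvanishing continuous function times the Levi form. That
    function has a constant sign near the origin, which [eps] records. *)
Lemma levi_sign S r : pseudoconvex S -> S 0 -> defining_function S 0 r ->
  exists2 eps : R, eps != 0 & \forall q \near (0 : 'rV[R]_(n + n)), S q ->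
    forall v, 0 <= eps * levi (gradf r q) (hessf r q) v.
Proof.
move=> psc S0 dr; have [theta [[[tR tI] tC] tIm tPos]] := psc 0 S0.
have [rS Sr _] := dr.
pose tau q := complex.Im (thetaR (theta q) (reeb q r)).
have tauE q : tau q = \sum_k complex.Im (theta q 0 k) * (- Jf (gradf r q) k).
  rewrite /tau thetaRE raddf_sum /=; apply: eq_bigr => k _; rewrite !mxE.
  by case: (theta q 0 k) => a b /=; ring.
have tauS : smooth_near 0 tau.
  have -> : tau = fun q => \sum_k complex.Im (theta q 0 k) * (- Jf (gradf r q) k).
    by apply/funext => q; apply: tauE.
  apply: smooth_near_sum => k _; apply: smooth_nearM.
    have := tI k; apply: smooth_near_eq.
    by apply: near_all => x; rewrite /= mxE.
  apply: smooth_nearN; rewrite /Jf; case: fintype.split => j; [apply: smooth_nearN|];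
    exact: smooth_grad.
have reebE q : defining_function S q r -> S q ->
    (forall v, tangent S q v -> complex.Re (thetaR (theta q) v) = 0) ->
    thetaR (theta q) (reeb q r) = 'i * (tau q)%:C.
  move=> dq Sq tq; have := tq _ (reeb_tangent dq Sq); rewrite /tau.
  case: (thetaR _ _) => a b /= ->.
  by apply/eqP; rewrite eq_complex /=; apply/andP; split; apply/eqP; ring.
have tau0 : tau 0 != 0.
  have [ex th0] := nbhs_singleton tC S0.
  have im0 := nbhs_singleton tIm S0.
  have := reeb_neq0 dr S0 th0 ex; rewrite (reebE 0 dr S0 im0).
  by apply: contra_neq => ->; rewrite mulr0.
(* the two factors [i], one from the bracket and one from the form being purely
   imaginary, multiply to [- 1] *)
exists (- tau 0); first by rewrite oppr_eq0.
have tauN : \forall q \near (0 : 'rV[R]_(n + n)), 0 < tau 0 * tau q.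
  have tt : 0 < tau 0 * tau 0 by rewrite -expr2 exprn_even_gt0.
  have := smooth_near_continuous (smooth_near_scale (tau 0) tauS).
  by move=> /cvgr_gt/(_ _ tt).
have ndr := defining_function_near dr.
have npsc : \forall q \near (0 : 'rV[R]_(n + n)), S q ->
    [/\ forall v w, H10 S q v -> H10 S q w -> form_app (theta q) (v + map_mx conjc w) = 0,
       forall v, tangent S q v -> complex.Re (thetaR (theta q) v) = 0 &
       forall L, section_H10_near S q L -> 0 <= form_app (theta q) (vf_bracket L (vf_conj L) q)].
  by apply: filterS3 tC tIm tPos => q q1 q2 q3 Sq; split;
    [have [] := q1 Sq|exact: q2|exact: q3].
have nndr : \forall q \near (0 : 'rV[R]_(n + n)), \forall x \near q, defining_function S x r.
  exact: near_join.
apply: filterS3 tauN nndr npsc => q tq ndq H Sq v.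
have dq := nbhs_singleton ndq; have [rq _ _] := dq.
have [th0 im pos] := H Sq; have {pos} := pos (ctan_vf r v).
rewrite (vf_bracket_ctan rq).
have -> : form_app (theta q) (\row_k ((2 * 'i : C) * (bracket_field r q v k)%:C)) =
    2 * 'i * thetaR (theta q) (\row_k bracket_field r q v k).
  rewrite thetaRE /form_app mulr_sumr; apply: eq_bigr => k _.
  by rewrite !mxE mulrCA.
rewrite (thetaR_decomp dq Sq th0); last first.
  have -> : (\row_k bracket_field r q v k) 0 = bracket_field r q v.
    by apply/funext => k; rewrite mxE.
  exact: bracket_tangent.
have -> : (\row_k bracket_field r q v k) 0 = bracket_field r q v.
  by apply/funext => k; rewrite mxE.
rewrite (bracket_levi rq) (reebE q dq Sq im).
have pp0 := gradf_gt0 dq; move: pp0.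
move: (levi _ _ _) (dotf _ _) => G pp pp0.
have -> : 2 * 'i * ((G / pp)%:C * ('i * (tau q)%:C)) = (- (2 * tau q * (G / pp)))%:C.
  by apply/eqP; rewrite eq_complex /=; apply/andP; split; apply/eqP; ring.
move=> pos.
have {}pos : 0 <= - (2 * tau q * (G / pp)).
  suff sec : section_H10_near S q (ctan_vf r v) by have := pos sec; rewrite lecR.
  split.
    split=> j.
      have := @smooth_ctan r v q j rq; apply: smooth_near_eq.
      by apply: near_all => x; rewrite /= !mxE.
    have := smooth_nearN (@smooth_Jctan r v q j rq); apply: smooth_near_eq.
    by apply: near_all => x; rewrite /= !mxE.
  apply: filterS ndq => x dx Sx; split; last first.
    apply/rowP => i; rewrite JmapE !mxE /Jf; case: (split_ordP i) => j ->.
      rewrite !mxE /Jf (unsplitK (inr j)).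
      by apply/eqP; rewrite eq_complex /=; apply/andP; split; apply/eqP; ring.
    rewrite !mxE /Jf (unsplitK (inl j)).
    by apply/eqP; rewrite eq_complex /=; apply/andP; split; apply/eqP; ring.
  split; apply/(tangent_dotf _ dx Sx).
    have -> : map_mx (@complex.Re R) (ctan_vf r v x) 0 = ctan (gradf r x) v.
      by apply/funext => i; rewrite !mxE.
    exact: dotf_ctan.
  have -> : map_mx (@complex.Im R) (ctan_vf r v x) 0 =
      fun i => (-1) * Jf (ctan (gradf r x) v) i + 0 * v i.
    by apply/funext => i; rewrite !mxE /= mulN1r mul0r addr0.
  by rewrite dotfD dotf_Jctan mulr0 mul0r addr0.
have -> : - tau 0 * G = - (2 * tau q * (G / pp)) * (pp * (tau 0 * tau q) / (2 * tau q ^+ 2)).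
  have tq0 : tau q != 0 by apply: contraTneq tq => ->; rewrite mulr0 ltxx.
  by field; rewrite tq0 gt_eqF.
have q2 : 0 <= 2 * tau q ^+ 2 by rewrite mulr_ge0 ?sqr_ge0.
exact: (mulr_ge0 pos (divr_ge0 (ltW (mulr_gt0 pp0 tq)) q2)).
Qed.

End LeviPositivity.

(** * Formal curves and smooth functions *)

Section Curves.
Context {R : realType}.
Implicit Types (u : 'rV[R]_1 -> R).

Lemma norm_const_mx (t : R) : 0 <= t -> `|const_mx t : 'rV[R]_1| = t.
Proof.
move=> t0; apply/eqP; rewrite eq_le; apply/andP; split.
  by apply: norm_rV_le => // i; rewrite mxE ger0_norm.
by have := norm_coord (const_mx t : 'rV[R]_1) 0; rewrite mxE ger0_norm.
Qed.

Lemma has_jet_monomial (a : R) k :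
  has_jet (fun x : 'rV[R]_1 => a * x 0 0 ^+ k) (a *: sX ^+ k).
Proof. exact: (has_jetZ a (has_jetX k (has_jet_coord 0))). Qed.

(** If the leading coefficient [a] were negative, the term [a t ^ k] would
    dominate both the remainder of the Taylor expansion and the admissible
    error, which are of order [k + 1]. *)
Lemma lead_sign u k C : smooth_near 0 u -> ord_ge k (taylor0 u) -> 0 <= C ->
    (\forall x \near (0 : 'rV[R]_1), - (C * `|x| ^+ k.+1) <= u x) ->
  0 <= cf k (taylor0 u).
Proof.
move=> u0 uk C0 upos; set a := cf k _; rewrite leNgt; apply/negP => a0.
have jv : has_jet (fun x => u x - a * x 0 0 ^+ k) (taylor0 u - a *: sX ^+ k).
  exact: (has_jetB (has_jet_taylor u0) (has_jet_monomial a k)).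
have [vS vE] := jv.
have vk : ord_ge k.+1 (taylor0 (fun x => u x - a * x 0 0 ^+ k)).
  rewrite vE; apply/ord_ge_cf => j; rewrite ltnS leq_eqVlt => /orP[/eqP ->|jk].
    by rewrite cfD cfN cfZ cf_sXn eqxx mulr1 subrr.
  rewrite cfD cfN cfZ cf_sXn (ltn_eqF jk) mulr0 subr0.
  by move/ord_ge_cf: uk; apply.
have [C' C'0 vle] := taylor_remainder vS vk.
have : \forall x \near (0 : 'rV[R]_1), - (C * `|x| ^+ k.+1) <= u x /\
    `|u x - a * x 0 0 ^+ k| <= C' * `|x| ^+ k.+1.
  exact: filterI upos vle.
move=> /nbhs_ballP[d /= d0 dP].
have CC : 0 < C + C' + 1 by rewrite ltr_wpDl // addr_ge0.
(* small enough for both estimates to hold at [t] and for their constants, times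
   [t], to be less than [- a] *)
pose t := Num.min (d / 2) (- a / (2 * (C + C' + 1))).
have t0 : 0 < t by rewrite lt_min !divr_gt0 ?mulr_gt0 ?oppr_gt0.
have td : t < d by rewrite gt_min; apply/orP; left; rewrite ltr_pdivrMr // ltr_pMr // ltr1n.
have ta : t * (C + C' + 1) < - a.
  apply: (@le_lt_trans _ _ (- a / 2)); last by rewrite ltr_pdivrMr // ltr_pMr ?ltr1n // oppr_gt0.
  have : t <= - a / (2 * (C + C' + 1)) by rewrite ge_min lexx orbT.
  rewrite ler_pdivlMr ?mulr_gt0 // => h; rewrite ler_pdivlMr //.
  by apply: le_trans h; rewrite [2 * _]mulrC mulrA.
have [] := dP (const_mx t).
  by rewrite -ball_normE /= sub0r normrN norm_const_mx // ltW.
have -> : (const_mx t : 'rV[R]_1) 0 0 = t by rewrite mxE.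
rewrite (norm_const_mx (ltW t0)) => h1.
rewrite ler_norml => /andP[_ h2].
have tk : 0 < t ^+ k by apply: exprn_gt0.
have : (C + C') * t + a < 0.
  by apply: le_lt_trans (_ : (C + C') * t + a <= t * (C + C' + 1) + a) _; [nra|lra].
rewrite ltNge => /negP; apply; rewrite -(pmulr_lge0 _ tk).
by move: h1 h2; rewrite exprS => h1 h2; nra.
Qed.

(** Converse of [taylor_remainder]: coefficients of degree less than [n]
    vanish, since [lead_sign] applies to [u] and to [- u]. *)
Lemma bound_ord_ge u n C : smooth_near 0 u -> 0 <= C ->
    (\forall x \near (0 : 'rV[R]_1), `|u x| <= C * `|x| ^+ n) ->
  ord_ge n (taylor0 u).
Proof.
move=> u0 C0 ub; have [Nu NE] := has_jetN (has_jet_taylor u0).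
have nx1 : \forall x \near (0 : 'rV[R]_1), `|x| <= 1.
  apply/nbhs_ballP; exists 1 => //= x; rewrite -ball_normE /= sub0r normrN.
  exact: ltW.
suff H k : (k <= n)%N -> ord_ge k (taylor0 u) by exact: H (leqnn n).
elim: k => [|k IH] kn; first exact: ord_ge0.
have uk := IH (ltnW kn).
have b : \forall x \near (0 : 'rV[R]_1), `|u x| <= C * `|x| ^+ k.+1.
  apply: filterS2 ub nx1 => x ux x1; apply: le_trans ux _; apply: ler_wpM2l => //.
  exact: ler_wiXn2l.
have c0 : cf k (taylor0 u) = 0.
  apply/eqP; rewrite eq_le; apply/andP; split.
    rewrite -oppr_ge0 -cfN -NE; apply: (@lead_sign _ _ C) => //.
      by rewrite NE; apply: ord_geN.
    by apply: filterS b => x; rewrite ler_norml lerN2 => /andP[].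
  apply: (@lead_sign _ _ C) => //.
  by apply: filterS b => x; rewrite ler_norml => /andP[].
apply/ord_ge_cf => j; rewrite ltnS leq_eqVlt => /orP[/eqP -> //|jk].
by move/ord_ge_cf: uk; apply.
Qed.

(** Truncation of a formal curve to a polynomial one, to which smooth
    functions can be restricted; contact to order at most [N] is not affected
    ([ord_ge_along]). *)
Definition poly_fun N (c : fps 1 R) (x : 'rV[R]_1) : R := \sum_(i < N) cf i c * x 0 0 ^+ i.
Definition poly_jet N (c : fps 1 R) : fps 1 R := \sum_(i < N) cf i c *: sX ^+ i.

Lemma has_jet_poly N c : has_jet (poly_fun N c) (poly_jet N c).
Proof. by apply: has_jet_sum => i _; apply: has_jet_monomial. Qed.

Lemma ord_ge_poly N c : ord_ge N (c - poly_jet N c).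
Proof. by apply/ord_ge_cf => j jN; rewrite cfD cfN (cf_poly N (fun i => cf i c)) jN subrr. Qed.

Definition poly_curve m N (c : 'I_m -> fps 1 R) (x : 'rV[R]_1) : 'rV[R]_m :=
  \row_j poly_fun N (c j) x.

Section PolyCurve.
Context {m : nat} (N : nat) (c : 'I_m -> fps 1 R).
Hypothesis c0 : forall j, fps_coef (c j) mi0 = 0.
Local Notation gam := (poly_curve N c).
Local Notation c' := (fun j => poly_jet N (c j)).

Lemma has_jet_curve j : has_jet (fun x => gam x 0 j) (c' j).
Proof.
apply: (has_jet_eq _ (erefl _) (has_jet_poly N (c j))).
by apply: near_all => x; rewrite mxE.
Qed.

Lemma poly_curve0 : gam 0 = 0.
Proof.
apply/rowP => j; rewrite !mxE /poly_fun big1 // => -[[|i] iN] _ /=.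
  by rewrite /cf (_ : mi_one 0 = mi0) ?c0 ?mul0r //; apply/ffunP => l; rewrite !ffunE.
by rewrite mxE expr0n mulr0.
Qed.

Lemma has_jet_along f F : has_jet f F -> has_jet (f \o gam) (fps_comp c' F).
Proof. by move=> fF; apply: has_jet_comp => // [|j]; [exact: poly_curve0|exact: has_jet_curve]. Qed.

Lemma ord_ge_along n F : (n <= N)%N -> ord_ge n (fps_comp c' F) <-> ord_ge n (fps_comp c F).
Proof.
move=> nN; have d : ord_ge n (fps_comp c F - fps_comp c' F).
  by apply: ord_ge_compB => j; exact: (ord_geW nN (@ord_ge_poly N (c j))).
split=> h; first by rewrite -[fps_comp c F](subrK (fps_comp c' F)); apply: ord_geD.
by rewrite -[fps_comp c' F](subKr (fps_comp c F)); apply: ord_geB.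
Qed.

Lemma near_along (P : 'rV[R]_m -> Prop) :
  (\forall x \near (0 : 'rV[R]_m), P x) -> \forall t \near (0 : 'rV[R]_1), P (gam t).
Proof.
have gS : smooth_map_near 0 gam by move=> j; have [] := has_jet_curve j.
have gc := smooth_map_continuous gS.
by rewrite -poly_curve0 => nP; exact: (gc P nP).
Qed.

End PolyCurve.

(** A function vanishing on [S] is bounded by a multiple of a defining
    function ([vanishing_le]). Along the truncated curve this bounds it by a
    multiple of [|t| ^ n], and bounds pass to the jets ([bound_ord_ge]). *)
Lemma jets_vanishing m (S : set 'rV[R]_m) r f (c : 'I_m -> fps 1 R) n :
    S 0 -> defining_function S 0 r -> (forall j, fps_coef (c j) mi0 = 0) ->
    smooth_near 0 f -> vanishes_on S 0 f ->
  ord_ge n (fps_comp c (taylor0 r)) -> ord_ge n (fps_comp c (taylor0 f)).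
Proof.
move=> S0 dr c0 f0 fS rn; have [r0 _ _] := dr.
have [C C0 fr] := vanishing_le dr S0 f0 fS.
have [rgS rgE] := has_jet_along n c0 (has_jet_taylor r0).
have [fgS fgE] := has_jet_along n c0 (has_jet_taylor f0).
apply/(ord_ge_along _ _ (leqnn n)); rewrite -fgE.
have [|C' C'0 rb] := taylor_remainder (n := n) rgS.
  by rewrite rgE; apply/(ord_ge_along _ _ (leqnn n)).
apply: (bound_ord_ge (C := C * C')) => //; first exact: mulr_ge0.
apply: filterS2 (near_along n c0 fr) rb => t ft rt; apply: le_trans ft _.
by rewrite -mulrA; apply: ler_wpM2l.
Qed.

End Curves.

Section FormalLevi.
Context {R : realType} {n : nat}.
Implicit Types (S : set 'rV[R]_(n + n)) (r : 'rV[R]_(n + n) -> R).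
Local Notation F := ('rV[R]_1 -> R).

(** Agreement up to a multiple of [rho]. The bound on [a] is included to make
    the relation stable under products ([closeM]). *)
Definition close (rho a b : F) : Prop := exists2 C, 0 <= C &
  \forall t \near (0 : 'rV[R]_1), `|a t| <= C /\ `|a t - b t| <= C * rho t.

Section Close.
Context (rho : F) (B : R).
Hypothesis B0 : 0 <= B.
Hypothesis rhoP : \forall t \near (0 : 'rV[R]_1), 0 <= rho t <= B.

Lemma close0 : close rho 0 0.
Proof. by exists 0 => //; apply: near_all => t; rewrite subrr normr0 mul0r. Qed.

Lemma closeD a a' b b' : close rho a a' -> close rho b b' -> close rho (a + b) (a' + b').
Proof.
move=> [C C0 aC] [D D0 bD]; exists (C + D); first exact: addr_ge0.
apply: filterS2 aC bD => t [a1 a2] [b1 b2]; split.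
  by apply: le_trans (ler_normD _ _) _; apply: lerD.
rewrite (_ : _ - _ = (a t - a' t) + (b t - b' t)); last first.
  by rewrite -[(a + b) t]/(a t + b t) -[(a' + b') t]/(a' t + b' t); ring.
by apply: le_trans (ler_normD _ _) _; rewrite mulrDl; apply: lerD.
Qed.

Lemma closeN a a' : close rho a a' -> close rho (- a) (- a').
Proof.
move=> [C C0 aC]; exists C => //; apply: filterS aC => t [a1 a2].
rewrite -[(- a) t]/(- a t) -[(- a') t]/(- a' t) normrN; split=> //.
by rewrite -opprD normrN.
Qed.

Lemma closeM a a' b b' : close rho a a' -> close rho b b' -> close rho (a * b) (a' * b').
Proof.
move=> [C C0 aC] [D D0 bD]; exists (C * D + C * (D + D * B)).
  by rewrite addr_ge0 ?mulr_ge0 ?addr_ge0 ?mulr_ge0.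
apply: filterS3 rhoP aC bD => t /andP[r0 rB] [a1 a2] [b1 b2].
rewrite -[(a * b) t]/(a t * b t) -[(a' * b') t]/(a' t * b' t) normrM.
have b'1 : `|b' t| <= D + D * B.
  rewrite -[b' t](subKr (b t)); apply: le_trans (ler_normB _ _) _; apply: lerD => //.
  by apply: le_trans b2 _; apply: ler_wpM2l.
split.
  by apply: (@le_trans _ _ (C * D)); [apply: ler_pM|rewrite lerDl mulr_ge0 ?addr_ge0 ?mulr_ge0].
rewrite (_ : _ - _ = a t * (b t - b' t) + (a t - a' t) * b' t); last by ring.
apply: le_trans (ler_normD _ _) _; rewrite !normrM.
apply: (@le_trans _ _ (C * (D * rho t) + C * rho t * (D + D * B))).
  by apply: lerD; apply: ler_pM.
by rewrite le_eqVlt; apply/orP; left; apply/eqP; ring.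
Qed.

End Close.

(** Near the truncated curve there are points of [S], at a distance controlled
    by [r] ([nearest_point]), where pseudoconvexity applies. Since [r] has
    order [k + 1] along the curve, replacing the curve by these points does
    not change the coefficient of degree [k] of the Levi form. *)
Lemma formal_levi S r : pseudoconvex S -> S 0 -> defining_function S 0 r ->
  exists2 eps : R, eps != 0 & forall (c v : 'I_(n + n) -> fps 1 R) k,
    (forall j, fps_coef (c j) mi0 = 0) -> ord_ge k.+1 (fps_comp c (taylor0 r)) ->
    let g := levi (fun i => fps_comp c (fps_deriv i (taylor0 r)))
      (fun i j => fps_comp c (fps_deriv i (fps_deriv j (taylor0 r)))) v in
    ord_ge k g -> 0 <= eps * cf k g.
Proof.
move=> psc S0 dr; have [eps eps0 pos] := levi_sign psc S0 dr; exists eps => // c v k c0 rk g gk.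
have [r0 _ _] := dr; have rr0 := defining_function0 dr S0.
pose N := k.+1; pose gam := poly_curve N c; pose w i := poly_fun N (v i).
pose hp i : F := gradf r ^~ i \o gam.
pose hH i j : F := (fun x => hessf r x i j) \o gam.
pose c' j := poly_jet N (c j).
pose g' := levi (fun i => fps_comp c' (fps_deriv i (taylor0 r)))
  (fun i j => fps_comp c' (fps_deriv i (fps_deriv j (taylor0 r)))) (fun i => poly_jet N (v i)).
have jp i : has_jet (gradf r ^~ i) (fps_deriv i (taylor0 r)).
  exact: has_jet_partial (has_jet_taylor r0).
have jH i j : has_jet (fun x => hessf r x i j) (fps_deriv i (fps_deriv j (taylor0 r))).
  exact: has_jet_partial (has_jet_partial j (has_jet_taylor r0)).
have jG : has_jet (levi hp hH w) g'.
  apply: (levi_rel (rel := @has_jet R 1)).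
  - have := @has_jet_cst R 1 0; rewrite scale0r; exact.
  - by move=> *; apply: has_jetD.
  - by move=> *; apply: has_jetM.
  - by move=> *; apply: has_jetN.
  - by move=> i; exact: has_jet_along.
  - by move=> i j; exact: has_jet_along.
  - by move=> i; exact: has_jet_poly.
have gg : ord_ge N (g - g').
  apply: (levi_rel (rel := fun a b : fps 1 R => ord_ge N (a - b))).
  - by rewrite subrr; exact: ord_ge_zero.
  - by move=> a a' b b' aa bb; rewrite opprD addrACA; exact: ord_geD.
  - move=> a a' b b' aa bb; rewrite (_ : _ - _ = a * (b - b') + (a - a') * b'); last by ring.
    by apply: ord_geD; [apply: ord_geMl|apply: ord_geMr].
  - by move=> a a' aa; rewrite -opprD; exact: ord_geN.
  - by move=> i; apply: ord_ge_compB => j; exact: ord_ge_poly.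
  - by move=> i l; apply: ord_ge_compB => j; exact: ord_ge_poly.
  - by move=> i; exact: ord_ge_poly.
have g'k : ord_ge k g'.
  by rewrite -[g'](subKr g); apply: ord_geB => //; exact: ord_geW (leqnSn k) gg.
have -> : cf k g = cf k g'.
  apply/eqP; rewrite -subr_eq0 -cfN -cfD; apply/eqP.
  by move/ord_ge_cf: gg; apply.
pose rho : F := fun t => `|r (gam t)|.
have [rgS rgE] := has_jet_along N c0 (has_jet_taylor r0).
have rgN : ord_ge N (taylor0 (r \o gam)) by rewrite rgE; apply/(ord_ge_along _ _ (leqnn N)).
have [D D0 rD] := taylor_remainder rgS rgN.
have [B B0 rB] := taylor_remainder rgS (@ord_ge0 _ _ _).
have rhoB : \forall t \near (0 : 'rV[R]_1), 0 <= rho t <= B.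
  by apply: filterS rB => t; rewrite expr0 mulr1 /rho normr_ge0.
pose h (s : option ('I_(n + n)) * 'I_(n + n)) (x : 'rV[R]_(n + n)) : R :=
  if s.1 is Some i then hessf r x i s.2 else gradf r x s.2.
have hS s : smooth_near 0 (h s).
  by case: s => -[i|] j; [have [] := jH i j|have [] := jp j].
have [C C0 near_pt] := nearest_point dr rr0 hS.
have := near_along N c0 (near_pt _ pos).
set Q := fun t : 'rV[R]_1 => _ => nQ.
have /choice[y yP] : forall t, exists y, Q t -> [/\ S y -> forall v, 0 <= eps * levi (gradf r y) (hessf r y) v,
    S y & forall s, `|h s y - h s (gam t)| <= C * rho t].
  move=> t; have [[y [y1 y2 y3]]|nq] := pselect (Q t); first by exists y.
  by exists 0.
have hcl s : close rho (h s \o gam) (h s \o y).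
  have [hgS _] := has_jet_along N c0 (has_jet_taylor (hS s)).
  have [E E0 hE] := taylor_remainder hgS (@ord_ge0 _ _ _).
  exists (C + E); first exact: addr_ge0.
  apply: filterS3 hE nQ rhoB => t; rewrite expr0 mulr1 => t1 /yP[_ _ /(_ s) t2] /andP[t3 _].
  split; first by apply: le_trans t1 _; rewrite lerDr.
  by rewrite distrC; apply: le_trans t2 _; apply: ler_wpM2r => //; rewrite lerDl.
have wcl i : close rho (w i) (w i).
  have [E E0 wE] := taylor_remainder (proj1 (has_jet_poly N (v i))) (@ord_ge0 _ _ _).
  exists E => //; apply: filterS2 wE rhoB => t; rewrite expr0 mulr1 => t1 /andP[t3 _].
  by split=> //; rewrite subrr normr0 mulr_ge0.
have [E E0 GE] : close rho (levi hp hH w)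
    (levi (fun i => h (None, i) \o y) (fun i j => h (Some i, j) \o y) w).
  apply: levi_rel; [exact: close0|exact: closeD|exact: (closeM B0 rhoB)|exact: closeN| | |] => //.
  - by move=> i; exact: (hcl (None, i)).
  - by move=> i j; exact: (hcl (Some i, j)).
have evE (p : 'I_(n + n) -> F) H u t : levi p H u t = levi (p ^~ t) (fun i j => H i j t) (u ^~ t).
  apply: (levi_rel (rel := fun (a : F) (b : R) => a t = b)) => //.
  - by move=> a a' b b' <- <-.
  - by move=> a a' b b' <- <-.
  - by move=> a a' <-.
have [eGS eGE] := has_jetZ eps jG.
rewrite -cfZ -eGE; apply: (@lead_sign _ _ _ (`|eps| * (E * D))).
- exact: eGS.
- by rewrite eGE; exact: ord_geZ.
- by rewrite !mulr_ge0.
apply: filterS3 GE nQ rD => t [_ t1] /yP[t2 /t2 t3 _] t4.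
have := t3 (w ^~ t); set a := levi _ _ _ => ea.
have {}t1 : `|levi hp hH w t - a| <= E * (D * `|t| ^+ N).
  have <- : levi (fun i => h (None, i) \o y) (fun i j => h (Some i, j) \o y) w t = a by rewrite evE.
  by apply: le_trans t1 _; apply: ler_wpM2l.
rewrite -[levi hp hH w t](subrK a) mulrDr -[X in X <= _]addr0; apply: lerD => //.
rewrite -lerN2 opprK; apply: le_trans (ler_norm _) _.
by rewrite normrN normrM -!mulrA; apply: ler_wpM2l.
Qed.

(** On [S] the bundle [HS] is the common kernel of [dr] and [dr o J]. *)
Lemma jet_HS_app S r (L : formal_vf (n + n) R) : S 0 -> defining_function S 0 r ->
  jet_HS S L -> jet_ideal S (fvf_app L (taylor0 r)) /\ jet_ideal S (fvf_app (Jmap L) (taylor0 r)).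
Proof.
move=> S0 dr [M [MS MH] <-]; have [r0 _ _] := dr; have ndr := defining_function_near dr.
have gS i : smooth_near 0 (gradf r ^~ i) := smooth_near_partial i r0.
have JM i : smooth_near 0 (fun x => Jf (M x 0) i).
  by rewrite /Jf; case: fintype.split => j; [exact: (smooth_nearN (MS _))|exact: MS].
split.
  exists (fun x => dotf (gradf r x) (M x 0)).
    split; first exact: (smooth_near_sum _ (fun i _ => smooth_nearM (gS i) (MS i))).
    by apply: filterS2 MH ndr => x Mx dx Sx; have [/(tangent_dotf _ dx Sx)] := Mx Sx.
  have [_ ->] := has_jet_sum (index_enum _) (fun i (_ : true) => has_jetM
    (has_jet_partial i (has_jet_taylor r0)) (has_jet_taylor (MS i))).
  by apply: eq_bigr => i _; rewrite mxE mulrC.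
exists (fun x => dotf (gradf r x) (Jf (M x 0))).
  split; first exact: (smooth_near_sum _ (fun i _ => smooth_nearM (gS i) (JM i))).
  apply: filterS2 MH ndr => x Mx dx Sx; have [_ /(tangent_dotf _ dx Sx)] := Mx Sx.
  by have -> : Jmap (M x) 0 = Jf (M x 0) by apply/funext => i; rewrite JmapE.
have [_ ->] := has_jet_sum (index_enum _) (fun i (_ : true) => has_jetM
  (has_jet_partial i (has_jet_taylor r0)) (has_jet_taylor (JM i))).
apply: eq_bigr => i _; rewrite mulrC JmapE; congr (_ * _).
rewrite /Jf; case: fintype.split => j; rewrite mxE //.
by have [_ ->] := has_jetN (has_jet_taylor (MS (rshift n j))).
Qed.

End FormalLevi.

(** * Functions of odd order on a formal submanifold *)

Section OddOrder.
Context {K : realFieldType} {m q k : nat} {J : finType}.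
Context (Phi : 'I_q -> fps m K) (Psi : 'I_m -> fps q K) (e : J -> 'I_q).
Hypothesis Phi0 : forall i, fps_coef (Phi i) mi0 = 0.
Hypothesis Psi0 : forall i, fps_coef (Psi i) mi0 = 0.
Hypothesis PhiPsi : forall f, fps_comp Phi (fps_comp Psi f) = f.
Hypothesis PsiPhi : forall f, fps_comp Psi (fps_comp Phi f) = f.
Context (I : set (fps m K)) (Im : manifold_ideal k I).

(** The coordinate vector fields of the chart [Phi], acting on functions in
    the original coordinates. *)
Definition chart_deriv (j : J) (f : fps m K) : fps m K :=
  fps_comp Phi (fps_deriv (e j) (fps_comp Psi f)).
Local Notation delta := chart_deriv.

Lemma chart_derivD j u v : delta j (u + v) = delta j u + delta j v.
Proof. by rewrite /delta fps_compD raddfD /= fps_compD. Qed.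

Lemma chart_derivC i j u : delta i (delta j u) = delta j (delta i u).
Proof. by rewrite /delta !PsiPhi fps_derivC. Qed.

Lemma is_ideal_manifold : is_ideal I.
Proof. by case: Im => F [_ _ ->]; exact: smallest_ideal. Qed.

Lemma dirN_chart t f l : iter l (dirN delta t) f =
  fps_comp Phi (iter l (dirN (fun j => fps_deriv (e j)) t) (fps_comp Psi f)).
Proof.
elim: l => [|l IH] /=; first by rewrite PhiPsi.
rewrite IH /dirN fps_comp_sum; apply: eq_bigr => j _.
by rewrite /delta PsiPhi fps_compMn.
Qed.

Lemma Iord_dirN t n f l : (l < n)%N -> Iord delta I n f -> I (iter l (dirN delta t) f).
Proof.
elim: n f l => [|n IH] f [|l] //; first by move=> _ [].
rewrite ltnS iterSr => ln fn; apply: IH => //; rewrite /dirN.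
have II := is_ideal_manifold.
apply: (Iord_sum chart_derivD II) => j _; elim: (t j) => [|i IHi].
  by rewrite mulr0n; exact: (Iord0 chart_derivD II).
by rewrite mulrS; apply: (IordD chart_derivD II) => //; apply: Iord_deriv.
Qed.

(** Otherwise some derivative of [G] of order [l] is not in the ideal, so it
    is nonzero along some formal curve of the submanifold. Displace this curve
    by [b s ^ M] along the chart, with [M] large. By [taylor_curve] the
    leading coefficient of [G] on it is that of the [l]-th derivative of [G]
    along [b], up to a positive factor. As [l] is odd it changes sign with
    [b], while [r] vanishes to higher order, so that the positivity assumption
    is contradicted. *)
Lemma odd_order (r G : fps m K) (eps : K) l : odd l -> eps != 0 ->
    Iord delta I l G -> Iord delta I l.+1 r ->
    (forall (c : 'I_m -> fps 1 K) n, (forall j, fps_coef (c j) mi0 = 0) ->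
       ord_ge n.+1 (fps_comp c r) -> ord_ge n (fps_comp c G) ->
       0 <= eps * cf n (fps_comp c G)) ->
  Iord delta I l.+1 G.
Proof.
move=> lodd eps0 Gl rl pos; apply: contrapT => GN.
have [s [sl sG]] : exists s, size s = l /\ ~ I (foldr delta G s).
  apply: contrapT => H; apply: GN; apply/Iord_foldr => s; rewrite ltnS leq_eqVlt.
  case/orP => [/eqP sl|sl]; last by move/Iord_foldr: Gl; apply.
  by apply: contrapT => sG; apply: H; exists s.
have [c [c0 cI cG]] := curve_detects Im sG.
(* the lowest degree in which the [l]-th power of some directional derivative is
   nonzero along [c]; one exists by polarization *)
have [n [[t tn] nmin]] : exists n, (exists t, cf n (fps_comp c (iter l (dirN delta t) G)) != 0) /\
    forall j t, (j < n)%N -> cf j (fps_comp c (iter l (dirN delta t) G)) = 0.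
  have ex : exists n, `[< exists t, cf n (fps_comp c (iter l (dirN delta t) G)) != 0 >].
    apply: contrapT => H; move/eqP: cG; apply; apply: fps1_eq0 => n.
    apply: (@polarization _ K _ delta _ _ (fun u => cf n (fps_comp c u)) l) => //.
    - exact: chart_derivD.
    - exact: chart_derivC.
    - by move=> u v; rewrite fps_compD cfD.
    move=> t; apply/eqP/negPn/negP => tn; apply: H; exists n; apply/asboolP.
    by exists t.
  exists (ex_minn ex); case: ex_minnP => n /asboolP en nmin; split=> // j t jn.
  apply/eqP/negPn/negP => tn; have : (n <= j)%N by apply: nmin; apply/asboolP; exists t.
  by rewrite leqNgt jn.
(* [M > n] makes the contact [M * l.+1] of [r] with the displaced curve exceed the
   order [M * l + n] of [G] on it *)
set a := cf n _ in tn; pose M := n.+1.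
pose om i := fps_comp c (Phi i).
pose b (sg : bool) i : K := (-1) ^+ sg * spread e t i.
pose cc sg i := fps_comp (fun i => om i + b sg i *: sX ^+ M) (Psi i).
have om0 i : fps_coef (om i) mi0 = 0 by rewrite fps_comp_coef0.
have ccE sg f : fps_comp (cc sg) f = fps_comp (fun i => om i + b sg i *: sX ^+ M) (fps_comp Psi f).
  by rewrite fps_comp_comp.
have iterE (sg : bool) f j : iter j (dirD (b sg)) f =
    ((-1) ^+ sg) ^+ j *: iter j (dirN (fun j => fps_deriv (e j)) t) f.
  elim: j => [|j IH] /=; first by rewrite expr0 scale1r.
  rewrite IH dirDZ -dirD_spread /dirD exprSr -scalerA; congr (_ *: _).
  by rewrite scaler_sumr; apply: eq_bigr => i _; rewrite scalerA.
have term (sg : bool) f j : fps_comp om (iter j (dirD (b sg)) (fps_comp Psi f)) =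
    ((-1) ^+ sg) ^+ j *: fps_comp c (iter j (dirN delta t) f).
  by rewrite iterE fps_compZ dirN_chart [in RHS]fps_comp_comp.
have contact sg f : Iord delta I l.+1 f -> ord_ge (M * l.+1) (fps_comp (cc sg) f).
  move=> fl; have := @taylor_curve _ K om (b sg) M l.+1 (fps_comp Psi f) isT om0.
  rewrite -ccE /taylor_sum big1 ?subr0 // => j _.
  by rewrite term cI ?scaler0 ?mulr0 ?scaler0 //; apply: Iord_dirN fl.
have lead (sg : bool) : ord_ge (M * l + n) (fps_comp (cc sg) G) /\
    cf (M * l + n) (fps_comp (cc sg) G) = l`!%:R^-1 * (((-1) ^+ sg) ^+ l * a).
  have := @taylor_curve _ K om (b sg) M l.+1 (fps_comp Psi G) isT om0.
  rewrite -ccE /taylor_sum big_ord_recr /= big1 => [|j _]; last first.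
    by rewrite term cI ?scaler0 ?mulr0 ?scaler0 //; apply: Iord_dirN Gl.
  rewrite add0r term => /ord_ge_cf H.
  have {}H j : (j < M * l.+1)%N -> cf j (fps_comp (cc sg) G) = cf j (l`!%:R^-1 *:
      (sX ^+ (M * l) * (((-1) ^+ sg) ^+ l *: fps_comp c (iter l (dirN delta t) G)))).
    by move=> /H; rewrite cfD cfN => /eqP; rewrite subr_eq0 => /eqP.
  have nM : (M * l + n < M * l.+1)%N by rewrite mulnS addnC ltn_add2r.
  split; last by rewrite H // cfZ cf_sXM cfZ.
  apply/ord_ge_cf => j jn; rewrite H; last exact: ltn_trans jn nM.
  rewrite cfZ; have [jM|jM] := ltnP j (M * l).
    have : ord_ge (M * l) (sX ^+ (M * l) *
        (((-1) ^+ sg) ^+ l *: fps_comp c (iter l (dirN delta t) G))).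
      by apply: ord_geMr; exact: ord_ge_sX.
    by move/ord_ge_cf => ->; rewrite ?mulr0.
  rewrite -(subnKC jM) cf_sXM cfZ nmin ?mulr0 //.
  by rewrite -(ltn_add2l (M * l)) subnKC.
have posl (sg : bool) : 0 <= eps * (((-1) ^+ sg) ^+ l * a).
  have [l1 l2] := lead sg.
  have := pos (cc sg) (M * l + n)%N _ _ l1; rewrite l2.
  rewrite mulrCA pmulr_rge0 ?invr_gt0 ?ltr0n ?fact_gt0 //; apply.
    by move=> j; rewrite /cc fps_comp_coef0.
  have nM : (M * l + n < M * l.+1)%N by rewrite mulnS addnC ltn_add2r.
  exact: ord_geW nM (contact sg r rl).
have := posl false; have := posl true.
rewrite !expr0 expr1 expr1n mul1r -signr_odd lodd expr1 mulN1r mulrN oppr_ge0.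
move=> h1 h2; have : eps * a == 0 by rewrite eq_le h1 h2.
by rewrite mulf_eq0 (negbTE eps0) (negbTE tn).
Qed.

End OddOrder.

(** * Formal vector fields and holomorphic charts *)

Section FieldApp.
Context {m : nat} {K : fieldType}.
Implicit Types (L M : formal_vf m K) (f g : fps m K).

Lemma fvf_appD L f g : fvf_app L (f + g) = fvf_app L f + fvf_app L g.
Proof.
by rewrite /fvf_app -big_split; apply: eq_bigr => i _; rewrite raddfD mulrDr.
Qed.

Lemma fvf_app0 L : fvf_app L 0 = 0.
Proof. by rewrite /fvf_app big1 // => i _; rewrite raddf0 mulr0. Qed.

Lemma fvf_app_sum L (T : Type) (s : seq T) (P : pred T) (F : T -> fps m K) :
  fvf_app L (\sum_(i <- s | P i) F i) = \sum_(i <- s | P i) fvf_app L (F i).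
Proof.
by apply: (big_morph (fvf_app L)) => [f g|]; [exact: fvf_appD|exact: fvf_app0].
Qed.

Lemma fvf_appZ L (c : K) f : fvf_app L (c *: f) = c *: fvf_app L f.
Proof.
by rewrite /fvf_app scaler_sumr; apply: eq_bigr => i _; rewrite fps_derivZ fps_scaleAr.
Qed.

Lemma fvf_appB L f g : fvf_app L (f - g) = fvf_app L f - fvf_app L g.
Proof. by rewrite fvf_appD -scaleN1r fvf_appZ scaleN1r. Qed.

Lemma fvf_appM L f g : fvf_app L (f * g) = fvf_app L f * g + f * fvf_app L g.
Proof.
rewrite /fvf_app mulr_suml mulr_sumr -big_split; apply: eq_bigr => i _ /=.
by rewrite fps_derivM; ring.
Qed.

Lemma fvf_appX L i : fvf_app L (fpsX i) = L 0 i.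
Proof.
rewrite /fvf_app (bigD1 i) //= fps_derivX eqxx mulr1 big1 ?addr0 // => j ji.
by rewrite fps_derivX (negbTE ji) mulr0.
Qed.

Lemma fvf_app_comp p (G : 'I_p -> fps m K) L (f : fps p K) :
  fvf_app L (fps_comp G f) = \sum_j fvf_app L (G j) * fps_comp G (fps_deriv j f).
Proof.
rewrite /fvf_app; under eq_bigr do rewrite fps_deriv_comp mulr_sumr.
rewrite exchange_big /=; apply: eq_bigr => j _; rewrite mulr_suml.
by apply: eq_bigr => i _; rewrite mulrA.
Qed.

Lemma fvf_appDl L M f : fvf_app (L + M) f = fvf_app L f + fvf_app M f.
Proof.
by rewrite /fvf_app -big_split; apply: eq_bigr => i _; rewrite mxE mulrDl.
Qed.

Lemma fvf_appZl g L f : fvf_app (g *: L) f = g * fvf_app L f.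
Proof.
by rewrite /fvf_app mulr_sumr; apply: eq_bigr => i _; rewrite mxE mulrA.
Qed.

Lemma fvf_app_bracket L M f :
  fvf_app (fvf_bracket L M) f = fvf_app L (fvf_app M f) - fvf_app M (fvf_app L f).
Proof.
have E L' M' : fvf_app L' (fvf_app M' f) = \sum_k fvf_app L' (M' 0 k) * fps_deriv k f +
    \sum_k \sum_i L' 0 i * M' 0 k * fps_deriv i (fps_deriv k f).
  rewrite [fvf_app M' f]/fvf_app fvf_app_sum -big_split; apply: eq_bigr => k _ /=.
  rewrite fvf_appM; congr (_ + _); rewrite /fvf_app mulr_sumr; apply: eq_bigr => i _.
  by rewrite mulrA [M' 0 k * _]mulrC.
rewrite !E [X in _ = _ + X - _]exchange_big /= opprD addrACA [in RHS]addrC.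
have -> : forall a b : fps m K, a = b -> a - b = 0 by move=> a b ->; rewrite subrr.
  by rewrite add0r -sumrB; apply: eq_bigr => k _; rewrite mxE -mulrBl.
apply: eq_bigr => k _; apply: eq_bigr => i _.
by rewrite fps_derivC [L 0 k * _]mulrC.
Qed.

End FieldApp.

Section WirtingerAlgebra.
Context {A : comNzRingType} {h i : A} (h2 : h *+ 2 = 1) (i2 : i * i = -1).

Lemma wirt_x a b : a = h * (a - i * b) + h * (a + i * b).
Proof. by rewrite -{1}[a]mul1r -h2; ring. Qed.

Lemma wirt_y a b : b = i * (h * (a - i * b) - h * (a + i * b)).
Proof.
transitivity (- (i * i) * (h *+ 2) * b); first by rewrite i2 h2 opprK !mul1r.
by ring.
Qed.

Lemma wirt_sum x y p q : x * (p + q) + y * (i * (p - q)) = (x + i * y) * p + (x - i * y) * q.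
Proof. by ring. Qed.

Lemma wirt_holo0 a : h * (a + i * (i * a)) = 0.
Proof. by rewrite mulrA i2 mulN1r subrr mulr0. Qed.

End WirtingerAlgebra.

Section Wirtinger.
Context {R : realType}.
Local Notation C := R[i].

Definition dz n (l : 'I_n) (f : fps (n + n) C) : fps (n + n) C :=
  (2^-1 : C) *: (fps_deriv (lshift n l) f - 'i *: fps_deriv (rshift n l) f).
Definition dzb n (l : 'I_n) (f : fps (n + n) C) : fps (n + n) C :=
  (2^-1 : C) *: (fps_deriv (lshift n l) f + 'i *: fps_deriv (rshift n l) f).

Context {n : nat}.
Implicit Types (l : 'I_n) (f g : fps (n + n) C) (L M : formal_vf (n + n) C).

Definition fcst (c : C) : fps (n + n) C := c%:A.

Lemma fcstE (c : C) f : c *: f = fcst c * f.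
Proof. by rewrite mulr_algl. Qed.

Lemma constP : (fcst 'i * fcst 'i = -1) * (fcst 2^-1 *+ 2 = 1).
Proof.
split; first by rewrite -fcstE scalerA -expr2 sqr_i scaleN1r.
by rewrite /fcst scalerMnl -mulr_natr mulVf ?pnatr_eq0 // scale1r.
Qed.

Lemma dz_x l f : fps_deriv (lshift n l) f = dz l f + dzb l f.
Proof.
by have [i2 h2] := constP; rewrite /dz /dzb !fcstE; exact: wirt_x. Qed.

Lemma dz_y l f : fps_deriv (rshift n l) f = 'i *: (dz l f - dzb l f).
Proof. by have [i2 h2] := constP; rewrite /dz /dzb !fcstE; exact: wirt_y. Qed.

Lemma dzb_holo l (h : fps n C) : dzb l (fps_holo h) = 0.
Proof.
have [i2 h2] := constP; rewrite /dzb holo_deriv_l holo_deriv_r !fcstE.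
exact: wirt_holo0.
Qed.

Lemma conjc_half : conjc (2^-1 : C) = 2^-1.
Proof. by apply/eqP; rewrite eq_complex /=; apply/andP; split; apply/eqP; field. Qed.

Lemma dz_cj l f : dz l (cj f) = cj (dzb l f).
Proof. by rewrite cjZ cjD cjZ conjc_i conjc_half !cj_deriv scaleNr. Qed.

Lemma dzb_cj l f : dzb l (cj f) = cj (dz l f).
Proof. by rewrite -[in RHS](cjK f) dz_cj cjK. Qed.

Lemma dz_deriv l i f : dz l (fps_deriv i f) = fps_deriv i (dz l f).
Proof. by rewrite fps_derivZ fps_derivB fps_derivZ !(fps_derivC i). Qed.

Lemma dzD l f g : dz l (f + g) = dz l f + dz l g.
Proof. by rewrite /dz [fps_deriv (lshift n l) _]raddfD [fps_deriv (rshift n l) _]raddfD !fcstE /=; ring. Qed.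

Lemma dzZ l c f : dz l (c *: f) = c *: dz l f.
Proof. by rewrite /dz !fps_derivZ scalerA mulrC -scalerA -scalerBr scalerA mulrC -scalerA. Qed.

Lemma dzC l l' f : dz l (dz l' f) = dz l' (dz l f).
Proof. by rewrite {2}/dz dzZ dzD -scaleNr dzZ !dz_deriv scaleNr. Qed.

Lemma dz_dzbC l l' f : dz l (dzb l' f) = dzb l' (dz l f).
Proof. by rewrite {1}/dzb dzZ dzD dzZ !dz_deriv. Qed.

(** Chain rule in the coordinates [z, zbar], which separates the (1, 0) and
    (0, 1) parts of [L]. *)
Lemma fvf_app_z L f : fvf_app L f =
  \sum_l (fvf_app L (zX l) * dz l f + fvf_app L (cj (zX l)) * dzb l f).
Proof.
rewrite {1}/fvf_app big_split_ord /= -big_split; apply: eq_bigr => l _ /=.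
have cjX i : cj (fpsX i : fps (n + n) C) = fpsX i by rewrite /cj fps_mapX.
rewrite /zX cjD cjZ !cjX conjc_i !fvf_appD !fvf_appZ !fvf_appX dz_x dz_y.
by rewrite scaleNr !fcstE; exact: wirt_sum.
Qed.

Lemma fvf_app_cj L f : cj (fvf_app L f) = fvf_app (map_mx (fps_map conjc) L) (cj f).
Proof. by rewrite cj_sum; apply: eq_bigr => i _; rewrite cjM cj_deriv mxE. Qed.

End Wirtinger.

Lemma dz_field_l (R : realType) n (a : 'rV[fps (n + n) R[i]]_n) l :
  dz_field a 0 (lshift n l) = fcst 2^-1 * a 0 l.
Proof. by rewrite /dz_field row_mxEl mxE. Qed.
Lemma dz_field_r (R : realType) n (a : 'rV[fps (n + n) R[i]]_n) l :
  dz_field a 0 (rshift n l) = fcst (- 'i / 2) * a 0 l.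
Proof. by rewrite /dz_field row_mxEr mxE. Qed.
Lemma fvf_app_dz_field (R : realType) n (a : 'rV[fps (n + n) R[i]]_n) f : fvf_app (dz_field a) f = \sum_l a 0 l * dz l f.
Proof.
rewrite /fvf_app big_split_ord /= -big_split; apply: eq_bigr => l _ /=.
rewrite dz_field_l dz_field_r /dz.
have -> : fcst (- 'i / 2) = - (fcst 'i * fcst 2^-1) :> fps (n + n) R[i].
  by rewrite /fcst mulr_algl scalerA mulNr scaleNr.
rewrite !fcstE.
move: (fcst _) (fcst _) (a 0 l) (fps_deriv _ _) (fps_deriv _ _) => x y z t u.
by ring.
Qed.

(** ** The frame of a holomorphic chart *)

Section Frame.
Context {R : realType} {n k d : nat}.
Local Notation C := R[i].
Local Notation A := (fps (n + n) C).
Context (Phi : 'I_(k + d) -> fps n C) (Psi : 'I_n -> fps (k + d) C).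
Hypothesis Phi0 : forall i, fps_coef (Phi i) mi0 = 0.
Hypothesis Psi0 : forall i, fps_coef (Psi i) mi0 = 0.
Hypothesis PhiPsi : forall f, fps_comp Phi (fps_comp Psi f) = f.
Hypothesis PsiPhi : forall f, fps_comp Psi (fps_comp Phi f) = f.
Implicit Types (f g : A) (L M : formal_vf (n + n) C) (j : 'I_(k + d)) (l : 'I_n).

Lemma sharp_PhiPsi f : sharp Phi (sharp Psi f) = f.
Proof.
rewrite sharp_sharp //; apply: sharp_id => l.
by rewrite -[Psi l]fps_compX // PhiPsi.
Qed.

Lemma sharp_PsiPhi (f : fps ((k + d) + (k + d)) C) : sharp Psi (sharp Phi f) = f.
Proof.
rewrite sharp_sharp //; apply: sharp_id => l.
by rewrite -[Phi l]fps_compX // PsiPhi.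
Qed.

Definition wX j : A := fps_holo (Phi j).

(** The coordinate field [d / d w_j] of the holomorphic chart [Phi]. *)
Definition dw j f : A := sharp Phi (dz j (sharp Psi f)).
Definition dwb j f : A := sharp Phi (dzb j (sharp Psi f)).
Definition chart_vf (i : 'I_((k + d) + (k + d))) : formal_vf (n + n) C :=
  \row_l sharp Phi (fps_deriv i (sharp_coord Psi l)).
Definition dw_vf j : formal_vf (n + n) C :=
  (2^-1)%:A *: (chart_vf (lshift (k + d) j) - 'i%:A *: chart_vf (rshift (k + d) j)).

Lemma chart_vfE i f : fvf_app (chart_vf i) f = sharp Phi (fps_deriv i (sharp Psi f)).
Proof.
rewrite /sharp fps_deriv_comp fps_comp_sum; apply: eq_bigr => l _.
by rewrite mxE fps_compM -!/(sharp _ _) sharp_PhiPsi.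
Qed.

Lemma dw_vfE j f : fvf_app (dw_vf j) f = dw j f.
Proof.
rewrite fvf_appZl -scaleN1r fvf_appDl !fvf_appZl !chart_vfE mulN1r.
by rewrite /dw /sharp /dz fps_compZ fps_compB fps_compZ !mulr_algl.
Qed.

Lemma dwD j f g : dw j (f + g) = dw j f + dw j g.
Proof. by rewrite -!dw_vfE fvf_appD. Qed.

Lemma dwM j f g : dw j (f * g) = dw j f * g + f * dw j g.
Proof. by rewrite -!dw_vfE fvf_appM. Qed.

Lemma dw_cj j f : cj (dw j f) = dwb j (cj f).
Proof. by rewrite /dw /dwb sharp_cj dzb_cj sharp_cj. Qed.

Lemma dwb_cj j f : cj (dwb j f) = dw j (cj f).
Proof. by rewrite -[in RHS](cjK f) -[RHS]cjK dw_cj !cjK. Qed.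

Lemma dwbE j f : dwb j f = cj (dw j (cj f)).
Proof. by rewrite dw_cj cjK. Qed.

Lemma dwbD j f g : dwb j (f + g) = dwb j f + dwb j g.
Proof. by rewrite !dwbE cjD dwD cjD. Qed.

Lemma dwbM j f g : dwb j (f * g) = dwb j f * g + f * dwb j g.
Proof. by rewrite !dwbE cjM dwM cjD !cjM !cjK. Qed.

Lemma dwC i j f : dw i (dw j f) = dw j (dw i f).
Proof. by rewrite /dw !sharp_PsiPhi dzC. Qed.

Lemma dw_dwbC i j f : dw i (dwb j f) = dwb j (dw i f).
Proof. by rewrite /dw /dwb !sharp_PsiPhi dz_dzbC. Qed.

Lemma dwb_z j l : dwb j (zX l) = 0.
Proof. by rewrite /dwb -holoX sharp_holo // dzb_holo /sharp raddf0. Qed.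

Lemma dw_zb j l : dw j (cj (zX l)) = 0.
Proof. by rewrite -dwb_cj dwb_z; exact: raddf0. Qed.

(** Chain rule in the coordinates [w, wbar] of the chart. *)
Lemma fvf_app_w L f : fvf_app L f =
  \sum_j (fvf_app L (wX j) * dw j f + fvf_app L (cj (wX j)) * dwb j f).
Proof.
rewrite -{1}[f]sharp_PhiPsi {1}/sharp fvf_app_comp big_split_ord /= -big_split.
apply: eq_bigr => j _ /=; rewrite -!/(sharp _ _) /sharp_coord.
rewrite (unsplitK (inl j)) (unsplitK (inr j)) rc_reS rc_imS -!/(wX j).
rewrite !fvf_appZ fvf_appB fvf_appD dz_x dz_y /sharp.
rewrite fps_compZ fps_compD fps_compB -!/(sharp _ _) -/(dw j f) -/(dwb j f).
have [i2 h2] := @constP R n; rewrite !fcstE.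
have -> : fcst (- 'i / 2) = - (fcst 'i * fcst 2^-1) :> A.
  by rewrite /fcst mulr_algl scalerA mulNr scaleNr.
set p := fvf_app L _; set q := fvf_app L _; set x := dw _ _; set y := dwb _ _.
transitivity ((fcst 2^-1 *+ 2) * (p * x + q * y) - (1 + fcst 'i * fcst 'i) * fcst 2^-1 * (p - q) * (x - y)).
  by ring.
by rewrite i2 h2 subrr !mul0r subr0 mul1r.
Qed.

Lemma dw_dz j f : dw j f = \sum_l dw j (zX l) * dz l f.
Proof.
rewrite -{1}dw_vfE fvf_app_z; apply: eq_bigr => l _.
by rewrite !dw_vfE dw_zb mul0r addr0.
Qed.

(** As [w] is holomorphic in [z], [d / d z_l] is a combination of the
    [d / d w_j] without any [d / d wbar_j]. *)
Lemma fvf_app10 L f : \sum_l fvf_app L (zX l) * dz l f = \sum_j fvf_app L (wX j) * dw j f.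
Proof.
under [RHS]eq_bigr do rewrite dw_dz mulr_sumr.
rewrite exchange_big /=; apply: eq_bigr => l _.
rewrite [in LHS]fvf_app_w mulr_suml; apply: eq_bigr => j _.
by rewrite dwb_z mulr0 addr0 mulrA.
Qed.

End Frame.

(** * The Levi form in a holomorphic chart *)

Section LeviCoordinates.
Context {R : realType} {n : nat}.
Local Notation C := R[i].
Local Notation A := (fps (n + n) C).
Implicit Types (f : A) (u : 'I_n -> A) (v : 'I_(n + n) -> A).

Definition dgrad f : 'I_(n + n) -> A := fun i => fps_deriv i f.
Definition dhess f : 'I_(n + n) -> 'I_(n + n) -> A := fun i j => fps_deriv i (fps_deriv j f).

(** [x] and [y] are the components of [v] on [d/dz] and [d/dzbar]. *)
Definition zcoord (v : 'I_(n + n) -> A) (x y : 'I_n -> A) : Prop :=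
  (forall l, v (lshift n l) + fcst 'i * v (rshift n l) = x l) /\
  (forall l, v (lshift n l) - fcst 'i * v (rshift n l) = y l).

Lemma zcoord_J v x y : zcoord v x y ->
  zcoord (Jf v) (fun l => fcst 'i * x l) (fun l => - (fcst 'i * y l)).
Proof.
have [i2 _] := @constP R n; move=> [vx vy]; split=> l;
  rewrite -?vx -?vy /Jf (unsplitK (inl l)) (unsplitK (inr l)); ring: i2.
Qed.

Lemma dotf_z v x y f : zcoord v x y ->
  dotf (dgrad f) v = \sum_l (x l * dz l f + y l * dzb l f).
Proof.
move=> [vx vy]; have -> : dotf (dgrad f) v = fvf_app (\row_i v i) f.
  by apply: eq_bigr => i _; rewrite mxE mulrC.
rewrite fvf_app_z; apply: eq_bigr => l _.
have cjX i : cj (fpsX i : A) = fpsX i by rewrite /cj fps_mapX.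
rewrite /zX cjD cjZ !cjX conjc_i !fvf_appD !fvf_appZ !fvf_appX !mxE scaleNr !fcstE.
by rewrite vx vy.
Qed.

Lemma quadf_z v x y f : zcoord v x y -> quadf (dhess f) v =
  \sum_l \sum_m (x l * x m * dz l (dz m f) + y l * y m * dzb l (dzb m f)
    + (x l * y m * dz l (dzb m f)) *+ 2).
Proof.
move=> vxy; have -> : quadf (dhess f) v = \sum_j v j * dotf (dgrad (fps_deriv j f)) v.
  rewrite /quadf exchange_big; apply: eq_bigr => j _; rewrite /dotf mulr_sumr.
  by apply: eq_bigr => i _; rewrite /dgrad /dhess; ring.
have dzbD l (g h : A) : dzb l (g + h) = dzb l g + dzb l h.
  by rewrite -[g]cjK -[h]cjK -cjD !dzb_cj dzD cjD.
have dzb_deriv l i (g : A) : dzb l (fps_deriv i g) = fps_deriv i (dzb l g).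
  by rewrite -[g]cjK -cj_deriv !dzb_cj dz_deriv cj_deriv.
have -> : \sum_j v j * dotf (dgrad (fps_deriv j f)) v =
   \sum_l (x l * dotf (dgrad (dz l f)) v + y l * dotf (dgrad (dzb l f)) v).
  under eq_bigr do rewrite (dotf_z _ vxy) mulr_sumr.
  rewrite exchange_big /=; apply: eq_bigr => l _.
  rewrite /dotf !mulr_sumr -big_split; apply: eq_bigr => i _.
  by rewrite /dgrad dz_deriv dzb_deriv /=; ring.
under eq_bigr do rewrite !(dotf_z _ vxy) !mulr_sumr -big_split.
have E (F G : 'I_n -> 'I_n -> A) : \sum_l \sum_m (F l m + G l m) =
    \sum_l \sum_m F l m + \sum_l \sum_m G l m.
  by rewrite -big_split; apply: eq_bigr => l _; rewrite big_split.
transitivity (\sum_l \sum_m (x l * x m * dz l (dz m f) + y l * y m * dzb l (dzb m f)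
    + x l * y m * dz l (dzb m f)) + \sum_m \sum_l x l * y m * dz l (dzb m f)).
  rewrite -E; apply: eq_bigr => l _; apply: eq_bigr => m _ /=.
  have dzbC : dzb m (dzb l f) = dzb l (dzb m f).
    by rewrite -[f]cjK !dzb_cj dzC.
  by rewrite (dzC m) dzbC -(dz_dzbC l m f); ring.
rewrite [X in _ + X]exchange_big -E; apply: eq_bigr => l _; apply: eq_bigr => m _ /=.
by rewrite mulr2n addrA.
Qed.

(** Replacing [v] by [J v] multiplies the components [x] by [i] and [y] by
    [- i]. This changes the sign of the terms of types (2, 0) and (0, 2) of
    the Hessian, and keeps those of type (1, 1), of which there are two equal
    ones in each Hessian. *)
Lemma quadf_levi v x y f : zcoord v x y ->
  quadf (dhess f) v + quadf (dhess f) (Jf v) =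
  (\sum_l \sum_m x l * y m * dz l (dzb m f)) *+ 4.
Proof.
move=> vxy; rewrite (quadf_z _ vxy) (quadf_z _ (zcoord_J vxy)).
have [i2 _] := @constP R n.
rewrite -big_split -sumrMnl; apply: eq_bigr => l _.
rewrite -big_split -sumrMnl; apply: eq_bigr => m _ /=.
by ring: i2.
Qed.

End LeviCoordinates.

Section LeviTangential.
Context {n : nat} {Q : comNzRingType} (P : set Q) (PI : is_ideal P).
Implicit Types (p v : 'I_(n + n) -> Q).

(** Modulo [dr (v)] and [dr (J v)] the projection [ctan] is multiplication by
    [|p|^2]. *)
Lemma levi_tangential p H v : P (dotf p v) -> P (dotf p (Jf v)) ->
  P (levi p H v - dotf p p * dotf p p * (quadf H v + quadf H (Jf v))).
Proof.
move=> pv pJv; have [P0 PD PM] := PI.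
have PN x : P x -> P (- x) by rewrite -mulN1r; exact: PM.
pose cong x y := P (x - y).
have cong0 x : cong x x by rewrite /cong subrr.
have congD x x' y y' : cong x x' -> cong y y' -> cong (x + y) (x' + y').
  by rewrite /cong opprD addrACA; exact: PD.
have congM x x' y y' : cong x x' -> cong y y' -> cong (x * y) (x' * y').
  move=> xx yy; rewrite /cong (_ : _ - _ = x * (y - y') + y' * (x - x')); last by ring.
  by apply: PD; apply: PM.
have congN x x' : cong x x' -> cong (- x) (- x').
  by move=> xx; rewrite /cong -opprD; apply: PN.
set D := dotf p p.
have cctan i : cong (ctan p v i) (D * v i).
  rewrite /cong /ctan -/D (_ : _ - _ = Jf p i * dotf p (Jf v) - p i * dotf p v); last by ring.
  by apply: PD; [|apply: PN]; apply: PM.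
have cJctan i : cong (Jf (ctan p v) i) (D * Jf v i).
  have -> : D * Jf v i = Jf (fun i => D * v i) i.
    by rewrite /Jf; case: fintype.split => j //; rewrite mulrN.
  exact: (rel_Jf (rel := cong)).
have quadD w : quadf H (fun i => D * w i) = D * D * quadf H w.
  rewrite /quadf mulr_sumr; apply: eq_bigr => i _.
  by rewrite mulr_sumr; apply: eq_bigr => j _; ring.
rewrite mulrDr -!quadD /levi; apply: (congD).
  exact: (rel_quadf (rel := cong)).
exact: (rel_quadf (rel := cong)).
Qed.

End LeviTangential.

(** * Orders of vanishing along a complex submanifold *)

Section Main.
Context {R : realType} {n k d : nat}.
Local Notation C := R[i].
Local Notation A := (fps (n + n) C).
Context (Phi : 'I_(k + d) -> fps n C) (Psi : 'I_n -> fps (k + d) C).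
Hypothesis Phi0 : forall i, fps_coef (Phi i) mi0 = 0.
Hypothesis Psi0 : forall i, fps_coef (Psi i) mi0 = 0.
Hypothesis PhiPsi : forall f, fps_comp Phi (fps_comp Psi f) = f.
Hypothesis PsiPhi : forall f, fps_comp Psi (fps_comp Phi f) = f.
Context (O : formal_submfd (n + n) R).
Local Notation I := (complexify (fideal O)).
Implicit Types (f g : A) (al be : 'I_d).

(** The real form of [sharp_coord]: the holomorphic substitution [G] as a
    substitution of real power series. *)
Definition realify a b (G : 'I_a -> fps b C) (i : 'I_(a + a)) : fps (b + b) R :=
  match fintype.split i with
  | inl j => reS (fps_holo (G j))
  | inr j => imS (fps_holo (G j))
  end.

Lemma rc_realify a b (G : 'I_a -> fps b C) i : rc (realify G i) = sharp_coord G i.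
Proof. by rewrite /realify /sharp_coord; case: fintype.split. Qed.

Lemma rc_comp_realify a b (G : 'I_a -> fps b C) (f : fps (a + a) R) :
  rc (fps_comp (realify G) f) = sharp G (rc f).
Proof.
by rewrite /rc fps_map_comp; apply: eq_fps_comp => i; rewrite -!/(rc _) rc_realify.
Qed.

Lemma realify_coef0 a b (G : 'I_a -> fps b C) i :
  (forall j, fps_coef (G j) mi0 = 0) -> fps_coef (realify G i) mi0 = 0.
Proof.
move=> G0; have := sharp_coord0 G0 i; rewrite -rc_realify => h.
by have := congr1 (@complex.Re R) h.
Qed.

Lemma realify_PhiPsi (f : fps (n + n) R) : fps_comp (realify Phi) (fps_comp (realify Psi) f) = f.
Proof. by apply: rc_inj; rewrite !rc_comp_realify sharp_PhiPsi. Qed.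

Lemma realify_PsiPhi (f : fps ((k + d) + (k + d)) R) : fps_comp (realify Psi) (fps_comp (realify Phi) f) = f.
Proof. by apply: rc_inj; rewrite !rc_comp_realify sharp_PsiPhi. Qed.

(** The real directions tangent to [V = {w_j = 0, j < k}], two for each
    holomorphic coordinate [w_al] of [V]. *)
Definition vdir (j : 'I_d + 'I_d) : 'I_((k + d) + (k + d)) :=
  match j with
  | inl al => lshift (k + d) (rshift k al)
  | inr al => rshift (k + d) (rshift k al)
  end.

(** Differentiation along [V] on complex series; [cdR] is its restriction to
    real series ([rc_cdR]). *)
Definition cd j f : A := sharp Phi (fps_deriv (vdir j) (sharp Psi f)).
Definition cdR := chart_deriv (realify Phi) (realify Psi) vdir.

Lemma rc_cdR j (f : fps (n + n) R) : rc (cdR j f) = cd j (rc f).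
Proof. by rewrite /cdR /chart_deriv rc_comp_realify /rc fps_map_deriv -!/(rc _) rc_comp_realify. Qed.

Lemma cd_vf j f : cd j f = fvf_app (chart_vf Phi Psi (vdir j)) f.
Proof. by rewrite chart_vfE. Qed.

Lemma cdD j f g : cd j (f + g) = cd j f + cd j g.
Proof. by rewrite !cd_vf fvf_appD. Qed.

Lemma cdM j f g : cd j (f * g) = cd j f * g + f * cd j g.
Proof. by rewrite !cd_vf fvf_appM. Qed.

Lemma cd_cj j f : cd j (cj f) = cj (cd j f).
Proof. by rewrite /cd sharp_cj // -cj_deriv sharp_cj. Qed.

Local Notation ord := (Iord cd I).
Local Notation et al := (dw Phi Psi (rshift k al)).
Local Notation etb al := (dwb Phi Psi (rshift k al)).

Lemma idealO : is_ideal (fideal O).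
Proof. exact: is_ideal_manifold (fidealP O). Qed.

Let II : is_ideal I := complexify_ideal idealO.

Lemma I_rc (f : fps (n + n) R) : I (rc f) <-> fideal O f.
Proof.
rewrite complexifyP reS_rc imS_rc; split=> [[]//|Of]; split=> //.
by have [] := idealO.
Qed.

Lemma ord_rc m (f : fps (n + n) R) : ord m (rc f) <-> Iord cdR (fideal O) m f.
Proof.
elim: m f => [|m IH] f //=; split=> -[/I_rc If df]; split=> // j.
  by apply/IH; rewrite rc_cdR.
by rewrite -rc_cdR; apply/IH.
Qed.

Lemma ord_cj m f : ord m f -> ord m (cj f).
Proof.
elim: m f => [|m IH] f; first by [].
move=> [If df]; split; first exact: (complexify_cj idealO If).
by move=> j; rewrite cd_cj; exact: (IH _ (df j)).
Qed.

Lemma ordZ m c f : ord m f -> ord m (c *: f).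
Proof. by move=> fm; rewrite fcstE; apply: (IordMl cdD cdM II). Qed.

Lemma cd_x al f : cd (inl al) f = et al f + etb al f.
Proof. by rewrite /cd dz_x /sharp fps_compD. Qed.

Lemma cd_y al f : cd (inr al) f = 'i *: (et al f - etb al f).
Proof. by rewrite /cd dz_y /sharp fps_compZ fps_compB. Qed.

Lemma dw_cd al f : et al f = (2^-1 : C) *: (cd (inl al) f - 'i *: cd (inr al) f).
Proof. by rewrite /dw /dz /sharp fps_compZ fps_compB fps_compZ. Qed.

Lemma ord_dw m al f : ord m.+1 f -> ord m (et al f).
Proof.
move=> fm; rewrite dw_cd; apply: ordZ; apply: (IordB cdD cdM II).
  exact: (Iord_deriv _ fm).
by apply: ordZ; exact: (Iord_deriv _ fm).
Qed.

Lemma ord_dwb m al f : ord m.+1 f -> ord m (etb al f).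
Proof. by move=> fm; rewrite dwbE //; apply/ord_cj/ord_dw/ord_cj. Qed.

Lemma ordS_dw m f : I f -> (forall al, ord m (et al f)) -> (forall al, ord m (etb al f)) ->
  ord m.+1 f.
Proof.
move=> If ef ebf; split=> // -[] al; rewrite ?cd_x ?cd_y.
  exact: (IordD cdD II).
by apply: ordZ; exact: (IordB cdD cdM II).
Qed.

Section OddLevi.
Context (rho : fps (n + n) R) (eps : R).
Local Notation r := (rc rho).
Hypothesis rho_grad : exists i, fps_coef (fps_deriv i rho) mi0 != 0.
Hypothesis eps0 : eps != 0.
Hypothesis levi_pos : forall (c v : 'I_(n + n) -> fps 1 R) m,
    (forall j, fps_coef (c j) mi0 = 0) -> ord_ge m.+1 (fps_comp c rho) ->
    let g := levi (fun i => fps_comp c (fps_deriv i rho))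
      (fun i j => fps_comp c (fps_deriv i (fps_deriv j rho))) v in
    ord_ge m g -> 0 <= eps * cf m g.

(** The Levi form of [r] along [V], extended to a bilinear form in the
    components of a (1, 0) and of a (0, 1) field. *)
Definition lev (a b : 'I_d -> A) : A := \sum_al \sum_be a al * b be * et al (etb be r).

(** The chart being holomorphic, its second derivatives do not enter the mixed
    derivatives [d^2 / dw dwbar]. *)
Lemma lev_z a : let u l := \sum_al a al * et al (zX l) in
  lev a (fun be => cj (a be)) = \sum_l \sum_m u l * cj (u m) * dz l (dzb m r).
Proof.
move=> u; have ebE be f : etb be f = \sum_m cj (et be (zX m)) * dzb m f.
  rewrite dwbE // dw_dz // cj_sum; apply: eq_bigr => m _.
  by rewrite cjM -dzb_cj cjK.
have eebE al be f : et al (etb be f) =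
    \sum_l \sum_m et al (zX l) * cj (et be (zX m)) * dz l (dzb m f).
  rewrite ebE -dw_vfE // fvf_app_sum [RHS]exchange_big; apply: eq_bigr => m _ /=.
  rewrite fvf_appM !dw_vfE // dw_cj // dw_dwbC // dw_zb //.
  have -> : etb be 0 = 0 by apply: (addIr (etb be 0)); rewrite -dwbD // !add0r.
  rewrite mul0r add0r dw_dz // mulr_sumr.
  by apply: eq_bigr => l _; rewrite mulrCA mulrA.
rewrite /lev; under eq_bigr do under eq_bigr do rewrite eebE mulr_sumr.
under eq_bigr do rewrite exchange_big.
rewrite exchange_big; apply: eq_bigr => l _ /=.
under eq_bigr do under eq_bigr do rewrite mulr_sumr.
under eq_bigr do rewrite exchange_big.
rewrite exchange_big; apply: eq_bigr => m _ /=.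
rewrite /u cj_sum mulr_suml mulr_suml; apply: eq_bigr => al _.
rewrite mulr_sumr mulr_suml; apply: eq_bigr => be _ /=.
by rewrite cjM; ring.
Qed.

Lemma grad_unit : exists D, dotf (dgrad r) (dgrad r) * D = 1.
Proof.
apply: fps_inv; rewrite fps_coef_sum.
have -> : \sum_i fps_coef (dgrad r i * dgrad r i) mi0 =
    (\sum_i fps_coef (fps_deriv i rho) mi0 ^+ 2)%:C.
  rewrite raddf_sum; apply: eq_bigr => i _; rewrite fps_coef0M.
  have -> : fps_coef (dgrad r i) mi0 = (fps_coef (fps_deriv i rho) mi0)%:C.
    by rewrite /dgrad /rc -fps_map_deriv.
  by rewrite -expr2 -rmorphXn.
have [i ri] := rho_grad; rewrite fmorph_eq0 gt_eqF // (bigD1 i) //= ltr_pwDl //.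
  by rewrite exprn_even_gt0.
by apply: sumr_ge0 => j _; rewrite sqr_ge0.
Qed.

(** For [u] the (1, 0) field with components [a], the real field [v] with
    (1, 0) part [u] is complex tangential modulo order [m + 1], so up to a
    unit the Levi form [levi] is [lev] there ([quadf_levi],
    [levi_tangential]). The former is nonnegative in the sense of
    [formal_levi], and [odd_order] applies. *)
Lemma levi_odd m a : odd m -> ord m.+1 r -> ord m.+1 (\sum_al a al * et al r) ->
  ord m (lev a (fun be => cj (a be))) -> ord m.+1 (lev a (fun be => cj (a be))).
Proof.
move=> modd rm Xr Lm.
pose u l := \sum_al a al * et al (zX l).
pose v (i : 'I_(n + n)) : fps (n + n) R :=
  match fintype.split i with inl l => reS (u l) | inr l => imS (u l) end.
pose vC i : A := rc (v i).
pose G := levi (fun i => fps_deriv i rho) (fun i j => fps_deriv i (fps_deriv j rho)) v.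
have vz : zcoord vC u (fun l => cj (u l)).
  split=> l; rewrite /vC /v (unsplitK (inl l)) (unsplitK (inr l)) -fcstE.
    by rewrite -reS_imS.
  by rewrite /= [in RHS](reS_imS (u l)) cjD cjZ !cj_rc conjc_i scaleNr.
have GE : rc G = levi (dgrad r) (dhess r) vC.
  apply: (levi_rel (rel := fun x y => rc x = y)) => //.
  - by move=> x x' y y' <- <-; exact: raddfD.
  - by move=> x x' y y' <- <-; exact: rmorphM.
  - by move=> x x' <-; exact: raddfN.
  - by move=> i; rewrite /dgrad /rc fps_map_deriv.
  - by move=> i j; rewrite /dhess /rc !fps_map_deriv.
pose D := dotf (dgrad r) (dgrad r).
have XE : \sum_l u l * dz l r = \sum_al a al * et al r.
  under [RHS]eq_bigr do rewrite dw_dz // mulr_sumr.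
  rewrite exchange_big; apply: eq_bigr => l _; rewrite mulr_suml.
  by apply: eq_bigr => al _; rewrite mulrA.
have XbE : \sum_l cj (u l) * dzb l r = cj (\sum_l u l * dz l r).
  rewrite cj_sum; apply: eq_bigr => l _.
  by rewrite cjM -dzb_cj cj_rc.
have pv : ord m.+1 (dotf (dgrad r) vC).
  rewrite (dotf_z _ vz) big_split /= XbE XE; exact: (IordD cdD II Xr (ord_cj Xr)).
have pJv : ord m.+1 (dotf (dgrad r) (Jf vC)).
  rewrite (dotf_z _ (zcoord_J vz)) big_split /=.
  have -> : \sum_l fcst 'i * u l * dz l r = fcst 'i * (\sum_l u l * dz l r).
    by rewrite mulr_sumr; apply: eq_bigr => l _; rewrite mulrA.
  have -> : \sum_l - (fcst 'i * cj (u l)) * dzb l r =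
      - (fcst 'i * \sum_l cj (u l) * dzb l r).
    by rewrite mulr_sumr -sumrN; apply: eq_bigr => l _; rewrite mulrA mulNr.
  rewrite XbE XE.
  exact: (IordB cdD cdM II (IordMl cdD cdM II _ Xr) (IordMl cdD cdM II _ (ord_cj Xr))).
have key : ord m.+1 (rc G - D * D * (lev a (fun be => cj (a be)) *+ 4)).
  rewrite lev_z -/u -(quadf_levi _ vz) GE.
  exact: (levi_tangential (Iord_ideal cdD cdM II m.+1) _ pv pJv).
have Grc : ord m (rc G).
  rewrite -[rc G](subrK (D * D * (lev a (fun be => cj (a be)) *+ 4))).
  apply: (IordD cdD II); first exact: IordS key.
  by apply: (IordMl cdD cdM II); rewrite -scaler_nat; apply: ordZ.
have GS : ord m.+1 (rc G).
  have OO := @odd_order R _ _ _ _ (realify Phi) (realify Psi) vdir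
    (fun i => realify_coef0 i Phi0) (fun i => realify_coef0 i Psi0) realify_PhiPsi realify_PsiPhi
    _ (fidealP O) rho G eps m modd eps0.
  apply/ord_rc; refine (OO _ _ _); [exact/ord_rc|exact/ord_rc|].
  move=> c l c0 rl.
  have -> : fps_comp c G = levi (fun i => fps_comp c (fps_deriv i rho))
      (fun i j => fps_comp c (fps_deriv i (fps_deriv j rho))) (fun i => fps_comp c (v i)).
    apply: (levi_rel (rel := fun x y => fps_comp c x = y)) => //.
    - exact: raddf0.
    - by move=> x x' y y' <- <-; exact: fps_compD.
    - by move=> x x' y y' <- <-; exact: fps_compM.
    - by move=> x x' <-; exact: raddfN.
  exact: levi_pos.
have DL : ord m.+1 (D * D * (lev a (fun be => cj (a be)) *+ 4)).
  rewrite -[_ * _](subKr (rc G)).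
  exact: (IordB cdD cdM II GS key).
have [D' DD] := grad_unit; rewrite -/D in DD.
have -> : lev a (fun be => cj (a be)) = (4%:R^-1 : C) *: (D' * D' * (D * D * (lev a (fun be => cj (a be)) *+ 4))).
  move: (lev a _) => x; rewrite !mulrnAr.
  have -> : D' * D' * (D * D * x) = x.
    transitivity ((D * D') * (D * D') * x); first by ring.
    by rewrite DD !mul1r.
  by rewrite -scalerMnr scalerMnl -mulr_natr mulVf ?pnatr_eq0 // scale1r.
by apply: ordZ; apply: (IordMl cdD cdM II).
Qed.

(** ** Polarization of the Levi form *)

Lemma levDl a a' b : lev (fun al => a al + a' al) b = lev a b + lev a' b.
Proof.
rewrite /lev -big_split; apply: eq_bigr => al _; rewrite -big_split.
by apply: eq_bigr => be _; rewrite !mulrDl.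
Qed.

Lemma levDr a b b' : lev a (fun al => b al + b' al) = lev a b + lev a b'.
Proof.
rewrite /lev -big_split; apply: eq_bigr => al _; rewrite -big_split.
by apply: eq_bigr => be _; rewrite mulrDr mulrDl.
Qed.

Lemma levMl c a b : lev (fun al => c * a al) b = c * lev a b.
Proof.
rewrite /lev mulr_sumr; apply: eq_bigr => al _; rewrite mulr_sumr.
by apply: eq_bigr => be _; rewrite !mulrA.
Qed.

Lemma levMr c a b : lev a (fun al => c * b al) = c * lev a b.
Proof.
rewrite /lev mulr_sumr; apply: eq_bigr => al _; rewrite mulr_sumr.
by apply: eq_bigr => be _; rewrite [a al * _]mulrCA !mulrA.
Qed.

(** The (1, 0) field along [V] with components [a], applied to [r]. *)
Definition app10 (a : 'I_d -> A) : A := \sum_al a al * et al r.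

Lemma app10_cj a : app10 (fun al => cj (a al)) = cj (\sum_al a al * etb al r).
Proof.
rewrite cj_sum; apply: eq_bigr => al _.
rewrite cjM; congr (_ * _).
by rewrite (dwb_cj Phi Psi) cj_rc.
Qed.

Lemma ord_app10 m a : ord m.+1 r -> ord m (app10 a).
Proof.
move=> rm; apply: (Iord_sum cdD II) => al _.
by apply: (IordMl cdD cdM II); exact: ord_dw.
Qed.

(** The polarization identity, on the module of the (1, 0) fields that
    annihilate [r] to order [m]. *)
Lemma lev_polar m a b : (forall a, ord m (app10 a) -> ord m (lev a (fun al => cj (a al)))) ->
    ord m (app10 a) -> ord m (app10 b) ->
  ord m (lev a (fun al => cj (b al))).
Proof.
move=> pos am bm; have [i2 h2] := @constP R n.
pose q a := lev a (fun al => cj (a al)).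
have cji : cj (fcst 'i : A) = - fcst 'i.
  by rewrite /fcst cjZ conjc_i scaleNr; congr (- (_ *: _)); exact: rmorph1.
have e1 : q (fun al => a al + b al) - q a - q b =
    lev a (fun al => cj (b al)) + lev b (fun al => cj (a al)).
  rewrite /q; have -> : (fun al => cj (a al + b al)) = fun al => cj (a al) + cj (b al).
    by apply/funext => al; rewrite cjD.
  by rewrite levDl !levDr; ring.
have e2 : q (fun al => a al + fcst 'i * b al) - q a - q b =
    - fcst 'i * lev a (fun al => cj (b al)) + fcst 'i * lev b (fun al => cj (a al)).
  rewrite /q; have -> : (fun al => cj (a al + fcst 'i * b al)) =
      fun al => cj (a al) + - fcst 'i * cj (b al).
    by apply/funext => al; rewrite cjD cjM cji.
  by rewrite levDl !levDr !levMl !levMr; ring: i2.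
have qm c : ord m (app10 c) -> ord m (q c) by exact: pos.
have addm c c' : ord m (app10 c) -> ord m (app10 c') -> ord m (app10 (fun al => c al + c' al)).
  have -> : app10 (fun al => c al + c' al) = app10 c + app10 c'.
    by rewrite /app10 -big_split; apply: eq_bigr => al _; rewrite mulrDl.
  exact: (IordD cdD II).
have ibm : ord m (app10 (fun al => fcst 'i * b al)).
  have -> : app10 (fun al => fcst 'i * b al) = fcst 'i * app10 b.
    by rewrite /app10 mulr_sumr; apply: eq_bigr => al _; rewrite mulrA.
  exact: (IordMl cdD cdM II).
have sub3 x y z : ord m x -> ord m y -> ord m z -> ord m (x - y - z).
  by move=> xm ym zm; exact: (IordB cdD cdM II (IordB cdD cdM II xm ym) zm).
have E1 := sub3 _ _ _ (qm _ (addm _ _ am bm)) (qm _ am) (qm _ bm).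
have E2 := sub3 _ _ _ (qm _ (addm _ _ am ibm)) (qm _ am) (qm _ bm).
rewrite e1 in E1; rewrite e2 in E2; move: E1 E2.
set x := lev a _; set y := lev b _ => E1 E2.
have -> : x = fcst 2^-1 * ((x + y) + fcst 'i * (- fcst 'i * x + fcst 'i * y)).
  transitivity ((fcst 2^-1 *+ 2) * x); first by rewrite h2 mul1r.
  by ring: i2.
apply: (IordMl cdD cdM II); apply: (IordD cdD II) => //.
exact: (IordMl cdD cdM II).
Qed.

(** ** Tangential parts of vector fields preserving the ideal of [O] *)

Local Notation wv al := (wX Phi (rshift k al)).
Hypothesis wI : forall j : 'I_k, I (wX Phi (lshift d j)).
Implicit Types (L M : formal_vf (n + n) C).

Let etD al f g : et al (f + g) = et al f + et al g.
Proof. exact: dwD. Qed.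
Let etM al f g : et al (f * g) = et al f * g + f * et al g.
Proof. exact: dwM. Qed.
Let etbD al f g : etb al (f + g) = etb al f + etb al g.
Proof. exact: dwbD. Qed.
Let etbM al f g : etb al (f * g) = etb al f * g + f * etb al g.
Proof. exact: dwbM. Qed.

(** The part along [V] of the field [L] in the chart. Unlike [L] it is a
    combination of derivatives along [V], so it can be compared with the order
    of series. *)
Definition tanp L f : A :=
  \sum_al (fvf_app L (wv al) * et al f + fvf_app L (cj (wv al)) * etb al f).

(** What is omitted are multiples of [L (w_j)] and [L (wbar_j)] for [j < k],
    where [w_j] and [wbar_j] are in the ideal of [O] since [O] is contained in
    [V]. *)
Lemma tanp_congr L f : preserves L I -> I (fvf_app L f - tanp L f).
Proof.
move=> LI; rewrite (fvf_app_w Phi0 Psi0 PhiPsi) big_split_ord /= addrK.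
refine (is_ideal_sum _ II _) => j _; have [_ ID IM] := II.
apply: ID; rewrite mulrC; apply: IM; apply: LI => //.
exact: complexify_cj idealO (wI j).
Qed.

Lemma tanpM L f g : tanp L (f * g) = tanp L f * g + f * tanp L g.
Proof.
rewrite /tanp mulr_suml mulr_sumr -big_split; apply: eq_bigr => al _ /=.
rewrite etM etbM.
move: (fvf_app L _) (fvf_app L _) (et al f) (et al g) (etb al f) (etb al g).
by move=> x y a a' b b'; ring.
Qed.

Lemma tanpD L f g : tanp L (f + g) = tanp L f + tanp L g.
Proof.
rewrite /tanp -big_split; apply: eq_bigr => al _ /=.
rewrite etD etbD.
move: (fvf_app L _) (fvf_app L _) (et al f) (et al g) (etb al f) (etb al g).
by move=> x y a a' b b'; ring.
Qed.

Lemma tanp_sum L (F : 'I_d -> A) : tanp L (\sum_al F al) = \sum_al tanp L (F al).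
Proof.
apply: (big_morph (tanp L)) => [f g|]; first exact: tanpD.
by apply: (addIr (tanp L 0)); rewrite -tanpD !add0r.
Qed.

Lemma cd_dw j al f : cd j (et al f) = et al (cd j f).
Proof.
by rewrite /cd /dw !(sharp_PsiPhi Phi0 Psi0 PsiPhi) dz_deriv.
Qed.

(** The commutator of [tanp L] with a derivative along [V] is again a
    combination of derivatives along [V], which gives an induction on [m]; at
    [m = 1], [L] preserves the ideal. *)
Lemma ord_tanp m L f : preserves L I -> ord m f -> ord m (tanp L f).
Proof.
move=> LI; elim: m f => [|m IH] f fm; first by [].
have Sm : ord m.+1 (tanp L f) <-> I (tanp L f) /\ forall j, ord m (cd j (tanp L f)) by [].
apply/Sm; split.
  have [_ ID IM] := II; have [If _] := fm.
  rewrite -[tanp L f](subKr (fvf_app L f)); apply: ID; first exact: LI.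
  by rewrite -mulN1r; apply: IM; apply: tanp_congr.
move=> j; have -> : cd j (tanp L f) =
    \sum_al (cd j (fvf_app L (wv al)) * et al f + cd j (fvf_app L (cj (wv al))) * etb al f)
    + tanp L (cd j f).
  rewrite cd_vf // fvf_app_sum -big_split; apply: eq_bigr => al _ /=.
  rewrite -!cd_vf // cdD !cdM cd_dw.
  have -> : cd j (etb al f) = etb al (cd j f) by rewrite dwbE cd_cj cd_dw cd_cj -dwbE.
  exact: addrACA.
apply: (IordD cdD II); last exact: IH (Iord_deriv j fm).
apply: (Iord_sum cdD II) => al _; apply: (IordD cdD II); apply: (IordMl cdD cdM II).
  exact: ord_dw.
exact: ord_dwb.
Qed.

(** ** The Lie algebra generated by the Cauchy-Riemann fields of [O] *)

(** The (1, 0) part of [tanp L], applied to [r]; [T01] is the (0, 1) part. *)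
Definition T10 L : A := app10 (fun al => fvf_app L (wv al)).
Definition T01 L : A := \sum_al fvf_app L (cj (wv al)) * etb al r.
Definition Lbar L : formal_vf (n + n) C := map_mx (fps_map conjc) L.

Lemma LbarK L : Lbar (Lbar L) = L.
Proof. by apply/rowP => i; rewrite !mxE; exact: cjK. Qed.

Lemma fvf_app_Lbar L f : fvf_app (Lbar L) f = cj (fvf_app L (cj f)).
Proof. by rewrite fvf_app_cj cjK. Qed.

Lemma T01_bar L : T01 L = cj (T10 (Lbar L)).
Proof.
rewrite /T10 /app10 cj_sum; apply: eq_bigr => al _; rewrite cjM.
by rewrite fvf_app_Lbar cjK (dw_cj Phi Psi) cj_rc.
Qed.

Lemma preserves_Lbar L : preserves L I -> preserves (Lbar L) I.
Proof.
move=> LI f If; rewrite fvf_app_Lbar.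
exact: complexify_cj idealO (LI _ (complexify_cj idealO If)).
Qed.

Lemma Lbar_bracket L M : Lbar (fvf_bracket L M) = fvf_bracket (Lbar L) (Lbar M).
Proof.
apply/rowP => i; rewrite [RHS]mxE [Lbar M 0 i]mxE [Lbar L 0 i]mxE !fvf_app_Lbar !cjK.
rewrite mxE [fvf_bracket L M 0 i]mxE.
exact: cjB.
Qed.

(** The (1, 0) part of the bracket maps [r] to
    [tanp L (T10 M) - tanp M (T10 L)], up to second derivatives of [r]. Those
    of type (2, 0) cancel by symmetry and the mixed ones make up two values of
    the Levi form. The components of the bracket involve [L] and [M]
    themselves instead of [tanp L] and [tanp M]; the difference is in the
    ideal and gets multiplied by a first derivative of [r], of order [m]. *)
Lemma ord_T10_bracket m L M : preserves L I -> preserves M I -> ord m.+1 r ->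
    (forall a b, ord m.+1 (app10 a) -> ord m.+1 (\sum_al b al * etb al r) -> ord m.+1 (lev a b)) ->
    ord m.+1 (T10 L) -> ord m.+1 (T01 L) -> ord m.+1 (T10 M) -> ord m.+1 (T01 M) ->
  ord m.+1 (T10 (fvf_bracket L M)).
Proof.
move=> LI MI rm LC L10 L01 M10 M01.
have P1 g h : I g -> ord m h -> ord m.+1 (g * h).
  by move=> Ig hm; have := @Iord_mul _ _ _ _ cdD cdM II 1 m g h; apply.
pose S L M := \sum_al \sum_be fvf_app M (wv al) * fvf_app L (wv be) * et be (et al r).
have SC : S L M = S M L.
  rewrite /S exchange_big; apply: eq_bigr => al _; apply: eq_bigr => be _.
  by rewrite (dwC Phi0 Psi0 PsiPhi) [fvf_app M _ * _]mulrC.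
have half L' M' : preserves L' I -> ord m.+1 (\sum_al fvf_app L' (fvf_app M' (wv al)) * et al r -
    (tanp L' (T10 M') - S L' M' - lev (fun al => fvf_app M' (wv al)) (fun al => fvf_app L' (cj (wv al))))).
  move=> LI'.
  have -> : tanp L' (T10 M') = \sum_al tanp L' (fvf_app M' (wv al)) * et al r +
      (S L' M' + lev (fun al => fvf_app M' (wv al)) (fun al => fvf_app L' (cj (wv al)))).
    rewrite /T10 /app10 tanp_sum.
    under eq_bigr do rewrite tanpM.
    rewrite big_split /=; congr (_ + _); rewrite /S /lev -big_split; apply: eq_bigr => al _ /=.
    rewrite /tanp mulr_sumr -big_split; apply: eq_bigr => be _ /=.
    by rewrite (dw_dwbC Phi0 Psi0 PsiPhi) mulrDr !mulrA.
  have -> : forall y s l : A, y + (s + l) - s - l = y by move=> y s l; ring.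
  rewrite -sumrB; apply: (Iord_sum cdD II) => al _; rewrite -mulrBl.
  by apply: P1; [exact: tanp_congr|exact: ord_dw].
have -> : T10 (fvf_bracket L M) = \sum_al fvf_app L (fvf_app M (wv al)) * et al r -
    \sum_al fvf_app M (fvf_app L (wv al)) * et al r.
  rewrite -sumrB; apply: eq_bigr => al _.
  by rewrite fvf_app_bracket mulrBl.
have := IordB cdD cdM II (half L M LI) (half M L MI); rewrite SC.
have t1 := ord_tanp LI M10; have t2 := ord_tanp MI L10.
have l1 := LC _ _ L10 M01; have l2 := LC _ _ M10 L01.
have comb (a b c e g h t : A) : ord m.+1 c -> ord m.+1 e -> ord m.+1 g -> ord m.+1 h ->
    ord m.+1 ((a - (c - t - h)) - (b - (e - t - g))) -> ord m.+1 (a - b).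
  move=> cm em gm hm H.
  have -> : a - b = (a - (c - t - h) - (b - (e - t - g))) + ((c - h) - (e - g)) by ring.
  exact: (IordD cdD II H (IordB cdD cdM II (IordB cdD cdM II cm hm) (IordB cdD cdM II em gm))).
exact: (comb _ _ _ _ _ _ _ t1 t2 l1 l2).
Qed.

Definition lie_O : set (formal_vf (n + n) C) := Lie [set L + M | L in D10 O & M in D01 O].

(** The class of fields to be shown to contain the Lie algebra of [O].
    Requiring [T10] and [T01] separately, and not only their sum, is what
    makes brackets controllable by the Levi form. *)
Definition tame m L : Prop := [/\ preserves L I, ord m (T10 L) & ord m (T01 L)].

(** For brackets, [ord_T10_bracket] handles the (1, 0) part; the (0, 1) part
    follows by conjugation. *)
Lemma tame_lie m : ord m.+1 r ->
    (forall a b, ord m.+1 (app10 a) -> ord m.+1 (\sum_al b al * etb al r) -> ord m.+1 (lev a b)) ->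
  is_lie_algebra (tame m.+1).
Proof.
move=> rm LC; have [I0 ID IM] := II.
have D10' L M : T10 (L + M) = T10 L + T10 M.
  by rewrite -big_split; apply: eq_bigr => al _; rewrite fvf_appDl mulrDl.
have D01' L M : T01 (L + M) = T01 L + T01 M.
  by rewrite -big_split; apply: eq_bigr => al _; rewrite fvf_appDl mulrDl.
have Z10 c L : T10 (c *: L) = c * T10 L.
  by rewrite /T10 /app10 mulr_sumr; apply: eq_bigr => al _; rewrite fvf_appZl mulrA.
have Z01 c L : T01 (c *: L) = c * T01 L.
  by rewrite /T01 mulr_sumr; apply: eq_bigr => al _; rewrite fvf_appZl mulrA.
have IB f g : I f -> I g -> I (f - g).
  by move=> If Ig; apply: ID => //; rewrite -mulN1r; exact: IM.
split.
- split.
  + by move=> f _; rewrite -(scale0r (0 : formal_vf (n + n) C)) fvf_appZl mul0r.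
  + by rewrite -(scale0r (0 : formal_vf (n + n) C)) Z10 mul0r; exact: (Iord0 cdD II).
  + by rewrite -(scale0r (0 : formal_vf (n + n) C)) Z01 mul0r; exact: (Iord0 cdD II).
- move=> L M [LI L10 L01] [MI M10 M01]; split.
  + by move=> f If; rewrite fvf_appDl; apply: ID; [exact: LI|exact: MI].
  + by rewrite D10'; exact: (IordD cdD II).
  + by rewrite D01'; exact: (IordD cdD II).
- move=> c L [LI L10 L01]; split.
  + by move=> f If; rewrite fvf_appZl; apply: IM; exact: LI.
  + by rewrite Z10; exact: (IordMl cdD cdM II).
  + by rewrite Z01; exact: (IordMl cdD cdM II).
move=> L M [LI L10 L01] [MI M10 M01]; split.
- move=> f If; rewrite fvf_app_bracket.
  by apply: IB; [exact: LI (MI _ If)|exact: MI (LI _ If)].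
- exact: (ord_T10_bracket LI MI rm LC L10 L01 M10 M01).
have bar N : ord m.+1 (T10 N) -> ord m.+1 (T01 N) ->
    ord m.+1 (T10 (Lbar N)) /\ ord m.+1 (T01 (Lbar N)).
  by move=> N10 N01; split; [rewrite -[T10 _]cjK -T01_bar|rewrite T01_bar LbarK]; exact: ord_cj.
have [Lb10 Lb01] := bar _ L10 L01; have [Mb10 Mb01] := bar _ M10 M01.
rewrite T01_bar Lbar_bracket; apply: ord_cj.
exact: (ord_T10_bracket (preserves_Lbar LI) (preserves_Lbar MI) rm LC Lb10 Lb01 Mb10 Mb01).
Qed.

Lemma D10_T01 L : D10 O L -> T01 L = 0.
Proof.
move=> [[a ->] _]; rewrite /T01 big1 // => al _.
rewrite fvf_app_dz_field big1 ?mul0r // => l _.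
by rewrite dz_cj dzb_holo [cj 0]raddf0 mulr0.
Qed.

Lemma tame_bar m L : tame m L -> tame m (Lbar L).
Proof.
move=> [LI L10 L01]; split; first exact: preserves_Lbar.
  by rewrite -[T10 _]cjK -T01_bar; exact: ord_cj.
by rewrite T01_bar LbarK; exact: ord_cj.
Qed.

(** As the (0, 1) part is zero, the (1, 0) part is all of [tanp L], which
    respects the order of [r]. *)
Lemma D10_tame m L : ord m r -> D10 O L -> tame m L.
Proof.
move=> rm LD; have L01 := D10_T01 LD; have [_ LI] := LD.
split=> //; last by rewrite L01; exact: (Iord0 cdD II).
suff <- : tanp L r = T10 L by exact: ord_tanp.
by rewrite /tanp big_split /= -/(T01 L) L01 addr0.
Qed.

(** After polarization the two arguments are conjugate to each other.
    Differentiating the assumption on [c] shows that the Levi form on [c] has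
    order [m], and [levi_odd] gains one more. *)
Lemma lev_even m a b : odd m -> ord m.+1 r -> ord m.+1 (app10 a) ->
  ord m.+1 (\sum_al b al * etb al r) -> ord m.+1 (lev a b).
Proof.
move=> modd rm am bm; have -> : b = fun al => cj (cj (b al)) by apply/funext => al; rewrite cjK.
refine (lev_polar (b := fun al => cj (b al)) _ am _); last by rewrite app10_cj; exact: ord_cj.
move=> c cm; refine (levi_odd modd rm cm _).
rewrite /lev exchange_big; apply: (Iord_sum cdD II) => be _ /=.
have -> : \sum_al c al * cj (c be) * et al (etb be r) =
    cj (c be) * (etb be (app10 c) - \sum_al etb be (c al) * et al r).
  have -> : etb be (app10 c) = \sum_al (etb be (c al) * et al r + c al * etb be (et al r)).
    rewrite (big_morph (etb be) (etbD be) (_ : etb be 0 = 0)).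
      by apply: eq_bigr => al _; rewrite etbM.
    by apply: (addIr (etb be 0)); rewrite -etbD !add0r.
  rewrite big_split /= addrAC subrr add0r mulr_sumr; apply: eq_bigr => al _.
  by rewrite (dw_dwbC Phi0 Psi0 PsiPhi) [c al * _]mulrC mulrA.
apply: (IordMl cdD cdM II); apply: (IordB cdD cdM II); first exact: ord_dwb.
by apply: (Iord_sum cdD II) => al _; apply: (IordMl cdD cdM II); exact: ord_dw.
Qed.

Lemma lie_tame m L : odd m -> ord m.+1 r -> lie_O L -> tame m.+1 L.
Proof.
move=> modd rm; apply; split; first exact: tame_lie rm (fun a b => lev_even modd rm).
move=> _ [X XD [_ [Y YD <-] <-]].
have [_ TD _ _] := tame_lie rm (fun a b => lev_even modd rm).
by apply: TD; [exact: D10_tame|exact/tame_bar/D10_tame].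
Qed.

Hypothesis span10 : forall (P : set A) (y : 'I_d -> A), is_ideal P ->
  (forall L, lie_O L -> P (\sum_al fvf_app L (wv al) * y al)) -> forall al, P (y al).
Hypothesis span01 : forall (P : set A) (y : 'I_d -> A), is_ideal P ->
  (forall L, lie_O L -> P (\sum_al fvf_app L (cj (wv al)) * y al)) -> forall al, P (y al).

Let etb_cj al : etb al r = cj (et al r).
Proof. by rewrite (dw_cj Phi Psi) cj_rc. Qed.

(** The Lie algebra of [O] is [tame] and its (1, 0) parts span the (1, 0)
    directions of [V], so the first derivatives of [r] gain an order. *)
Lemma step_even m : odd m -> ord m.+1 r -> ord m.+2 r.
Proof.
move=> modd rm; have [Ir _] := rm.
have er al : ord m.+1 (et al r).
  refine (@span10 (ord m.+1) (fun al => et al r) (Iord_ideal cdD cdM II m.+1) _ al) => L LO.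
  by have [_ L10 _] := lie_tame modd rm LO.
by refine (ordS_dw Ir er _) => al; rewrite etb_cj; exact: ord_cj (er al).
Qed.

(** Here every pair of directions has a Levi form of odd order [m], which
    [levi_odd] raises to [m + 1]; these are the mixed derivatives. For type
    (0, 2), a field [L] of the Lie algebra maps [d r / d wbar_be] to a series
    of order [m + 1]; subtracting mixed derivatives leaves the (0, 1) part of
    [L], and (0, 1) parts span. *)
Lemma step_odd m : odd m -> ord m.+2 r -> ord m.+3 r.
Proof.
move=> modd rm; have rm1 := IordS rm; have [Ir _] := rm.
have mixed al be : ord m.+1 (et al (etb be r)).
  have -> : et al (etb be r) = lev (fun i => (i == al)%:R) (fun i => cj ((i == be)%:R : A)).
    rewrite /lev (bigD1 al) //= [X in _ + X]big1 => [|i ial]; last first.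
      by rewrite big1 // => j _; rewrite (negbTE ial) !mul0r.
    rewrite addr0 (bigD1 be) //= big1 => [|j jbe]; last first.
      by rewrite (negbTE jbe) [cj 0]raddf0 mulr0 mul0r.
    by rewrite !eqxx addr0 [cj 1]rmorph1 !mul1r.
  have a1 c : ord m.+1 (app10 c) := ord_app10 c rm.
  refine (lev_polar (b := fun i => (i == be)%:R) _ (a1 _) (a1 _)) => a _.
  refine (levi_odd modd rm1 (a1 a) _).
  apply: (Iord_sum cdD II) => i _; apply: (Iord_sum cdD II) => j _.
  by apply: (IordMl cdD cdM II); exact: ord_dw (ord_dwb _ rm).
have bb be al : ord m.+1 (etb al (etb be r)).
  refine (@span01 (ord m.+1) (fun al => etb al (etb be r)) (Iord_ideal cdD cdM II m.+1) _ al) => L LO.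
  have [LI _ _] := lie_tame modd rm1 LO.
  have -> : \sum_al fvf_app L (cj (wv al)) * etb al (etb be r) =
      tanp L (etb be r) - \sum_al fvf_app L (wv al) * et al (etb be r).
    by rewrite /tanp big_split /= addrAC subrr add0r.
  apply: (IordB cdD cdM II); first exact: ord_tanp (ord_dwb _ rm).
  by apply: (Iord_sum cdD II) => i _; exact: (IordMl cdD cdM II _ (mixed i be)).
have br be : ord m.+2 (etb be r).
  have [Ib _] := ord_dwb be rm.
  exact: (ordS_dw Ib (fun al => mixed al be) (bb be)).
refine (ordS_dw Ir _ br) => al.
by rewrite -[et al r]cjK -etb_cj; exact: ord_cj (br al).
Qed.

Lemma ord_all : ord 2 r -> forall m, ord m r.
Proof.
move=> r2 m; have H j : ord (j.*2.+2) r.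
  elim: j => [//|j IH]; rewrite doubleS.
  have jodd : odd j.*2.+1 by rewrite /= odd_double.
  exact: step_odd jodd (step_even jodd IH).
apply: IordW (H m).
by rewrite -addnn; lia.
Qed.

End OddLevi.

End Main.

(** * The Cauchy-Riemann fields span *)

Section SpanIdeal.
Context {m d : nat} {K : fieldType}.
Local Notation A := (fps m K).

Lemma coef0_prod (T : Type) (s : seq T) (F : T -> A) :
  fps_coef (\prod_(i <- s) F i) mi0 = \prod_(i <- s) fps_coef (F i) mi0.
Proof.
by apply: (big_morph (fun f : A => fps_coef f mi0)) => [f g|]; [exact: fps_coef0M|rewrite /= eqxx].
Qed.

Lemma coef0_det (M : 'M[A]_d) : (forall i j, fps_coef (M i j) mi0 = (i == j)%:R) ->
  fps_coef (\det M) mi0 = 1.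
Proof.
move=> M1; rewrite -(det1 K d) /determinant fps_coef_sum; apply: eq_bigr => s _.
rewrite fps_coef0M coef0_prod; congr (_ * _).
  case: (perm.odd_perm s); last by rewrite !expr0 /= eqxx.
  by rewrite !expr1 -[LHS]/(- (fps_coef (1 : A) mi0)) /= eqxx.
by apply: eq_bigr => i _; rewrite M1 mxE.
Qed.

(** Cramer's rule: the determinant is a unit since it is 1 at the origin. *)
Lemma span_ideal (P : set A) (M : 'I_d -> 'I_d -> A) (y : 'I_d -> A) : is_ideal P ->
    (forall i j, fps_coef (M i j) mi0 = (i == j)%:R) ->
    (forall i, P (\sum_j M i j * y j)) -> forall j, P (y j).
Proof.
move=> PI M1 My j; have [_ _ PM] := PI.
pose MM : 'M[A]_d := \matrix_(i, j) M i j; pose yc : 'cV[A]_d := \col_j y j.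
have [D DD] : exists D, \det MM * D = 1.
  apply: fps_inv; rewrite coef0_det ?oner_neq0 // => i l.
  by rewrite mxE M1.
have E : \det MM * y j = \sum_i \adj MM j i * (\sum_l M i l * y l).
  have -> : \det MM * y j = ((\det MM)%:M *m yc) j 0 by rewrite mul_scalar_mx !mxE.
  rewrite -mul_adj_mx -mulmxA mxE; apply: eq_bigr => i _; congr (_ * _).
  by rewrite mxE; apply: eq_bigr => l _; rewrite !mxE.
have -> : y j = D * (\det MM * y j) by rewrite mulrA [D * _]mulrC DD mul1r.
by apply: (PM); rewrite E; apply: is_ideal_sum => // i _; exact: PM.
Qed.

End SpanIdeal.

Section FirstOrder.
Context {m : nat} {K : comNzRingType}.
Implicit Types (f g : fps m K).

Definition d0 (i : 'I_m) f : K := fps_coef (fps_deriv i f) mi0.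

Lemma d0E i f : d0 i f = fps_coef f (mi1 i).
Proof. by rewrite /d0 fps_coef_deriv ffunE mulr1n mi_add0. Qed.

Lemma d0D i f g : d0 i (f + g) = d0 i f + d0 i g.
Proof. by rewrite /d0 raddfD. Qed.

Lemma d0M i f g : d0 i (f * g) = d0 i f * fps_coef g mi0 + fps_coef f mi0 * d0 i g.
Proof. by rewrite /d0 fps_derivM fps_coefD !fps_coef0M. Qed.

Lemma d0X i j : d0 i (fpsX j) = (i == j)%:R :> K.
Proof. by rewrite /d0 fps_derivX; case: eqP => //= _; rewrite eqxx. Qed.

Lemma d0_comp p (G : 'I_p -> fps m K) i (f : fps p K) :
  d0 i (fps_comp G f) = \sum_l d0 i (G l) * fps_coef (fps_deriv l f) mi0.
Proof.
rewrite /d0 fps_deriv_comp fps_coef_sum; apply: eq_bigr => l _.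
by rewrite fps_coef0M fps_comp_coef0.
Qed.

End FirstOrder.

Lemma manifold_ideal_coef0 m (K : fieldType) k (I : set (fps m K)) f :
  manifold_ideal k I -> I f -> fps_coef f mi0 = 0.
Proof.
move=> [F [F0 _ ->]] If; apply: (smallest_ideal_sub (J := fun f => fps_coef f mi0 = 0) _ _ If).
  split=> [//|g h g0 h0|g h h0]; first by rewrite fps_coefD g0 h0 addr0.
  by rewrite fps_coef0M h0 mulr0.
by move=> _ [j _ <-].
Qed.

Section Span.
Context {R : realType} {n k d : nat}.
Local Notation C := R[i].
Local Notation A := (fps (n + n) C).
Context (Phi : 'I_(k + d) -> fps n C) (Psi : 'I_n -> fps (k + d) C).
Hypothesis Phi0 : forall i, fps_coef (Phi i) mi0 = 0.
Hypothesis Psi0 : forall i, fps_coef (Psi i) mi0 = 0.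
Hypothesis PhiPsi : forall f, fps_comp Phi (fps_comp Psi f) = f.
Hypothesis PsiPhi : forall f, fps_comp Psi (fps_comp Phi f) = f.
Context (O : formal_submfd (n + n) R) (V : formal_submfd n C).
Hypothesis VE : forall f, fideal V f <-> (forall a : multi_index (k + d),
  (forall j, a (lshift d j) = 0%N) -> fps_coef (fps_comp Psi f) a = 0).
Local Notation wv al := (wX Phi (rshift k al)).
Implicit Types (al be : 'I_d) (l : 'I_n).

(** The holomorphic tangent vector [d / d w_al] of [V] at the origin, by its
    components in the coordinates [z]; [tanv] is the corresponding real
    vector. *)
Definition tanc al l : C := d0 (rshift k al) (Psi l).

Lemma tanc_dual al be : \sum_l tanc al l * d0 l (Phi (rshift k be)) = (al == be)%:R.
Proof.
rewrite -[RHS](_ : d0 (rshift k al) (fpsX (rshift k be)) = _); last by rewrite d0X eq_rshift.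
rewrite -[fpsX _]PsiPhi fps_compX // d0_comp.
by [].
Qed.

Lemma tanc_fideal al f : fideal V f -> \sum_l tanc al l * d0 l f = 0.
Proof.
move=> /VE Vf; rewrite -d0_comp d0E; apply: Vf => j.
by rewrite ffunE eq_lrshift.
Qed.

Lemma d0_holo_l l (h : fps n C) : d0 (lshift n l) (fps_holo h) = d0 l h.
Proof. by rewrite /d0 holo_deriv_l holo_coef0. Qed.

Lemma d0_holo_r l (h : fps n C) : d0 (rshift n l) (fps_holo h) = 'i * d0 l h.
Proof. by rewrite /d0 holo_deriv_r fps_coefZ holo_coef0. Qed.

Lemma d0_cj i (f : A) : d0 i (cj f) = conjc (d0 i f).
Proof. by rewrite /d0 -cj_deriv. Qed.

Definition tanv al : 'rV[R]_(n + n) :=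
  row_mx (\row_l complex.Re (tanc al l)) (\row_l complex.Im (tanc al l)).

Lemma tancE al l : tanc al l =
  (tanv al 0 (lshift n l))%:C + 'i * (tanv al 0 (rshift n l))%:C.
Proof.
rewrite row_mxEl row_mxEr !mxE; case: (tanc al l) => a b.
by apply/eqP; rewrite eq_complex /=; apply/andP; split; apply/eqP; ring.
Qed.

(** The complexified ideal of [V] is generated by holomorphic series and their
    conjugates. A real vector annihilates both as soon as its (1, 0) part
    annihilates the former. *)
Lemma tanv_tangent al : tangent0 (underlying_real_ideal V) (tanv al).
Proof.
move=> f Vf; pose J (F : A) := fps_coef F mi0 = 0 /\ \sum_i d0 i F * (tanv al 0 i)%:C = 0.
have Jideal : is_ideal J.
  split.
  - split=> //; rewrite big1 // => i _.
    by rewrite /d0 raddf0 mul0r.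
  - move=> F G [F0 F1] [G0 G1]; split; first by rewrite fps_coefD F0 G0 addr0.
    transitivity (\sum_i d0 i F * (tanv al 0 i)%:C + \sum_i d0 i G * (tanv al 0 i)%:C);
      last by rewrite F1 G1 addr0.
    by rewrite -big_split; apply: eq_bigr => i _; rewrite d0D mulrDl.
  move=> F G [G0 G1]; split; first by rewrite fps_coef0M G0 mulr0.
  transitivity (fps_coef F mi0 * \sum_i d0 i G * (tanv al 0 i)%:C); last by rewrite G1 mulr0.
  rewrite mulr_sumr; apply: eq_bigr => i _.
  by rewrite d0M G0 mulr0 add0r mulrA.
have Jholo h : fideal V h -> J (fps_holo h).
  move=> Vh; split; first by rewrite holo_coef0; exact: (manifold_ideal_coef0 (fidealP V) Vh).
  rewrite big_split_ord /= -big_split -[RHS](tanc_fideal al Vh); apply: eq_bigr => l _.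
  rewrite d0_holo_l d0_holo_r tancE /=.
  by move: (d0 l h) (_%:C) (_%:C) => x y z; ring.
have Jcj F : J F -> J (cj F).
  move=> [F0 F1]; split; first by rewrite -[LHS]/(conjc (fps_coef F mi0)) F0 rmorph0.
  transitivity (conjc (\sum_i d0 i F * (tanv al 0 i)%:C)); last by rewrite F1 rmorph0.
  rewrite rmorph_sum; apply: eq_bigr => i _.
  by rewrite d0_cj rmorphM /= oppr0.
have [_ Jf] : J (rc f).
  apply: (smallest_ideal_sub Jideal _ Vf) => F [] [h Vh <-]; first exact: Jholo.
  exact: Jcj (Jholo _ Vh).
have := congr1 (@complex.Re R) Jf; rewrite raddf_sum => E; rewrite -[RHS]E.
apply: eq_bigr => i _; rewrite d0E /rc /fps_diff0 mxE /=.
by ring.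
Qed.

Hypothesis O_generic : [set xi + Jmap eta | xi in tangent0 (fideal O)
                                    & eta in tangent0 (fideal O)] =
                 tangent0 (underlying_real_ideal V).
Hypothesis O_type : finite_commutator_type O.

Lemma coef0_fvf_app (L : formal_vf (n + n) C) f :
  fps_coef (fvf_app L f) mi0 = \sum_i fvf_value0 L 0 i * d0 i f.
Proof. by rewrite fps_coef_sum; apply: eq_bigr => i _; rewrite fps_coef0M mxE. Qed.

(** By genericity every tangent vector of [V] is [xi + J eta] with [xi] and [eta]
    tangent to [O]; it has the same (1, 0) part as [xi + i eta], which by the
    finite type condition is the value of a field of the Lie algebra. *)
Lemma span_vectors (conjugate : bool) al : exists2 L, lie_O O L &
  forall be, fps_coef (fvf_app L (if conjugate then cj (wv be) else wv be)) mi0 = (al == be)%:R.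
Proof.
have := tanv_tangent al; rewrite -O_generic => -[xi xiO [et etO E]].
(* for the (0, 1) direction take the conjugate vector [xi - i eta] *)
pose sg : R := if conjugate then -1 else 1.
pose v : 'rV[C]_(n + n) := \row_i (xi 0 i +i* (sg * et 0 i))%C.
have vT : complexify_space (tangent0 (fideal O)) v.
  split=> f fO.
    rewrite -[RHS](xiO f fO); apply: eq_bigr => i _.
    by rewrite !mxE.
  transitivity (sg * \sum_i fps_diff0 f 0 i * et 0 i); last by rewrite (etO f fO) mulr0.
  rewrite mulr_sumr; apply: eq_bigr => i _.
  by rewrite !mxE /=; ring.
move: vT; rewrite -O_type => -[L LL Lv]; exists L => // be.
have Ex l : xi 0 (lshift n l) - et 0 (rshift n l) = tanv al 0 (lshift n l).
  by rewrite -E /Jmap mxE row_mxEl !mxE.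
have Ey l : xi 0 (rshift n l) + et 0 (lshift n l) = tanv al 0 (rshift n l).
  by rewrite -E /Jmap mxE row_mxEr !mxE.
rewrite coef0_fvf_app Lv big_split_ord /= -big_split /=.
have vl l : v 0 (lshift n l) = (xi 0 (lshift n l) +i* (sg * et 0 (lshift n l)))%C by rewrite mxE.
have vr l : v 0 (rshift n l) = (xi 0 (rshift n l) +i* (sg * et 0 (rshift n l)))%C by rewrite mxE.
move: vl vr; rewrite /sg => vl vr {Lv}; clearbody v; clear sg; move: vl vr.
case: conjugate => vl vr.
  have -> : (al == be)%:R = conjc ((al == be)%:R : C) by rewrite rmorph_nat.
  rewrite -tanc_dual rmorph_sum; apply: eq_bigr => l _.
  rewrite !d0_cj d0_holo_l d0_holo_r vl vr tancE -Ex -Ey.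
  case: (d0 l _) => a b.
  by apply/eqP; rewrite eq_complex /=; apply/andP; split; apply/eqP; ring.
rewrite -tanc_dual; apply: eq_bigr => l _.
rewrite d0_holo_l d0_holo_r vl vr tancE -Ex -Ey.
case: (d0 l _) => a b.
by apply/eqP; rewrite eq_complex /=; apply/andP; split; apply/eqP; ring.
Qed.

Lemma span_lie (conjugate : bool) (P : set A) (y : 'I_d -> A) : is_ideal P ->
  (forall L, lie_O O L ->
    P (\sum_al fvf_app L (if conjugate then cj (wv al) else wv al) * y al)) ->
  forall al, P (y al).
Proof.
move=> PI H; have /choice[L LE] : forall al, exists L, lie_O O L /\ forall be,
    fps_coef (fvf_app L (if conjugate then cj (wv be) else wv be)) mi0 = (al == be)%:R.
  by move=> al; have [L L1 L2] := span_vectors conjugate al; exists L.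
apply: (span_ideal (M := fun al be => fvf_app (L al) (if conjugate then cj (wv be) else wv be))) => //.
  by move=> al be; have [_ ->] := LE al.
by move=> al; apply: H; have [] := LE al.
Qed.

End Span.

(** * The tangential derivatives of a defining function vanish *)

Section Contact.
Context {R : realType} {n k d : nat}.
Local Notation C := R[i].
Local Notation A := (fps (n + n) C).
Context (Phi : 'I_(k + d) -> fps n C) (Psi : 'I_n -> fps (k + d) C).
Hypothesis Phi0 : forall i, fps_coef (Phi i) mi0 = 0.
Hypothesis Psi0 : forall i, fps_coef (Psi i) mi0 = 0.
Hypothesis PhiPsi : forall f, fps_comp Phi (fps_comp Psi f) = f.
Hypothesis PsiPhi : forall f, fps_comp Psi (fps_comp Phi f) = f.
Context (O : formal_submfd (n + n) R) (V : formal_submfd n C).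
Hypothesis VE : forall f, fideal V f <-> (forall a : multi_index (k + d),
  (forall j, a (lshift d j) = 0%N) -> fps_coef (fps_comp Psi f) a = 0).
Hypothesis OV : formally_contained (fideal O) (underlying_real_ideal V).
Hypothesis O_generic : [set xi + Jmap eta | xi in tangent0 (fideal O)
                                    & eta in tangent0 (fideal O)] =
                 tangent0 (underlying_real_ideal V).
Hypothesis O_type : finite_commutator_type O.
Local Notation I := (complexify (fideal O)).
Local Notation wv al := (wX Phi (rshift k al)).
Implicit Types (L M : formal_vf (n + n) C).

Let II : is_ideal I := complexify_ideal (idealO O).

Lemma normal_fideal (j : 'I_k) : fideal V (Phi (lshift d j)).
Proof.
apply/VE => a a0; rewrite -[Phi _]fps_compX // PsiPhi /=.
case: eqP => // aE; have := a0 j.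
by rewrite aE ffunE eqxx.
Qed.

Lemma complexified_ideal_reim f : fideal V f ->
  complexified_ideal V (rc (reS (fps_holo f))) /\ complexified_ideal V (rc (imS (fps_holo f))).
Proof.
move=> Vf; have [_ VD VM] := smallest_ideal ((@fps_holo R n @` fideal V) `|`
     ((fun f => fps_map conjc (fps_holo f)) @` fideal V)).
have h1 : complexified_ideal V (fps_holo f) by apply: smallest_ideal_gen; left; exists f.
have h2 : complexified_ideal V (cj (fps_holo f)) by apply: smallest_ideal_gen; right; exists f.
rewrite rc_reS rc_imS -[- cj _]mulN1r.
by split; rewrite fcstE; apply: (VM); apply: VD => //; apply: (VM).
Qed.

Lemma normal_complexify (j : 'I_k) : I (wX Phi (lshift d j)).
Proof.
have [h1 h2] := complexified_ideal_reim (normal_fideal j).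
by apply/complexifyP; split; apply: OV.
Qed.

Lemma preserves_lie (J : set A) : is_ideal J -> is_lie_algebra [set L | preserves L J].
Proof.
move=> [J0 JD JM]; split.
- by move=> f _; rewrite -(scale0r (0 : formal_vf (n + n) C)) fvf_appZl mul0r.
- by move=> L M LJ MJ f Jf; rewrite fvf_appDl; apply: JD; [exact: LJ|exact: MJ].
- by move=> c L LJ f Jf; rewrite fvf_appZl; apply: JM; exact: LJ.
move=> L M LJ MJ f Jf; rewrite fvf_app_bracket -mulN1r; apply: JD; first exact: LJ (MJ _ Jf).
by apply: JM; exact: MJ (LJ _ Jf).
Qed.

Lemma lie_preserves L : lie_O O L -> preserves L I.
Proof.
move=> LO; refine (LO [set L | preserves L I] _); split; first exact: preserves_lie.
have [_ PD _ _] := preserves_lie II.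
move=> _ [X [_ XI] [_ [Y [_ YI] <-] <-]]; apply: PD => //.
exact: preserves_Lbar.
Qed.

Definition reL L : formal_vf (n + n) R := map_mx (@reS R (n + n)) L.
Definition imL L : formal_vf (n + n) R := map_mx (@imS R (n + n)) L.

Lemma fvf_app_reim L f : fvf_app L (rc f) = rc (fvf_app (reL L) f) + 'i *: rc (fvf_app (imL L) f).
Proof.
have rc_sum (F : 'I_(n + n) -> fps (n + n) R) : rc (\sum_i F i) = \sum_i rc (F i).
  exact: raddf_sum.
have rcM (g h : fps (n + n) R) : rc (g * h) = rc g * rc h by exact: rmorphM.
rewrite /fvf_app !rc_sum scaler_sumr -big_split; apply: eq_bigr => i _ /=.
rewrite !rcM /rc fps_map_deriv -!/(rc _) {1}[L 0 i]reS_imS mulrDl -scalerAl.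
by rewrite [reL L 0 i]mxE [imL L 0 i]mxE.
Qed.

Lemma reS_rcD (f g : fps (n + n) R) : reS (rc f + 'i *: rc g) = f /\ imS (rc f + 'i *: rc g) = g.
Proof. by split; apply: fps_ext => a /=; ring. Qed.

Lemma I_reim (f g : fps (n + n) R) : I (rc f + 'i *: rc g) <-> fideal O f /\ fideal O g.
Proof. by have [e1 e2] := reS_rcD f g; rewrite complexifyP e1 e2. Qed.

Lemma preserves_reim L : preserves L I -> DO O (reL L) /\ DO O (imL L).
Proof.
move=> LI; split=> f Of; have := LI (rc f); rewrite fvf_app_reim => H;
  by have /I_reim[] := H (proj2 (I_rc O f) Of).
Qed.

Lemma Jmap_reim L : reL (Jmap L) = Jmap (reL L) /\ imL (Jmap L) = Jmap (imL L).
Proof.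
split; apply/rowP => i; rewrite mxE !JmapE /Jf; case: fintype.split => j; rewrite mxE //;
  by apply: fps_ext => a /=; rewrite raddfN.
Qed.

Lemma app10_Jmap L f : \sum_l fvf_app L (zX l) * dz l f =
  (2^-1 : C) *: (fvf_app L f - 'i *: fvf_app (Jmap L) f).
Proof.
have [i2 h2] := @constP R n.
rewrite /fvf_app !big_split_ord /= !fcstE -!big_split mulr_sumr -sumrB mulr_sumr.
apply: eq_bigr => l _ /=; rewrite -/(fvf_app _ _) /zX fvf_appD fvf_appZ !fvf_appX /dz !fcstE.
rewrite !JmapE /Jf (unsplitK (inl l)) (unsplitK (inr l)).
by ring: i2.
Qed.

Section Defining.
Context (S : set 'rV[R]_(n + n)) (r : 'rV[R]_(n + n) -> R).
Hypothesis S_psc : pseudoconvex S.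
Hypothesis S0 : S 0.
Hypothesis dr : defining_function S 0 r.
Hypothesis OS : formally_contained (fideal O) (jet_ideal S).
Hypothesis O_tangential : sub_mod (DO O) (jet_HS S) (fideal O).
Local Notation rho := (taylor0 r).

Lemma jet_ideal_r : jet_ideal S rho.
Proof. by exists r => //; split; [have [] := dr|exact: defining_function_vanishes dr]. Qed.

(** Modulo the ideal [L] is the jet of a section of [HS], and [J] preserves
    [HS]. *)
Lemma Jmap_app_r (L : formal_vf (n + n) R) : DO O L -> fideal O (fvf_app (Jmap L) rho).
Proof.
move=> /O_tangential[M MH LM]; have [_ MD MM] := idealO O.
have [_ /OS JM] := jet_HS_app S0 dr MH.
have -> : fvf_app (Jmap L) rho = fvf_app (Jmap M) rho + fvf_app (Jmap (L - M)) rho.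
  rewrite -fvf_appDl; congr fvf_app; apply/rowP => i.
  rewrite [RHS]mxE !JmapE /Jf; case: fintype.split => j; rewrite !mxE; ring.
apply: MD => //; apply: is_ideal_sum; first exact: idealO.
move=> i _; rewrite mulrC; apply: (MM); rewrite JmapE /Jf; case: fintype.split => j //.
by rewrite -mulN1r; apply: MM.
Qed.

(** The (1, 0) part of a field [L] of the Lie algebra of [O] is
    [(L - i J L) / 2], so it maps [r] into the ideal because [L] is tangent to
    [O] and complex tangential to [S]. These parts span the (1, 0) directions
    of [V]. *)
Lemma contact_order2 : Iord (cd Phi Psi) I 2 (rc rho).
Proof.
have rO : fideal O rho := OS jet_ideal_r.
have rI : I (rc rho) by apply/I_rc.
have [_ ID IM] := II.
have er al : I (dw Phi Psi (rshift k al) (rc rho)).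
  refine (@span_lie _ _ _ _ Phi Psi Phi0 PsiPhi O V VE O_generic O_type false I
    (fun al => dw Phi Psi (rshift k al) (rc rho)) II _ al) => L LO.
  have LI := lie_preserves LO; have [L1 L2] := preserves_reim LI.
  have JL : I (fvf_app (Jmap L) (rc rho)).
    rewrite fvf_app_reim; have [-> ->] := Jmap_reim L.
    by apply/I_reim; split; exact: Jmap_app_r.
  have := app10_Jmap L (rc rho); rewrite (fvf_app10 Phi0 Psi0 PhiPsi) big_split_ord /= => E.
  have -> : \sum_al fvf_app L (wv al) * dw Phi Psi (rshift k al) (rc rho) =
      (2^-1 : C) *: (fvf_app L (rc rho) - 'i *: fvf_app (Jmap L) (rc rho)) +
      -1 * \sum_j fvf_app L (wX Phi (lshift d j)) * dw Phi Psi (lshift d j) (rc rho).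
    by rewrite -E mulN1r addrAC subrr add0r.
  apply: (ID).
    rewrite !fcstE -mulN1r; apply: (IM); apply: (ID); first exact: LI.
    by do 2 apply: (IM).
  apply: (IM); refine (is_ideal_sum _ II _) => j _; rewrite mulrC; apply: (IM).
  exact: LI (normal_complexify j).
have o1 g : I g -> Iord (cd Phi Psi) I 1 g by [].
refine (ordS_dw Phi0 Psi0 PhiPsi _ _ _) => [//|al|al]; apply: o1; first exact: er.
have -> : dwb Phi Psi (rshift k al) (rc rho) = cj (dw Phi Psi (rshift k al) (rc rho)).
  by rewrite (dw_cj Phi Psi) cj_rc.
exact: complexify_cj (idealO O) (er al).
Qed.

Lemma grad_neq0 : exists i, fps_coef (fps_deriv i rho) mi0 != 0.
Proof.
have [r0 _ [i ri]] := dr; exists i.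
by rewrite -taylor0_partial // taylor0_coef0.
Qed.

(** The derivatives in question are values at the origin of elements of the
    ideal of [O], by [ord_all]. *)
Lemma contact_vanish a : supported (@vdir k d) a ->
  fps_coef (fps_comp (realify Psi) rho) a = 0.
Proof.
have [eps eps0 pos] := formal_levi S_psc S0 dr.
have span b := @span_lie _ _ _ _ Phi Psi Phi0 PsiPhi O V VE O_generic O_type b.
have ordm := ord_all Phi0 Psi0 PhiPsi PsiPhi grad_neq0 eps0 pos normal_complexify
  (span false) (span true) contact_order2.
apply: coef_derivs => s.
have -> : foldr (fun j => fps_deriv (vdir j)) (fps_comp (realify Psi) rho) s =
    fps_comp (realify Psi) (foldr (cdR Phi Psi) rho s).
  elim: s => [//|j s IH] /=; rewrite IH.
  exact/esym/(realify_PsiPhi Phi0 Psi0 PsiPhi).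
rewrite fps_comp_coef0; apply: manifold_ideal_coef0 (fidealP O) _.
have /ord_rc/Iord_foldr := ordm (size s).+1; apply.
exact: ltnSn.
Qed.

End Defining.
End Contact.

(** * Formal inclusion of [V] *)

Section Inclusion.
Context {R : realType} {n k d : nat}.
Local Notation C := R[i].
Context (Phi : 'I_(k + d) -> fps n C) (Psi : 'I_n -> fps (k + d) C).
Hypothesis Phi0 : forall i, fps_coef (Phi i) mi0 = 0.
Hypothesis Psi0 : forall i, fps_coef (Psi i) mi0 = 0.
Hypothesis PhiPsi : forall f, fps_comp Phi (fps_comp Psi f) = f.
Hypothesis PsiPhi : forall f, fps_comp Psi (fps_comp Phi f) = f.
Context (V : formal_submfd n C).
Hypothesis VE : forall f, fideal V f <-> (forall a : multi_index (k + d),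
  (forall j, a (lshift d j) = 0%N) -> fps_coef (fps_comp Psi f) a = 0).

(** The real and imaginary parts of the coordinates [w_j] with [j < k]. *)
Definition normal (i : 'I_((k + d) + (k + d))) : bool := `[< forall j, i <> @vdir k d j >].

Lemma normal_decomp (g : fps ((k + d) + (k + d)) R) :
    (forall a, supported (@vdir k d) a -> fps_coef g a = 0) ->
  exists h : 'I_((k + d) + (k + d)) -> fps ((k + d) + (k + d)) R,
    g = \sum_(i | normal i) fpsX i * h i.
Proof.
move=> g0; apply: coordinate_ideal => a a0; apply: g0 => i ai.
apply: contrapT => ie; move: ai; rewrite a0 //; apply/asboolP => j ij.
by apply: ie; exists j.
Qed.

Lemma normal_coord i : normal i -> complexified_ideal V (rc (realify Phi i)).
Proof.
move=> /asboolP ni; rewrite /realify; case: (split_ordP i) ni => l ->;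
  case: (split_ordP l) => j -> ni.
- by have [] := complexified_ideal_reim (normal_fideal Phi0 PsiPhi VE j).
- by case: (ni (inl j)).
- by have [] := complexified_ideal_reim (normal_fideal Phi0 PsiPhi VE j).
- by case: (ni (inr j)).
Qed.

(** In the chart such a series is a combination of the normal coordinates,
    which are real and imaginary parts of elements of the ideal of [V]. *)
Lemma vanish_underlying (f : fps (n + n) R) :
    (forall a, supported (@vdir k d) a -> fps_coef (fps_comp (realify Psi) f) a = 0) ->
  underlying_real_ideal V f.
Proof.
move=> /normal_decomp[h hE]; rewrite /underlying_real_ideal /=.
rewrite -[f](realify_PhiPsi Phi0 Psi0 PhiPsi) hE fps_comp_sum.
have [_ _ VM] := smallest_ideal ((@fps_holo R n @` fideal V) `|`
     ((fun f => fps_map conjc (fps_holo f)) @` fideal V)).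
rewrite -/(rc _) (_ : rc _ = \sum_(i | normal i) rc (fps_comp (realify Phi) (fpsX i * h i))).
  apply: is_ideal_sum; first exact: smallest_ideal.
  move=> i ni; rewrite fps_compM fps_compX ?realify_coef0 // mulrC.
  rewrite (_ : rc _ = rc (fps_comp (realify Phi) (h i)) * rc (realify Phi i)); last exact: rmorphM.
  by apply: (VM); exact: normal_coord.
exact: raddf_sum.
Qed.

(** If a function vanishing on [S] had a nonzero derivative along [V], its jet
    would be nonzero on a formal curve in [V] by [line_detects]. But [r],
    hence by [jets_vanishing] this function, vanishes to infinite order on
    such curves. *)
Lemma jet_inclusion (S : set 'rV[R]_(n + n)) r : S 0 -> defining_function S 0 r ->
    (forall a, supported (@vdir k d) a -> fps_coef (fps_comp (realify Psi) (taylor0 r)) a = 0) ->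
  formally_contained (underlying_real_ideal V) (jet_ideal S).
Proof.
move=> S0 dr r0 _ [f [f0 fS] <-]; apply: vanish_underlying => a aV.
apply/eqP/negPn/negP => fa.
have [c [c0 cI /eqP cf]] := line_detects (fun i => realify_coef0 i Psi0) aV fa.
apply: cf; apply: ord_ge_eq0 => m; apply: (jets_vanishing S0 dr c0 f0 fS).
by rewrite (cI _ r0); exact: ord_ge_zero.
Qed.

End Inclusion.

(** * Holomorphic curves of high contact *)

Lemma scalel_differentiable (K : numFieldType) (V : normedModType K) (w : V) (z : K) :
  differentiable (fun x : K => x *: w) z.
Proof. by case: (is_diff_scalel z w). Qed.

Section Curve.
Context {R : realType}.
Local Notation C := (complex_field R).

Section Germ.
Context {n : nat} (N : nat) (v : nat -> 'rV[C]_n).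

Definition poly_germ (z : C) : 'rV[C]_n := \sum_(i < N.+2) z ^+ i *: v i.

Lemma monomial_differentiable (i : nat) (w : 'rV[C]_n) (z : C) :
  differentiable (fun z : C => z ^+ i *: w) z.
Proof.
apply: (@differentiable_comp _ _ _ _ (fun z : C => z ^+ i) (fun x : C => x *: w)).
  exact/derivable1_diffP/exprn_derivable.
exact: scalel_differentiable.
Qed.

Lemma poly_germ_differentiable (M : nat) (w : nat -> 'rV[C]_n) (z : C) :
  differentiable (fun z : C => \sum_(i < M) z ^+ i *: w i) z.
Proof.
rewrite (_ : (fun z => _) = \sum_(i < M) (fun z : C => z ^+ i *: w i)).
  by apply: differentiable_sum => i; exact: monomial_differentiable.
by apply/funext => x; rewrite fct_sumE.
Qed.

Lemma poly_germ_immersion : v 0%N = 0 -> v 1%N != 0 -> holomorphic_immersion_germ poly_germ.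
Proof.
move=> v0 v1; split.
- by near=> z; exact/derivable1_diffP/poly_germ_differentiable.
- rewrite /poly_germ big_ord_recl /= expr0 scale1r v0 add0r big1 // => i _.
  by rewrite exprS mul0r scale0r.
pose g (z : C) : 'rV[C]_n := \sum_(i < N.+1) z ^+ i *: v i.+1.
have gE z : poly_germ z = z *: g z.
  rewrite /poly_germ big_ord_recl expr0 scale1r v0 add0r scaler_sumr.
  by apply: eq_bigr => i _; rewrite scalerA -exprS.
have gc : {for 0, continuous g}.
  apply: differentiable_continuous.
  exact: (poly_germ_differentiable N.+1 (fun i => v i.+1) 0).
have g0 : g 0 = v 1%N.
  rewrite /g big_ord_recl expr0 scale1r big1 ?addr0 // => i _.
  by rewrite exprS mul0r scale0r.
suff -> : 'D_1 poly_germ 0 = v 1%N by [].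
apply: cvg_lim; [exact: norm_hausdorff|rewrite -g0].
have gd : g z @[z --> (0:C)^'] --> g 0 by apply: cvg_trans gc; apply: cvg_app; exact: cvg_within.
apply: cvg_trans gd; apply: near_eq_cvg; near=> z.
have z0 : z != 0 by near: z; exact: nbhs_dnbhs_neq.
by rewrite /= !gE scale0r subr0 addr0 [z *: 1]mulr1 scalerA mulVf // scale1r.
Unshelve. all: by end_near. Qed.

End Germ.
End Curve.

Section ComplexJets.
Context {R : realType} {m : nat}.
Local Notation C := R[i].
Implicit Types (g h : 'rV[R]_m -> C) (G H : fps m C).

(** Jets of complex-valued functions, by real and imaginary parts. *)
Definition has_cjet g G : Prop :=
  has_jet (@complex.Re R \o g) (reS G) /\ has_jet (@complex.Im R \o g) (imS G).

Lemma has_cjet_eq g h G : g =1 h -> has_cjet g G -> has_cjet h G.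
Proof. by move=> /funext ->. Qed.

Lemma has_cjetD g h G H : has_cjet g G -> has_cjet h H -> has_cjet (fun x => g x + h x) (G + H).
Proof.
move=> [g1 g2] [h1 h2]; split.
  have -> : @complex.Re R \o (fun x => g x + h x) =
      fun x => (@complex.Re R \o g) x + (@complex.Re R \o h) x.
    by apply/funext => x; exact: raddfD.
  have -> : reS (G + H) = reS G + reS H by apply: fps_ext => a; exact: raddfD.
  exact: has_jetD.
have -> : @complex.Im R \o (fun x => g x + h x) =
    fun x => (@complex.Im R \o g) x + (@complex.Im R \o h) x.
  by apply/funext => x; exact: raddfD.
have -> : imS (G + H) = imS G + imS H by apply: fps_ext => a; exact: raddfD.
exact: has_jetD.
Qed.

Lemma has_cjetM g h G H : has_cjet g G -> has_cjet h H -> has_cjet (fun x => g x * h x) (G * H).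
Proof.
move=> [g1 g2] [h1 h2]; rewrite /has_cjet; have [-> ->] := reim_mul G H; split.
  have -> : @complex.Re R \o (fun x => g x * h x) = fun x =>
      (@complex.Re R \o g) x * (@complex.Re R \o h) x - (@complex.Im R \o g) x * (@complex.Im R \o h) x.
    by apply/funext => x /=; case: (g x) (h x) => [a b] [c d].
  by apply: has_jetB; apply: has_jetM.
have -> : @complex.Im R \o (fun x => g x * h x) = fun x =>
    (@complex.Re R \o g) x * (@complex.Im R \o h) x + (@complex.Im R \o g) x * (@complex.Re R \o h) x.
  by apply/funext => x /=; case: (g x) (h x) => [a b] [c d].
by apply: has_jetD; apply: has_jetM.
Qed.

Lemma has_cjet_cst (c : C) : has_cjet (fun=> c) (c%:A).
Proof.
have e1 : reS (c%:A : fps m C) = (complex.Re c)%:A.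
  by apply: fps_ext => a /=; case: (_ == _); case: c => x y /=; ring.
have e2 : imS (c%:A : fps m C) = (complex.Im c)%:A.
  by clear e1; apply: fps_ext => a /=; case: (_ == _); case: c => x y /=; ring.
by split; rewrite ?e1 ?e2; exact: has_jet_cst.
Qed.

Lemma has_cjetX g G j : has_cjet g G -> has_cjet (fun x => g x ^+ j) (G ^+ j).
Proof.
move=> gG; elim: j => [|j IH].
  by rewrite expr0 -[1]scale1r; exact: has_cjet_cst.
rewrite exprS; apply: has_cjet_eq (has_cjetM gG IH) => x.
by rewrite exprS.
Qed.

Lemma has_cjet_sum (s : seq nat) (F : nat -> 'rV[R]_m -> C) (FF : nat -> fps m C) :
  (forall i, has_cjet (F i) (FF i)) ->
  has_cjet (fun x => \sum_(i <- s) F i x) (\sum_(i <- s) FF i).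
Proof.
move=> FH; elim: s => [|i s IH].
  have z : (0 : fps m C) = 0%:A by rewrite scale0r.
  rewrite big_nil z; apply: has_cjet_eq (has_cjet_cst 0) => x.
  by rewrite big_nil.
rewrite big_cons; apply: has_cjet_eq (has_cjetD (FH i) IH) => x.
by rewrite big_cons.
Qed.

End ComplexJets.

Section Pullback.
Context {R : realType} {n : nat}.
Local Notation C := R[i].

Lemma has_cjet_coord :
  has_cjet (fun u : 'rV[R]_(1 + 1) => u 0 (lshift 1 0) +i* u 0 (rshift 1 0))%C (@zX R 1 0).
Proof.
have zE : @zX R 1 0 = rc (fpsX (lshift 1 0)) + 'i *: rc (fpsX (rshift 1 0)).
  by rewrite /zX /rc !fps_mapX.
rewrite /has_cjet; have [-> ->] : reS (@zX R 1 0) = fpsX (lshift 1 0) /\ imS (@zX R 1 0) = fpsX (rshift 1 0).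
  by rewrite zE; exact: reS_rcD.
by split; exact: has_jet_coord.
Qed.

(** In the parameter [x + i y] the curve has the real and imaginary parts of
    the polynomials as its own Taylor series; the rest is the expansion of
    composites. *)
Lemma taylor0_pullback (r : 'rV[R]_(n + n) -> R) N (c : 'I_n -> fps 1 C) :
    (forall l, fps_coef (c l) mi0 = 0) -> smooth_near 0 r ->
  taylor0 (pullback r (poly_germ N (fun i => \row_l cf i (c l)))) =
  fps_comp (realify (fun l => \sum_(i < N.+2) cf i (c l) *: sX ^+ i)) (taylor0 r).
Proof.
move=> c0 r0; set p := fun l => \sum_(i < N.+2) _.
pose z (u : 'rV[R]_(1 + 1)) : C := (u 0 (lshift 1 0) +i* u 0 (rshift 1 0))%C.
pose G (u : 'rV[R]_(1 + 1)) := real_point (poly_germ N (fun i => \row_l cf i (c l)) (z u)).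
have pjet l : has_cjet (fun u => \sum_(i < N.+2) z u ^+ i * cf i (c l)) (fps_holo (p l)).
  have -> : fps_holo (p l) = \sum_(0 <= i < N.+2) (zX 0) ^+ i * (cf i (c l))%:A.
    rewrite holoE fps_comp_sum big_mkord; apply: eq_bigr => i _.
    rewrite fps_compZ rmorphXn /= fps_compX ?zX_coef0 // -fps_scaleAr mulr1.
    by [].
  have E u : \sum_(0 <= i < N.+2) z u ^+ i * cf i (c l) = \sum_(i < N.+2) z u ^+ i * cf i (c l).
    by rewrite big_mkord.
  apply: (has_cjet_eq E); apply: has_cjet_sum => i.
  by apply: has_cjetM; [apply: has_cjetX; exact: has_cjet_coord|exact: has_cjet_cst].
have GE u l : poly_germ N (fun i => \row_l cf i (c l)) (z u) 0 l =
    \sum_(i < N.+2) z u ^+ i * cf i (c l).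
  by rewrite /poly_germ summxE; apply: eq_bigr => i _; rewrite !mxE.
have Gj i : has_jet (fun u => G u 0 i) (realify p i).
  rewrite /realify; case: (split_ordP i) => l ->.
    have [h _] := pjet l; apply: has_jet_eq (erefl _) h.
    by apply: near_all => u; rewrite /G /real_point row_mxEl mxE GE.
  have [_ h] := pjet l; apply: has_jet_eq (erefl _) h.
  by apply: near_all => u; rewrite /G /real_point row_mxEr mxE GE.
have G0 : G 0 = 0.
  apply/rowP => i; rewrite [RHS]mxE; transitivity ((fun u => G u 0 i) 0); first by [].
  rewrite -(taylor0_coef0 (fun u => G u 0 i)).
  have [_ ->] := Gj i; apply: realify_coef0 => l.
  rewrite -[LHS]/(fps_coef (p l) mi0) (_ : mi0 = mi_one 0); last by apply/ffunP => j; rewrite !ffunE.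
  rewrite -/(cf 0 _) /p (cf_poly N.+2 (fun i => cf i (c l))) /=.
  by rewrite /cf -[RHS](c0 l); congr fps_coef; apply/ffunP => j; rewrite !ffunE.
by have [_] := has_jet_comp G0 (has_jet_taylor r0) Gj.
Qed.

End Pullback.

Section HighContact.
Context {R : realType} {n k d : nat}.
Local Notation C := R[i].
Context (Phi : 'I_(k + d) -> fps n C) (Psi : 'I_n -> fps (k + d) C).
Hypothesis Phi0 : forall i, fps_coef (Phi i) mi0 = 0.
Hypothesis Psi0 : forall i, fps_coef (Psi i) mi0 = 0.
Hypothesis PsiPhi : forall f, fps_comp Psi (fps_comp Phi f) = f.
Context (r : 'rV[R]_(n + n) -> R) (r0 : smooth_near 0 r).
Hypothesis contact : forall a, supported (@vdir k d) a ->
  fps_coef (fps_comp (realify Psi) (taylor0 r)) a = 0.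
Context (al : 'I_d).

Let Z (i : 'I_(k + d)) : fps 1 C := (i == rshift k al)%:R *: sX.

Definition axis_curve (l : 'I_n) : fps 1 C := fps_comp Z (Psi l).

Lemma axis_curve0 l : fps_coef (axis_curve l) mi0 = 0.
Proof. by rewrite fps_comp_coef0. Qed.

Lemma cf0E (u : fps 1 C) : cf 0 u = fps_coef u mi0.
Proof. by congr fps_coef; apply/ffunP => j; rewrite !ffunE. Qed.

Lemma axis_curve1 l : cf 1 (axis_curve l) = tanc Psi al l.
Proof.
have -> : cf 1 (axis_curve l) = d0 0 (axis_curve l).
  by rewrite d0E; congr fps_coef; apply/ffunP => j; rewrite !ffunE ord1 eqxx.
rewrite d0_comp (bigD1 (rshift k al)) //= big1 ?addr0 => [|i ial].
  by rewrite /Z eqxx scale1r d0X eqxx mul1r.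
by rewrite /Z (negbTE ial) scale0r /d0 raddf0 mul0r.
Qed.

(** The curve lies in [V], where the normal coordinates vanish, and [r] is a
    combination of normal coordinates in the chart. *)
Lemma axis_contact : fps_comp (realify axis_curve) (taylor0 r) = 0.
Proof.
have Z0 i : fps_coef (Z i) mi0 = 0 by rewrite fps_coefZ fpsX_coef0 mulr0.
apply: rc_inj; rewrite rc_comp_realify [RHS]raddf0.
have -> : sharp axis_curve (rc (taylor0 r)) = sharp Z (sharp Psi (rc (taylor0 r))).
  by rewrite sharp_sharp.
rewrite -(rc_comp_realify Psi) -(rc_comp_realify Z).
have [h ->] := normal_decomp contact.
rewrite fps_comp_sum big1 => [|i /asboolP ni]; first exact: raddf0.
rewrite fps_compM fps_compX ?realify_coef0 // (_ : realify Z i = 0) ?mul0r //.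
have holoZ j : fps_holo (Z (lshift d j)) = 0.
  by rewrite /Z eq_lrshift scale0r holoE; exact: raddf0.
rewrite /realify; case: (split_ordP i) ni => l ->; case: (split_ordP l) => j -> ni.
- by rewrite holoZ; exact: fps_ext.
- by case: (ni (inl j)).
- by rewrite holoZ; exact: fps_ext.
- by case: (ni (inr j)).
Qed.

(** Truncate [axis_curve] to the degrees up to [N + 1], which include the
    linear term for every [N]. Its tangent vector at the origin is that of the
    coordinate [w_al], hence nonzero, and contact up to order [N] is not
    affected by the truncation. *)
Lemma high_contact N : exists2 gamma : complex_field R -> 'rV[complex_field R]_n,
  holomorphic_immersion_germ gamma &
  forall a, (mi_deg a < N)%N -> fps_coef (taylor0 (pullback r gamma)) a = 0.
Proof.
exists (poly_germ N (fun i => \row_l cf i (axis_curve l))).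
  apply: poly_germ_immersion.
    by apply/rowP => l; rewrite !mxE cf0E axis_curve0.
  apply/eqP => /rowP v1; have /eqP := tanc_dual Phi0 PsiPhi al al.
  rewrite big1 ?eqxx => [|l _]; first by rewrite eq_sym oner_eq0.
  by have := v1 l; rewrite !mxE axis_curve1 => ->; rewrite mul0r.
rewrite (taylor0_pullback _ axis_curve0 r0); set p := fun l => \sum_(i < N.+2) _.
suff : ord_ge N (fps_comp (realify p) (taylor0 r) - fps_comp (realify axis_curve) (taylor0 r)).
  by rewrite axis_contact subr0.
apply: ord_ge_compB => i.
have pN l : ord_ge N (p l - axis_curve l).
  apply/ord_ge_cf => j jN; rewrite cfD cfN (cf_poly N.+2 (fun i => cf i (axis_curve l))).
  by rewrite ltnW ?subrr // ltnS ltnW.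
have hN l : ord_ge N (fps_holo (p l) - fps_holo (axis_curve l)).
  by rewrite !holoE -fps_compB; exact: ord_ge_comp.
rewrite /realify; case: fintype.split => l a aN.
  have -> : fps_coef (reS (fps_holo (p l)) - reS (fps_holo (axis_curve l))) a =
    complex.Re (fps_coef (fps_holo (p l) - fps_holo (axis_curve l)) a) by exact/esym/raddfB.
  by rewrite hN.
have -> : fps_coef (imS (fps_holo (p l)) - imS (fps_holo (axis_curve l))) a =
  complex.Im (fps_coef (fps_holo (p l) - fps_holo (axis_curve l)) a) by exact/esym/raddfB.
by rewrite hN.
Qed.

Lemma regular_type_infinite : regular_type r = +oo%E.
Proof.
apply/eqyP => x x0; pose N := Num.truncn x; have [gamma gim gN] := high_contact N.+1.
apply: (@le_trans _ _ (vanishing_order (pullback r gamma))); last first.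
  by apply: ereal_sup_ubound; exists gamma.
apply: le_ereal_inf_tmp => _ [a /= ra <-]; rewrite lee_fin.
have aN : (N < mi_deg a)%N.
  by rewrite ltnNge; apply/negP => aN; move/eqP: ra; apply; exact: gN.
apply: (le_trans (ltW (truncnS_gt x))).
by rewrite ler_nat.
Qed.

End HighContact.

Theorem theorem6p1 (R : realType) (n : nat) (S : set 'rV[R]_(n + n))
    (O : formal_submfd (n + n) R) (V : formal_submfd n R[i])
    (S_hyp : smooth_hypersurface S) (S_psc : pseudoconvex S) (S0 : S 0)
    (OV : formally_contained (fideal O) (underlying_real_ideal V))
    (O_generic : [set xi + Jmap eta | xi in tangent0 (fideal O)
                                    & eta in tangent0 (fideal O)] =
                 tangent0 (underlying_real_ideal V))
    (OS : formally_contained (fideal O) (jet_ideal S))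
    (O_tangential : sub_mod (DO O) (jet_HS S) (fideal O))
    (O_type : finite_commutator_type O) :
  formally_contained (underlying_real_ideal V) (jet_ideal S) /\
  ((1 <= fdim V)%N -> infinite_regular_type S).
Proof.
have [d [Phi [Psi [kd Phi0 Psi0 [PhiPsi PsiPhi] VE]]]] := manifold_ideal_chart (fidealP V).
have contact r (dr : defining_function S 0 r) :=
  contact_vanish Phi0 Psi0 PhiPsi PsiPhi VE OV O_generic O_type S_psc S0 dr OS O_tangential.
split.
  have [r dr] := S_hyp 0 S0.
  exact: (jet_inclusion Phi0 Psi0 PhiPsi PsiPhi VE S0 dr (contact r dr)).
move=> V1 r dr; have [r0 _ _] := dr.
have d0 : (0 < d)%N by move: V1; rewrite /fdim; lia.
exact: (regular_type_infinite Phi0 Psi0 PsiPhi r0 (contact r dr) (Ordinal d0)).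
Qed.
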